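(* Let $2\le k\le n$. (1) For 3-Majority, for every initial configuration, with high probability $\tau_{\mathrm{cons}}\le \min\{\sqrt n,k\}\cdot (\log n)^{O(1)}$. Moreover, for every $2\le k\le n$ there is an initial configuration for which, with high probability, $\tau_{\mathrm{cons}}\ge \min\{\sqrt n,k\}/(\log n)^{O(1)}$. (2) For 3-Majority, suppose $k=o(\sqrt n/\log n)$ and the initially most popular opinion is supported by $\omega(\sqrt{n\log n})$ more vertices than any other opinion. Then with high probability 3-Majority reaches consensus on that opinion. (3) For 2-Choices, for every initial configuration, with high probability $\tau_{\mathrm{cons}}\le k\cdot(\log n)^{O(1)}$. Moreover, for every $2\le k\le n$ there is an initial configuration for which, with high probability, $\tau_{\mathrm{cons}}\ge k/(\log n)^{O(1)}$. (4) For 2-Choices, suppose $k=o(n/(\log n)^2)$ and the initially most popular opinion is supported by $\omega(\sqrt{\alpha_1 n\log n})$ more vertices than any other opinion, where $\alpha_1$ is the initial fraction of vertices supporting the most popular opinion. Then with high probability 2-Choices reaches consensus on that opinion.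
   Context: **Setting.** Let $V$ be a set of $n$ vertices and $k\in\{1,\dots,n\}$. A configuration is a map $\mathsf{opn}\colon V\to[k]=\{1,\dots,k\}$. The process is synchronous: each round $t\ge1$ produces $\mathsf{opn}_t$ from $\mathsf{opn}_{t-1}$, and all vertices make their choices independently. **3-Majority.** Each vertex $v$ samples $w_1,w_2,w_3\in V$ independently and uniformly, with replacement. It sets $\mathsf{opn}_t(v)=\mathsf{opn}_{t-1}(w_1)$ if $\mathsf{opn}_{t-1}(w_1)=\mathsf{opn}_{t-1}(w_2)$, and $\mathsf{opn}_t(v)=\mathsf{opn}_{t-1}(w_3)$ otherwise. **2-Choices.** Each vertex $v$ samples $w_1,w_2\in V$ independently and uniformly, with replacement. It sets $\mathsf{opn}_t(v)=\mathsf{opn}_{t-1}(w_1)$ if $\mathsf{opn}_{t-1}(w_1)=\mathsf{opn}_{t-1}(w_2)$, and $\mathsf{opn}_t(v)=\mathsf{opn}_{t-1}(v)$ otherwise. **Consensus time.** $\tau_{\mathrm{cons}}=\inf\{t\ge0:\ \exists i\ \forall v,\ \mathsf{opn}_t(v)=i\}$. **High probability.** ''With high probability'' means with probability $1-O(n^{-c})$ for some constant $c>0$, as $n\to\infty$. Asymptotic notation is with respect to $n\to\infty$. Hidden constants are independent of $n$, $k$ and the initial configuration. *)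

(* Defs.v *)
From HB Require Import structures.
From mathcomp Require Import all_boot all_order all_algebra.
From mathcomp Require Import all_classical all_reals all_analysis.
Set Implicit Arguments. Unset Strict Implicit. Unset Printing Implicit Defensive.
Import Order.TTheory GRing.Theory Num.Theory.
Import numFieldNormedType.Exports.
Local Open Scope ring_scope.

(* Vertex set V = 'I_n, opinions [k] = 'I_k (opinion i+1 is represented by i). *)
Definition config (n k : nat) := {ffun 'I_n -> 'I_k}.

Inductive protocol := ThreeMajority | TwoChoices.

Definition maj3_out n k (c : config n k) (w1 w2 w3 : 'I_n) : 'I_k :=
  if c w1 == c w2 then c w1 else c w3.

Definition choices2_out n k (c : config n k) (v w1 w2 : 'I_n) : 'I_k :=
  if c w1 == c w2 then c w1 else c v.

(* Probability that vertex v adopts opinion i in the next round, given the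
   current configuration c: samples are independent, uniform, with replacement. *)
Definition update_prob (R : realType) (p : protocol) n k (c : config n k)
    (v : 'I_n) (i : 'I_k) : R :=
  match p with
  | ThreeMajority =>
      #|[set w : 'I_n * 'I_n * 'I_n | maj3_out c w.1.1 w.1.2 w.2 == i]|%:R
        / (n%:R ^+ 3)
  | TwoChoices =>
      #|[set w : 'I_n * 'I_n | choices2_out c v w.1 w.2 == i]|%:R
        / (n%:R ^+ 2)
  end.

(* One synchronous round: vertices choose independently. *)
Definition trans (R : realType) (p : protocol) n k (c c' : config n k) : R :=
  \prod_(v : 'I_n) update_prob R p c v (c' v).

Definition traj n k N := {ffun 'I_N.+1 -> config n k}.

Definition traj_weight (R : realType) (p : protocol) n k N (w : traj n k N) : R :=
  \prod_(t < N) trans R p (w (inord t)) (w (inord t.+1)).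

Definition probTraj (R : realType) (p : protocol) n k (c0 : config n k) N
    (E : pred (traj n k N)) : R :=
  \sum_(w : traj n k N | (w ord0 == c0) && E w) traj_weight R p w.

Definition is_consensus n k (c : config n k) : bool :=
  [exists i : 'I_k, [forall v : 'I_n, c v == i]].

Definition consensus_on n k (c : config n k) (i : 'I_k) : bool :=
  [forall v : 'I_n, c v == i].

(* P(tau_cons <= B), for a real B >= 0: tau_cons <= B iff consensus occurs at
   some round t <= truncn B. *)
Definition prob_tau_le (R : realType) (p : protocol) n k (c0 : config n k)
    (B : R) : R :=
  probTraj R p c0 (fun w : traj n k (Num.truncn B) =>
    [exists t, is_consensus (w t)]).

(* P(tau_cons >= x), for a real x >= 0: no consensus at any round t < x
   (all such t are <= truncn x). *)
Definition prob_tau_ge (R : realType) (p : protocol) n k (c0 : config n k)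
    (x : R) : R :=
  probTraj R p c0 (fun w : traj n k (Num.truncn x) =>
    [forall t : 'I_(Num.truncn x).+1, ((nat_of_ord t)%:R < x) ==> ~~ is_consensus (w t)]).

Definition prob_reach_within (R : realType) (p : protocol) n k (c0 : config n k)
    (i : 'I_k) (N : nat) : R :=
  probTraj R p c0 (fun w : traj n k N => [exists t, consensus_on (w t) i]).

Definition prob_reach_on (R : realType) (p : protocol) n k (c0 : config n k)
    (i : 'I_k) : R :=
  limn (prob_reach_within R p c0 i : R^nat).

Definition opinion_count n k (c : config n k) (i : 'I_k) : nat :=
  #|[set v : 'I_n | c v == i]|.

Arguments prob_tau_le R p {n k} c0 B.
Arguments prob_tau_ge R p {n k} c0 x.
Arguments prob_reach_on R p {n k} c0 i.
Arguments prob_reach_within R p {n k} c0 i N.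

(* Main.v *)
Require Import Defs.
From HB Require Import structures.
From mathcomp Require Import all_boot all_order all_algebra.
From mathcomp Require Import all_classical all_reals all_analysis.
From mathcomp Require Import ring lra.
Import Order.TTheory GRing.Theory Num.Theory.
Import numFieldNormedType.Exports.
Local Open Scope ring_scope.
Set Implicit Arguments.
Unset Strict Implicit.
Unset Printing Implicit Defensive.

(** For both protocols, consensus is reached fast because a bounded potential [f (X_i, X_j)],
    evaluated at the counts of a leader [i] and of a living rival [j], has negative drift of order
    [gam >= 1/k] (for 3-Majority also [1/X_j + X_j/n >= 1/sqrt n]) in every configuration. The
    potential sums a slowly growing function of [X_j] (the norm [gam] shrinks small opinions), a
    dyadic family of exponentials of the gap [X_i - X_j] (the multiplicative drift enlarges the gap
    once it exceeds the noise), and a profile that is concave for small gaps (the sampling noise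
    breaks ties); for 2-Choices one more term handles rivals of bounded size. Summing over [j] and
    exploiting that the leader minimises the sum gives a supermartingale although the leader changes.
    All expectations of exponentials of counts are computed from products over the vertices.

    For slowness, from a balanced configuration the sum over opinions of [exp (lam_t X_i - B)], with
    [lam_t] decreasing by a factor [1 + beta] per round, is superharmonic as long as it is below 1.
    For plurality, [sum_j exp (- lam (gap of i over j))] is superharmonic as long as it is below 1,
    so that the fast consensus is reached on [i]. *)

(** * One round and trajectories *)

(** Both protocols give the gap between leader and rival the same expected relative growth, about
    [a + b - gam] for frequencies [a], [b]; only the variances differ. Near a tie the variance is of
    order [n * a] for 3-Majority, so drift beats noise once the gap exceeds [sqrt n], a fixed scale.
    For 2-Choices it is of order [n * a ^+ 2], and the threshold is the square root of the leader's
    count, which moves; hence a dyadic family of profiles, each damped so as to act only while the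
    leader is small enough for its scale. The obstacle is that noise raises every exponential of the
    gap, so that at a tie exponentials alone have no negative drift. Only a profile concave along
    the noise turns variance into a gain, and its cost outside the concave window has to be paid by
    the other terms. This dictates a hierarchy of weights, all absolute constants. Boundedness
    matters too: a potential lying between a constant and O(log n) converts additive drift into
    geometric decay, and the sum over at most [n] rivals then costs only one more logarithm. *)

Section OneRound.
Context {R : realType}.
Variables (p : protocol) (n k : nat).
Implicit Types (c : config n k) (f g : config n k -> R).
Hypothesis n_gt0 : (0 < n)%N.

Definition expect c f : R := \sum_c' trans R p c c' * f c'.

Lemma update_prob_ge0 c v o : 0 <= update_prob R p c v o.
Proof. by rewrite /update_prob; case: p; rewrite divr_ge0 // exprn_ge0. Qed.

Lemma sum_card_preim (T : finType) (h : T -> 'I_k) :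
  \sum_o #|[set w | h w == o]|%:R = #|T|%:R :> R.
Proof.
rewrite -natr_sum; congr (_%:R).
rewrite -[RHS]sum1_card (partition_big h predT) //=.
apply: eq_bigr => o _; rewrite -sum1_card.
by apply: eq_bigl => w; rewrite inE.
Qed.

Lemma update_prob_sum1 c v : \sum_o update_prob R p c v o = 1.
Proof.
have n0 : n%:R != 0 :> R by rewrite pnatr_eq0 -lt0n.
rewrite /update_prob; case: p; rewrite -mulr_suml sum_card_preim !card_prod card_ord !natrM.
  by field.
by field.
Qed.

Lemma trans_ge0 c c' : 0 <= trans R p c c'.
Proof. by apply: prodr_ge0 => v _; exact: update_prob_ge0. Qed.

Lemma expect_prod c (phi : 'I_n -> 'I_k -> R) :
  expect c (fun c' => \prod_v phi v (c' v)) =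
  \prod_v \sum_o update_prob R p c v o * phi v o.
Proof.
rewrite bigA_distr_bigA /expect; apply: eq_bigr => c' _.
by rewrite /trans big_split.
Qed.

Lemma expect_cst c (a : R) : expect c (fun=> a) = a.
Proof.
rewrite /expect -mulr_suml.
suff -> : \sum_c' trans R p c c' = 1 by rewrite mul1r.
rewrite /trans -(bigA_distr_bigA (fun v o => update_prob R p c v o)).
by rewrite big1 // => v _; exact: update_prob_sum1.
Qed.

Lemma eq_expect c f g : f =1 g -> expect c f = expect c g.
Proof. by move=> fg; apply: eq_bigr => c' _; rewrite fg. Qed.

Lemma ler_expect c f g : (forall c', f c' <= g c') -> expect c f <= expect c g.
Proof. by move=> fg; apply: ler_sum => c' _; rewrite ler_wpM2l ?trans_ge0. Qed.

Lemma expect_ge0 c f : (forall c', 0 <= f c') -> 0 <= expect c f.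
Proof. by move=> f0; apply: sumr_ge0 => c' _; rewrite mulr_ge0 ?trans_ge0. Qed.

Lemma expectD c f g : expect c (fun c' => f c' + g c') = expect c f + expect c g.
Proof. by rewrite /expect -big_split; apply: eq_bigr => c' _; rewrite mulrDr. Qed.

Lemma expectZ c (a : R) f : expect c (fun c' => a * f c') = a * expect c f.
Proof. by rewrite /expect mulr_sumr; apply: eq_bigr => c' _; rewrite mulrCA. Qed.

Lemma expectN c f : expect c (fun c' => - f c') = - expect c f.
Proof. by rewrite /expect -sumrN; apply: eq_bigr => c' _; rewrite mulrN. Qed.

Lemma expectB c f g : expect c (fun c' => f c' - g c') = expect c f - expect c g.
Proof. by rewrite expectD expectN. Qed.

Lemma expect_sum c (I : Type) (r : seq I) (P : pred I) (F : I -> config n k -> R) :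
  expect c (fun c' => \sum_(i <- r | P i) F i c') = \sum_(i <- r | P i) expect c (F i).
Proof.
by rewrite /expect exchange_big; apply: eq_bigr => c' _; rewrite mulr_sumr.
Qed.

(** Probability that [P] holds at one of the times 0, ..., [N], by recursion on the first step. Time
    0 is included, so [N] rounds examine [N.+1] configurations, as a trajectory does. In this form
    supermartingale arguments are inductions on the horizon. *)
Fixpoint hit (P : pred (config n k)) (N : nat) c : R :=
  if P c then 1 else if N is N'.+1 then expect c (hit P N') else 0.

Lemma hit_ge0 P N c : 0 <= hit P N c.
Proof.
elim: N c => [|N IH] c /=; case: (P c) => //.
exact: expect_ge0.
Qed.

Lemma hit_le1 P N c : hit P N c <= 1.
Proof.
elim: N c => [|N IH] c /=; case: (P c) => //.
by rewrite -(expect_cst c 1); exact: ler_expect.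
Qed.

Lemma hitS_ge P N c : hit P N c <= hit P N.+1 c.
Proof.
elim: N c => [|N IH] c /=; case: (P c) => //.
  by apply: expect_ge0 => c'; exact: (hit_ge0 P 0).
by apply: ler_expect => c'; exact: (IH c').
Qed.

Lemma hit_nondecreasing P c : {homo (fun N => hit P N c) : N M / (N <= M)%N >-> N <= M}.
Proof. exact: homo_leq (fun=> lexx _) (fun _ _ _ => @le_trans _ _ _ _ _) (hitS_ge P ^~ c). Qed.

End OneRound.

Lemma ord_I1 (t : 'I_1) : t = ord0.
Proof. by apply: val_inj; case: t => -[]. Qed.

Section Trajectories.
Context {R : realType}.
Variables (p : protocol) (n k : nat).
Implicit Types (c : config n k).

Definition traj_cons N (x : config n k * traj n k N) : traj n k N.+1 :=
  [ffun t => if unlift ord0 t is Some s then x.2 s else x.1].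

Definition traj_uncons N (w : traj n k N.+1) : config n k * traj n k N :=
  (w ord0, [ffun t => w (lift ord0 t)]).

Lemma traj_consK N : cancel (@traj_cons N) (@traj_uncons N).
Proof.
case=> c w; rewrite /traj_uncons /traj_cons /= ffunE unlift_none; congr pair.
by apply/ffunP => t; rewrite !ffunE liftK.
Qed.

Lemma traj_unconsK N : cancel (@traj_uncons N) (@traj_cons N).
Proof.
move=> w; apply/ffunP => t; rewrite ffunE.
by case: unliftP => [s ->|->] //=; rewrite ffunE.
Qed.

Lemma traj_cons0 N x : @traj_cons N x ord0 = x.1.
Proof. by rewrite ffunE unlift_none. Qed.

Lemma traj_consS N x (t : 'I_N.+1) : @traj_cons N x (lift ord0 t) = x.2 t.
Proof. by rewrite ffunE liftK. Qed.

Lemma traj_cons_inord N x t : (t < N.+1)%N ->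
  @traj_cons N x (inord t.+1) = x.2 (inord t).
Proof.
move=> tN; rewrite -(traj_consS x); congr (traj_cons x _).
by apply: val_inj; rewrite /= /bump /= !inordK // ltnS.
Qed.

Lemma traj_weight_cons N (x : config n k * traj n k N) :
  traj_weight R p (traj_cons x) = trans R p x.1 (x.2 ord0) * traj_weight R p x.2.
Proof.
rewrite /traj_weight big_ord_recl.
have e0 : inord (ord0 : 'I_N.+1) = ord0 :> 'I_N.+2.
  by apply: val_inj; rewrite /= inordK.
have e1 : inord 0 = ord0 :> 'I_N.+1 by apply: val_inj; rewrite /= inordK.
congr (_ * _).
  by rewrite /= e0 traj_cons0 traj_cons_inord // e1.
apply: eq_bigr => t _; rewrite !lift0 traj_cons_inord; last by rewrite ltnW // ltnS.
by rewrite traj_cons_inord // ltnS.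
Qed.

(** Markov property at the first step: removing the first configuration leaves one transition times
    the weight of a shorter trajectory. This bridge allows the probabilistic arguments to be carried
    out with [hit]. *)
Lemma probTraj_exists (P : pred (config n k)) N c :
  (0 < n)%N ->
  probTraj R p c (fun w : traj n k N => [exists t, P (w t)]) = hit p P N c.
Proof.
move=> n0; elim: N c => [|N IH] c.
  rewrite /probTraj /=.
  have -> : (\sum_(w : traj n k 0 | (w ord0 == c) && [exists t, P (w t)]) traj_weight R p w)
      = \sum_(w : traj n k 0 | (w == [ffun=> c]) && P c) traj_weight R p w.
    apply: eq_bigl => w; apply/andP/andP => -[].
      move=> /eqP wc /existsP[t Pt]; rewrite -wc; split.
        by apply/eqP/ffunP => s; rewrite ffunE (ord_I1 s).
      by rewrite (ord_I1 t) in Pt.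
    move=> /eqP -> Pc; split; first by rewrite ffunE.
    by apply/existsP; exists ord0; rewrite ffunE.
  case: (P c).
    under eq_bigl do rewrite andbT.
    by rewrite big_pred1_eq /traj_weight big_ord0.
  by under eq_bigl do rewrite andbF; rewrite big_pred0_eq.
have split_first : probTraj R p c (fun w : traj n k N.+1 => [exists t, P (w t)]) =
    \sum_c' trans R p c c' *
      probTraj R p c' (fun w : traj n k N => P c || [exists t, P (w t)]).
  rewrite /probTraj (reindex (@traj_cons N)); last first.
    by exists (@traj_uncons N) => x _; [exact: traj_consK|exact: traj_unconsK].
  have -> : \sum_(x : config n k * traj n k N | (traj_cons x ord0 == c) &&
        [exists t, P (traj_cons x t)]) traj_weight R p (traj_cons x) =
      \sum_(x : config n k * traj n k N | (x.1 == c) && (P c || [exists t, P (x.2 t)]))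
        trans R p x.1 (x.2 ord0) * traj_weight R p x.2.
    apply: eq_big => [x|x _]; last exact: traj_weight_cons.
    rewrite traj_cons0; case: eqP => //= xc.
    apply/existsP/orP => [[t]|[Pc|/existsP[t Pt]]].
    - by case: (unliftP ord0 t) => [s ->|->];
        rewrite ?traj_consS ?traj_cons0 ?xc; [right; apply/existsP; exists s|left].
    - by exists ord0; rewrite traj_cons0 xc.
    - by exists (lift ord0 t); rewrite traj_consS.
  rewrite -(pair_big (fun c1 => c1 == c) (fun w : traj n k N => P c || [exists t, P (w t)])
     (fun c1 (w : traj n k N) => trans R p c1 (w ord0) * traj_weight R p w)) /=.
  rewrite big_pred1_eq (partition_big (fun w : traj n k N => w ord0) predT) //=.
  apply: eq_bigr => c' _; rewrite mulr_sumr.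
  apply: eq_big => [w|w /andP[_ /eqP <-]] //; exact: andbC.
rewrite split_first /=.
case Pc: (P c); last by apply: eq_bigr => c' _; rewrite -IH.
(* If [P] already holds at the start, the remaining event is certain, and what is left is that the
   trajectory weights sum to 1. *)
have total m c' : probTraj R p c' (fun w : traj n k m => true) = 1.
  move: m c'; elim=> [|m IHm] c'.
    rewrite /probTraj (big_pred1 [ffun=> c']) ?/traj_weight ?big_ord0 // => w /=.
    rewrite andbT; apply/eqP/eqP => [<-|->]; last by rewrite ffunE.
    by apply/ffunP => s; rewrite ffunE (ord_I1 s).
  rewrite /probTraj (reindex (@traj_cons m)); last first.
    by exists (@traj_uncons m) => x _; [exact: traj_consK|exact: traj_unconsK].
  under eq_bigl do rewrite traj_cons0.
  under eq_bigr do rewrite traj_weight_cons.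
  rewrite -(pair_big (fun c1 => c1 == c') (fun w : traj n k m => true)
     (fun c1 (w : traj n k m) => trans R p c1 (w ord0) * traj_weight R p w)) /=.
  rewrite big_pred1_eq (partition_big (fun w : traj n k m => w ord0) predT) //=.
  rewrite -[RHS](expect_cst p n0 c' (1 : R)); apply: eq_bigr => c1 _.
  rewrite -(IHm c1) mulr_sumr.
  by apply: eq_big => [w|w /eqP ->]; rewrite ?andbT.
rewrite -[RHS](expect_cst p n0 c (1 : R)); apply: eq_bigr => c' _; congr (_ * _).
exact: total.
Qed.

End Trajectories.

(** * Exponential inequalities *)

(** The exponential estimates form a ladder: both sides agree at 0, and the derivative of the
    difference is controlled by an earlier estimate. *)
Lemma nonneg_of_derive (R : realType) (F G : R -> R) (b : R) :
  (forall x : R, is_derive x (1 : R) F (G x)) -> (forall x : R, 0 <= x <= b -> 0 <= G x) ->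
  F 0 = 0 -> forall x : R, 0 <= x <= b -> 0 <= F x.
Proof.
move=> dF G0 F0 x /andP[x0 xb]; rewrite -F0.
apply: (@ger0_derive1_ndecr R F 0 x) => //.
- move=> y; rewrite in_itv /= => /andP[y0 yx].
  rewrite derive1E (@derive_val _ _ _ _ _ _ _ (dF y)) G0 // (ltW y0) /=.
  by rewrite (le_trans (ltW yx)).
- apply: continuous_subspaceT => y; apply: differentiable_continuous.
  by apply/derivable1_diffP; case: (dF y).
Qed.

Section ExpBounds.
Context {R : realType}.
Implicit Type x : R.

Lemma expR_ge_quad x : 0 <= x -> 1 + x + x ^+ 2 / 2 <= expR x.
Proof.
move=> x0; rewrite -subr_ge0.
apply: (@nonneg_of_derive R (fun y => expR y - (1 + y + y ^+ 2 / 2))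
  (fun y => expR y - (1 + y)) x) => [y|y _||]; last by rewrite x0 lexx.
- apply: is_derive_eq; rewrite /GRing.scale /=; lra.
- by rewrite subr_ge0 expR_ge1Dx.
- by rewrite expR0; lra.
Qed.

Lemma expR_le_inv x : x < 1 -> expR x <= (1 - x)^-1.
Proof.
move=> x1; have := expR_ge1Dx (- x); rewrite expRN => h.
rewrite -[leLHS]invrK lef_pV2 ?posrE ?invr_gt0 ?expR_gt0 //; lra.
Qed.

Lemma expR_le_cubic x : 0 <= x <= 1 / 3 -> expR x <= 1 + x + x ^+ 2 / 2 + x ^+ 3 / 2.
Proof.
move=> x0; rewrite -subr_ge0.
apply: (@nonneg_of_derive R (fun y => 1 + y + y ^+ 2 / 2 + y ^+ 3 / 2 - expR y)
  (fun y => 1 + y + 3 / 2 * y ^+ 2 - expR y) (1 / 3)) => [y|y /andP[y0 y3]||] //.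
- apply: is_derive_eq; rewrite /GRing.scale /=; lra.
- rewrite subr_ge0 (le_trans (expR_le_inv _)) //; first by lra.
  rewrite -div1r ler_pdivrMr; nra.
- by rewrite expR0; lra.
Qed.

Lemma expRN_le_quad x : 0 <= x -> expR (- x) <= 1 - x + x ^+ 2 / 2.
Proof.
move=> x0; rewrite -subr_ge0.
apply: (@nonneg_of_derive R (fun y => 1 - y + y ^+ 2 / 2 - expR (- y))
  (fun y => expR (- y) - (1 - y)) x) => [y|y _||]; last by rewrite x0 lexx.
- apply: is_derive_eq; rewrite /GRing.scale /=; lra.
- by rewrite subr_ge0 expR_ge1Dx.
- by rewrite oppr0 expR0; lra.
Qed.

Lemma expRN_ge_cubic x : 0 <= x -> 1 - x + x ^+ 2 / 2 - x ^+ 3 / 2 <= expR (- x).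
Proof.
move=> x0; rewrite -subr_ge0.
apply: (@nonneg_of_derive R (fun y => expR (- y) - (1 - y + y ^+ 2 / 2 - y ^+ 3 / 2))
  (fun y => 1 - y + 3 / 2 * y ^+ 2 - expR (- y)) x) => [y|y /andP[y0 _]||]; last by rewrite x0 lexx.
- apply: is_derive_eq; rewrite /GRing.scale /=; lra.
- have := expRN_le_quad y0; nra.
- by rewrite oppr0 expR0; lra.
Qed.

(** The cubic remainder is absorbed into the quadratic term as a relative error [h]. The constant
    and linear terms stay exact, so that after centring the mean enters without error and only the
    variance is perturbed. *)
Lemma expR_quad_bounds x h : `|x| <= h -> h <= 1 / 3 ->
  1 + x + x ^+ 2 / 2 * (1 - h) <= expR x <= 1 + x + x ^+ 2 / 2 * (1 + h).
Proof.
move=> xh h3; have [x0|x0] := leP 0 x.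
  rewrite ger0_norm // in xh.
  have /expR_le_cubic : 0 <= x <= 1 / 3 by lra.
  have := expR_ge_quad x0.
  have x2 : 0 <= x ^+ 2 by rewrite sqr_ge0.
  by move=> h1 h2; apply/andP; split; nra.
rewrite ltr0_norm // in xh.
have nx0 : 0 <= - x by lra.
have := expRN_ge_cubic nx0; have := expRN_le_quad nx0; rewrite opprK.
by move=> h1 h2; apply/andP; split; nra.
Qed.

End ExpBounds.

(** * Opinion counts and frequencies *)

Section Frequencies.
Context {R : realType}.
Variables (n k : nat).
Implicit Types (c : config n k) (o i j : 'I_k) (v : 'I_n).

Definition cnt c o : R := (opinion_count c o)%:R.
Definition freq c o : R := cnt c o / n%:R.
(** The probability that two independent samples agree. It is also the frequency-weighted mean of
    the frequencies, and a living opinion grows in expectation exactly when its frequency exceeds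
    it. *)
Definition gam c : R := \sum_o freq c o ^+ 2.

Local Notation ind c v o := ((c v == o)%:R : R).

Lemma natr_card_set (T : finType) (P : pred T) :
  #|[set w | P w]|%:R = \sum_w (P w)%:R :> R.
Proof. by rewrite -sum1_card natr_sum big_mkcond; apply: eq_bigr => w _; rewrite inE; case: (P w). Qed.

Lemma cntE c o : cnt c o = \sum_v ind c v o.
Proof. exact: natr_card_set. Qed.

Lemma ind_sum1 c v : \sum_o ind c v o = 1.
Proof.
rewrite (bigD1 (c v)) //= eqxx big1 ?addr0 // => o.
by rewrite eq_sym => /negbTE ->.
Qed.

Lemma cnt_sum c : \sum_o cnt c o = n%:R.
Proof.
under eq_bigr do rewrite cntE.
rewrite exchange_big /=; under eq_bigr do rewrite ind_sum1.
by rewrite sumr_const card_ord.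
Qed.

Lemma cnt_ge0 c o : 0 <= cnt c o. Proof. exact: ler0n. Qed.

Lemma sum_agree c : \sum_v \sum_w ((c v == c w)%:R : R) = \sum_o cnt c o ^+ 2.
Proof.
have -> : \sum_o cnt c o ^+ 2 = \sum_o \sum_v \sum_w ind c v o * ind c w o.
  apply: eq_bigr => o _; rewrite expr2 {1}cntE mulr_suml; apply: eq_bigr => v _.
  by rewrite cntE mulr_sumr.
rewrite [RHS]exchange_big /=; apply: eq_bigr => v _; rewrite [RHS]exchange_big /=.
apply: eq_bigr => w _; rewrite (bigD1 (c v)) //= big1 ?addr0.
  by rewrite eqxx mul1r eq_sym.
by move=> o; rewrite eq_sym => /negbTE ->; rewrite mul0r.
Qed.

Lemma sum_agree_on c o : \sum_v \sum_w (((c v == c w) && (c v == o))%:R : R) = cnt c o ^+ 2.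
Proof.
rewrite expr2 {1}cntE mulr_suml; apply: eq_bigr => v _.
rewrite cntE mulr_sumr; apply: eq_bigr => w _.
case: (c v =P o) => [->|_]; last by rewrite andbF mul0r.
by rewrite andbT mul1r eq_sym.
Qed.

Hypothesis n_gt0 : (0 < n)%N.

Let n_neq0 : n%:R != 0 :> R. Proof. by rewrite pnatr_eq0 -lt0n. Qed.

Lemma gamE c : gam c * n%:R ^+ 2 = \sum_o cnt c o ^+ 2.
Proof.
by rewrite mulr_suml; apply: eq_bigr => o _; rewrite /freq; field.
Qed.

Lemma update_prob_maj3 c v o :
  update_prob R ThreeMajority c v o = freq c o * (1 + freq c o - gam c).
Proof.
rewrite /update_prob natr_card_set.
rewrite -(pair_bigA _ (fun w12 w3 => ((maj3_out c w12.1 w12.2 w3 == o)%:R : R))) /=.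
rewrite -(pair_bigA _ (fun w1 w2 => \sum_w3 ((maj3_out c w1 w2 w3 == o)%:R : R))) /=.
have -> : \sum_w1 \sum_w2 \sum_w3 ((maj3_out c w1 w2 w3 == o)%:R : R) =
    \sum_w1 \sum_w2 (n%:R * ((c w1 == c w2) && (c w1 == o))%:R
      + (1 - (c w1 == c w2)%:R) * cnt c o).
  apply: eq_bigr => w1 _; apply: eq_bigr => w2 _; rewrite /maj3_out.
  case: (c w1 == c w2); rewrite /= ?mulr1n ?mulr0n.
    by rewrite sumr_const card_ord -[_ *+ n]mulr_natl subrr mul0r addr0.
  by rewrite cntE mulr0 add0r subr0 mul1r.
under eq_bigr do rewrite big_split /= -mulr_sumr -mulr_suml sumrB sumr_const card_ord.
rewrite big_split /= -mulr_sumr -mulr_suml sum_agree_on sumrB sum_agree sumr_const card_ord.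
rewrite -gamE /freq -[_ *+ n]mulr_natl; field.
exact: n_neq0.
Qed.

Lemma update_prob_choices2 c v o :
  update_prob R TwoChoices c v o = freq c o ^+ 2 + (c v == o)%:R * (1 - gam c).
Proof.
rewrite /update_prob natr_card_set.
rewrite -(pair_bigA _ (fun w1 w2 => ((choices2_out c v w1 w2 == o)%:R : R))) /=.
have -> : \sum_w1 \sum_w2 ((choices2_out c v w1 w2 == o)%:R : R) =
    \sum_w1 \sum_w2 (((c w1 == c w2) && (c w1 == o))%:R
      + (1 - (c w1 == c w2)%:R) * ind c v o).
  apply: eq_bigr => w1 _; apply: eq_bigr => w2 _; rewrite /choices2_out.
  case: (c w1 == c w2); rewrite /= ?mulr1n ?mulr0n.
    by rewrite subrr mul0r addr0.
  by rewrite add0r subr0 mul1r.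
under eq_bigr do rewrite big_split /= -mulr_suml sumrB sumr_const card_ord.
rewrite big_split /= -mulr_suml sum_agree_on sumrB sum_agree sumr_const card_ord.
rewrite -gamE /freq -[_ *+ n]mulr_natl; field.
exact: n_neq0.
Qed.

(** The protocols differ only when the first two samples disagree: a fresh sample is followed, or
    the vertex's own opinion. Summed over the vertices, both reproduce the current frequencies, so
    the drift is common to the two protocols. *)
Lemma mean_update p c o :
  \sum_v update_prob R p c v o = cnt c o * (1 + freq c o - gam c).
Proof.
case: p.
  under eq_bigr do rewrite update_prob_maj3.
  by rewrite sumr_const card_ord -[_ *+ n]mulr_natl /freq; field.
under eq_bigr do rewrite update_prob_choices2.
rewrite big_split /= sumr_const card_ord -mulr_suml -cntE -[_ *+ n]mulr_natl /freq; field.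
exact: n_neq0.
Qed.

Lemma freq_ge0 c o : 0 <= freq c o. Proof. by rewrite divr_ge0 ?cnt_ge0. Qed.

Lemma freq_sum1 c : \sum_o freq c o = 1.
Proof. by rewrite -mulr_suml cnt_sum divff. Qed.

Lemma cnt_freq c o : cnt c o = n%:R * freq c o.
Proof. by rewrite /freq mulrCA divff // mulr1. Qed.

Lemma freq_le1 c o : freq c o <= 1.
Proof.
rewrite -(freq_sum1 c) (bigD1 o) //= lerDl; apply: sumr_ge0 => j _; exact: freq_ge0.
Qed.

Lemma freq_add_le1 c i j : i != j -> freq c i + freq c j <= 1.
Proof.
move=> ij; rewrite -(freq_sum1 c) (bigD1 i) //= (bigD1 j) 1?eq_sym //= addrA lerDl.
by apply: sumr_ge0 => o _; exact: freq_ge0.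
Qed.

Lemma gam_ge_pair c i j : i != j -> freq c i ^+ 2 + freq c j ^+ 2 <= gam c.
Proof.
move=> ij; rewrite /gam (bigD1 i) //= (bigD1 j) 1?eq_sym //= addrA lerDl.
by apply: sumr_ge0 => o _; exact: sqr_ge0.
Qed.

Lemma gam_ge_sq c i : freq c i ^+ 2 <= gam c.
Proof. by rewrite /gam (bigD1 i) //= lerDl; apply: sumr_ge0 => o _; exact: sqr_ge0. Qed.

Lemma gam_le_freq c (b : R) : (forall o, freq c o <= b) -> gam c <= b.
Proof.
move=> fb; rewrite -[b]mul1r -(freq_sum1 c) mulr_suml.
by apply: ler_sum => o _; rewrite expr2 ler_wpM2l ?freq_ge0.
Qed.

Lemma gam_le1 c : gam c <= 1. Proof. exact: gam_le_freq (freq_le1 c). Qed.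

Lemma gam_ge0 c : 0 <= gam c. Proof. by apply: sumr_ge0 => o _; exact: sqr_ge0. Qed.

(** Cauchy-Schwarz, as non-negativity of the squared deviations from the uniform distribution. *)
Lemma gam_ge_invk c : k%:R^-1 <= gam c.
Proof.
have k0 : (0 < k)%N by apply: leq_ltn_trans (ltn_ord (c (Ordinal n_gt0))).
have kR : k%:R != 0 :> R by rewrite pnatr_eq0 -lt0n.
have : 0 <= \sum_o (freq c o - k%:R^-1) ^+ 2 by apply: sumr_ge0 => o _; exact: sqr_ge0.
have -> : \sum_o (freq c o - k%:R^-1) ^+ 2 =
    gam c - 2 * k%:R^-1 * \sum_o freq c o + k%:R^-1 ^+ 2 * k%:R.
  transitivity (\sum_o (freq c o ^+ 2 + - (2 * k%:R^-1) * freq c o + k%:R^-1 ^+ 2)).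
    by apply: eq_bigr => o _; ring.
  rewrite !big_split /= -mulr_sumr sumr_const card_ord -[_ *+ k]mulr_natr /gam; ring.
rewrite freq_sum1; have -> : k%:R^-1 ^+ 2 * k%:R = k%:R^-1 :> R by field.
lra.
Qed.

(** Counts are integers, so none exceeds its square. *)
Lemma gam_ge_invn c : n%:R^-1 <= gam c.
Proof.
have : \sum_o cnt c o <= \sum_o cnt c o ^+ 2.
  apply: ler_sum => o _; rewrite /cnt -natrX ler_nat.
  by case: (opinion_count c o) => // m; rewrite expnS leq_pmulr ?expn_gt0.
rewrite cnt_sum -gamE => h.
have n0 : 0 < n%:R :> R by rewrite ltr0n.
rewrite -(ler_pM2r (exprn_gt0 2 n0)); apply: le_trans h.
by rewrite expr2 mulrA mulVf // mul1r.
Qed.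

Lemma sum_by_class (F : bool -> bool -> R) c i j : i != j ->
  \sum_v F (c v == i) (c v == j) =
  cnt c i * F true false + cnt c j * F false true
  + (n%:R - cnt c i - cnt c j) * F false false.
Proof.
move=> ij.
have -> : \sum_v F (c v == i) (c v == j) = \sum_v (ind c v i * (F true false - F false false)
    + ind c v j * (F false true - F false false) + F false false).
  apply: eq_bigr => v _; case: (c v =P i) => [->|_].
    by rewrite (negbTE ij) /=; ring.
  by case: eqP => _ /=; ring.
rewrite !big_split /= -!mulr_suml -!cntE sumr_const card_ord -[_ *+ n]mulr_natl; ring.
Qed.

End Frequencies.

(** * Laplace transforms of counts *)

Section CenteredExponentials.
Context {R : realType} {I : finType}.
Variables (w z : I -> R) (h : R).
Hypotheses (w_ge0 : forall o, 0 <= w o) (w_sum1 : \sum_o w o = 1).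

Let m := \sum_o w o * z o.
Let V := \sum_o w o * z o ^+ 2 - m ^+ 2.

Lemma variance_centered : \sum_o w o * (z o - m) ^+ 2 = V.
Proof.
transitivity (\sum_o (w o * z o ^+ 2 + - (2 * m) * (w o * z o) + m ^+ 2 * w o)).
  by apply: eq_bigr => o _; ring.
rewrite !big_split /= -!mulr_sumr w_sum1 -/m /V; ring.
Qed.

Lemma variance_ge0 : 0 <= V.
Proof. by rewrite -variance_centered; apply: sumr_ge0 => o _; rewrite mulr_ge0 ?sqr_ge0. Qed.

Hypotheses (z_le : forall o, `|z o| <= h) (h_le : h <= 1 / 6).

(** Centring at [m] factors out [expR m] exactly. The centred variable is bounded by [2 * h], which
    explains the factor 2 and the bound 1/6: [expR_quad_bounds] asks for [2 * h <= 1 / 3]. *)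
Lemma mean_exp_bounds :
  expR m * (1 + V / 2 * (1 - 2 * h)) <= \sum_o w o * expR (z o)
    <= expR m * (1 + V / 2 * (1 + 2 * h)).
Proof.
have m_le : `|m| <= h.
  apply: le_trans (ler_norm_sum _ _ _) _.
  rewrite -[h]mul1r -w_sum1 mulr_suml; apply: ler_sum => o _.
  by rewrite normrM ger0_norm // ler_wpM2l.
have c_le o : `|z o - m| <= 2 * h.
  by apply: le_trans (ler_normB _ _) _; rewrite mulr_natl mulr2n lerD.
have -> : \sum_o w o * expR (z o) = expR m * \sum_o w o * expR (z o - m).
  rewrite mulr_sumr; apply: eq_bigr => o _.
  by rewrite mulrCA -expRD addrC subrK.
have lin e : \sum_o w o * (1 + (z o - m) + (z o - m) ^+ 2 / 2 * e) = 1 + V / 2 * e.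
  transitivity (\sum_o (w o * (1 - m) + w o * z o + w o * (z o - m) ^+ 2 * (e / 2))).
    by apply: eq_bigr => o _; field.
  by rewrite !big_split /= -!mulr_suml w_sum1 variance_centered -/m; field.
have h3 : 2 * h <= 1 / 3 by have := h_le; lra.
have bd o := expR_quad_bounds (c_le o) h3.
apply/andP; split; rewrite ler_wpM2l ?expR_ge0 // -lin; apply: ler_sum => o _;
  by rewrite ler_wpM2l //; case/andP: (bd o).
Qed.

End CenteredExponentials.

Lemma prod_le_expR_sum (R : realType) (I : finType) (x : I -> R) :
  (forall v, 0 <= 1 + x v) -> \prod_v (1 + x v) <= expR (\sum_v x v).
Proof.
move=> x0; rewrite expR_sum; apply: ler_prod => v _.
by rewrite x0 expR_ge1Dx.
Qed.

Lemma prod_ge_1Dsum (R : realType) (I : finType) (x : I -> R) :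
  (forall v, 0 <= x v) -> 1 + \sum_v x v <= \prod_v (1 + x v).
Proof.
move=> x0; rewrite -!(big_enum) /=.
elim: (enum I) => [|v s IH]; first by rewrite !big_nil addr0.
rewrite !big_cons.
have s0 : 0 <= \sum_(j <- s) x j by apply: sumr_ge0.
have := x0 v; have := IH; set P := \prod_(j <- s) _; set S := \sum_(j <- s) _ in s0 *.
nra.
Qed.

Section Laplace.
Context {R : realType}.
Variables (p : protocol) (n k : nat).
Hypothesis n_gt0 : (0 < n)%N.
Implicit Types (c : config n k) (o i j : 'I_k).

(** For [i != j], the variance of [al * cnt c' i - be * cnt c' j] after one round from [c]: the
    vertices are independent, and each contributes the variance of a variable with values [al],
    [- be] and 0. *)
Definition pair_var c i j (al be : R) : R :=
  \sum_v (al ^+ 2 * update_prob R p c v i + be ^+ 2 * update_prob R p c v j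
          - (al * update_prob R p c v i - be * update_prob R p c v j) ^+ 2).

Definition mean_cnt c o : R := cnt c o * (1 + freq c o - gam c).

Definition tilt i j (al be : R) o : R := be * (o == j)%:R - al * (o == i)%:R.

Lemma expect_expR_sum c (zeta : 'I_k -> R) :
  expect p c (fun c' => expR (\sum_v zeta (c' v))) =
  \prod_v \sum_o update_prob R p c v o * expR (zeta o).
Proof.
rewrite -(expect_prod p c (fun _ o => expR (zeta o))); apply: eq_expect => c'.
exact: expR_sum.
Qed.

Lemma sum_tilt c i j al be :
  \sum_v tilt i j al be (c v) = be * cnt c j - al * cnt c i.
Proof. by rewrite !cntE !mulr_sumr -sumrB. Qed.

Lemma sum_pick (q : 'I_k -> R) i : \sum_o q o * (o == i)%:R = q i.
Proof.
rewrite (bigD1 i) //= eqxx mulr1 big1 ?addr0 // => o /negbTE ->.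
by rewrite mulr0.
Qed.

Lemma tilt_mean (q : 'I_k -> R) i j al be :
  \sum_o q o * tilt i j al be o = be * q j - al * q i.
Proof.
rewrite -[X in be * X]sum_pick -[X in al * X]sum_pick !mulr_sumr -sumrB.
apply: eq_bigr => o _; rewrite /tilt; ring.
Qed.

Lemma tilt_sqr (q : 'I_k -> R) i j al be : i != j ->
  \sum_o q o * tilt i j al be o ^+ 2 = al ^+ 2 * q i + be ^+ 2 * q j.
Proof.
move=> ij; rewrite -[X in _ ^+ 2 * X]sum_pick -[X in _ + _ ^+ 2 * X]sum_pick !mulr_sumr -big_split.
apply: eq_bigr => o _; rewrite /tilt /=.
case: (o =P i) => [->|_]; first by rewrite (negbTE ij) /=; ring.
by case: eqP => _ /=; ring.
Qed.

Lemma tilt_le i j al be h o : i != j -> 0 <= al <= h -> 0 <= be <= h ->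
  `|tilt i j al be o| <= h.
Proof.
move=> ij /andP[a0 ah] /andP[b0 bh]; rewrite /tilt.
case: (o =P i) => [->|_].
  by rewrite (negbTE ij) mulr0 sub0r mulr1 normrN ger0_norm.
by case: eqP => _; rewrite ?mulr1 ?mulr0 subr0 ?ger0_norm ?normr0 // (le_trans b0).
Qed.

Lemma pair_varE c i j al be : i != j -> pair_var c i j al be =
  \sum_v (\sum_o update_prob R p c v o * tilt i j al be o ^+ 2
          - (\sum_o update_prob R p c v o * tilt i j al be o) ^+ 2).
Proof.
move=> ij; apply: eq_bigr => v _; rewrite tilt_sqr // tilt_mean; ring.
Qed.

Lemma pair_var_ge0 c i j al be : i != j -> 0 <= pair_var c i j al be.
Proof.
move=> ij; rewrite pair_varE //; apply: sumr_ge0 => v _.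
by apply: variance_ge0; [move=> o; exact: update_prob_ge0|exact: update_prob_sum1].
Qed.

(** The expectation is a product over the vertices, each factor controlled by [mean_exp_bounds]. The
    two sides are closed differently: a product of factors above 1 dominates 1 plus the sum of the
    excesses, and is dominated by the exponential of that sum. *)
Lemma laplace_bounds c i j al be h :
  i != j -> 0 <= al <= h -> 0 <= be <= h -> h <= 1 / 6 ->
  expR (be * mean_cnt c j - al * mean_cnt c i)
      * (1 + pair_var c i j al be / 2 * (1 - 2 * h))
    <= expect p c (fun c' => expR (be * cnt c' j - al * cnt c' i))
    <= expR (be * mean_cnt c j - al * mean_cnt c i
             + pair_var c i j al be / 2 * (1 + 2 * h)).
Proof.
move=> ij alh beh h6.
set E := expect _ _ _; set mu := _ - _.
have h0 : 0 <= h by case/andP: alh => /le_trans; apply.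
pose q v := update_prob R p c v.
pose m v := \sum_o q v o * tilt i j al be o.
pose V v := \sum_o q v o * tilt i j al be o ^+ 2 - m v ^+ 2.
have q0 v o : 0 <= q v o by exact: update_prob_ge0.
have q1 v : \sum_o q v o = 1 by exact: update_prob_sum1.
have V0 v : 0 <= V v by apply: variance_ge0.
have EE : E = \prod_v \sum_o q v o * expR (tilt i j al be o).
  rewrite -expect_expR_sum; apply: eq_expect => c'; by rewrite sum_tilt.
have muE : expR mu = \prod_v expR (m v).
  rewrite -expR_sum; congr expR; rewrite /m /mu /mean_cnt -!(mean_update n_gt0 p).
  by rewrite !mulr_sumr -sumrB; apply: eq_bigr => v _; rewrite tilt_mean.
have PV : pair_var c i j al be = \sum_v V v by rewrite pair_varE.
have bd v := mean_exp_bounds (q0 v) (q1 v) (fun o => tilt_le o ij alh beh) h6.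
rewrite EE (expRD mu) muE PV; apply/andP; split.
  have -> : (\sum_v V v) / 2 * (1 - 2 * h) = \sum_v V v / 2 * (1 - 2 * h) by rewrite !mulr_suml.
  apply: le_trans (_ : _ <= \prod_v (expR (m v) * (1 + V v / 2 * (1 - 2 * h)))) _.
    rewrite big_split /= ler_wpM2l ?prodr_ge0 //.
    by apply: prod_ge_1Dsum => v; rewrite mulr_ge0 ?divr_ge0 ?V0 //; lra.
  apply: ler_prod => v _; case/andP: (bd v) => -> _; rewrite andbT.
  by rewrite mulr_ge0 ?expR_ge0 // addr_ge0 // mulr_ge0 ?divr_ge0 ?V0 //; lra.
have -> : (\sum_v V v) / 2 * (1 + 2 * h) = \sum_v V v / 2 * (1 + 2 * h) by rewrite !mulr_suml.
apply: le_trans (_ : _ <= \prod_v (expR (m v) * (1 + V v / 2 * (1 + 2 * h)))) _.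
  apply: ler_prod => v _; case/andP: (bd v) => _ ->; rewrite andbT.
  by apply: sumr_ge0 => o _; rewrite mulr_ge0 ?expR_ge0.
rewrite big_split /= ler_wpM2l ?prodr_ge0 //.
apply: prod_le_expR_sum => v; rewrite addr_ge0 // mulr_ge0 ?divr_ge0 ?V0 //; lra.
Qed.

End Laplace.

(** * Variance of the gap under each protocol *)

Section Variances.
Context {R : realType}.
Variables (n k : nat).
Hypothesis n_gt0 : (0 < n)%N.
Implicit Types (c : config n k) (o i j : 'I_k).

Lemma update_prob_add_le1 p c v i j : i != j ->
  update_prob R p c v i + update_prob R p c v j <= 1.
Proof.
move=> ij; rewrite -(update_prob_sum1 p n_gt0 c v) (bigD1 i) //= (bigD1 j) 1?eq_sym //=.
by rewrite addrA lerDl; apply: sumr_ge0 => o _; exact: update_prob_ge0.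
Qed.

(** Per vertex the variance combines [x * (1 - x)], [y * (1 - y)] and [2 * (x * y)], all
    non-negative, with coefficients [al ^+ 2], [be ^+ 2] and [al * be]; hence it is monotone in both
    weights. *)
Lemma pair_var_le p c i j (al be h : R) : i != j -> 0 <= al <= h -> 0 <= be <= h ->
  pair_var p c i j al be <= h ^+ 2 * pair_var p c i j 1 1.
Proof.
move=> ij /andP[a0 ah] /andP[b0 bh]; have h0 := le_trans a0 ah; rewrite /pair_var mulr_sumr; apply: ler_sum => v _.
have := update_prob_add_le1 p c v ij.
have := @update_prob_ge0 R p n k c v i; have := @update_prob_ge0 R p n k c v j.
set x := update_prob _ _ _ _ i; set y := update_prob _ _ _ _ j => y0 x0 xy1.
have -> : al ^+ 2 * x + be ^+ 2 * y - (al * x - be * y) ^+ 2 =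
  al ^+ 2 * (x * (1 - x)) + be ^+ 2 * (y * (1 - y)) + (al * be) * (2 * (x * y)) by ring.
have -> : h ^+ 2 * (1 ^+ 2 * x + 1 ^+ 2 * y - (1 * x - 1 * y) ^+ 2) =
  h ^+ 2 * (x * (1 - x)) + h ^+ 2 * (y * (1 - y)) + h ^+ 2 * (2 * (x * y)) by ring.
by rewrite !lerD // ler_wpM2r ?mulr_ge0 //; try lra; nra.
Qed.

Lemma pair_var_ge p c i j (al be m : R) : i != j -> 0 <= m -> m <= al -> m <= be ->
  m ^+ 2 * pair_var p c i j 1 1 <= pair_var p c i j al be.
Proof.
move=> ij m0 ma mb; have a0 := le_trans m0 ma; have b0 := le_trans m0 mb; rewrite /pair_var mulr_sumr; apply: ler_sum => v _.
have := update_prob_add_le1 p c v ij.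
have := @update_prob_ge0 R p n k c v i; have := @update_prob_ge0 R p n k c v j.
set x := update_prob _ _ _ _ i; set y := update_prob _ _ _ _ j => y0 x0 xy1.
have -> : al ^+ 2 * x + be ^+ 2 * y - (al * x - be * y) ^+ 2 =
  al ^+ 2 * (x * (1 - x)) + be ^+ 2 * (y * (1 - y)) + (al * be) * (2 * (x * y)) by ring.
have -> : m ^+ 2 * (1 ^+ 2 * x + 1 ^+ 2 * y - (1 * x - 1 * y) ^+ 2) =
  m ^+ 2 * (x * (1 - x)) + m ^+ 2 * (y * (1 - y)) + m ^+ 2 * (2 * (x * y)) by ring.
by rewrite !lerD // ler_wpM2r ?mulr_ge0 //; try lra; nra.
Qed.

Lemma mean_diff c i j : mean_cnt c i - mean_cnt c j =
  (cnt c i - cnt c j) * (1 + (freq c i + freq c j - gam c)) :> R.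
Proof. by rewrite /mean_cnt !(cnt_freq n_gt0); ring. Qed.

Section Leader.
Variables (c : config n k) (i j : 'I_k).
Hypotheses (ij : i != j) (imax : forall o, freq c o <= freq c i :> R).
Local Notation a := (freq c i : R).
Local Notation b := (freq c j : R).
Local Notation g := (gam c : R).

Lemma leader_facts : [/\ 0 <= b, b <= a, a + b <= 1, g <= a & a ^+ 2 + b ^+ 2 <= g].
Proof.
split; [exact: freq_ge0|exact: imax|exact: freq_add_le1|exact: gam_le_freq|exact: gam_ge_pair].
Qed.

Lemma pair_var_maj3E : pair_var ThreeMajority c i j 1 1 =
  n%:R * (a * (1 + a - g) + b * (1 + b - g)
          - (a * (1 + a - g) - b * (1 + b - g)) ^+ 2).
Proof.
rewrite /pair_var; under eq_bigr do rewrite !update_prob_maj3 //.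
by rewrite sumr_const card_ord -[_ *+ n]mulr_natl; ring.
Qed.

Lemma pair_var_maj3_le : pair_var ThreeMajority c i j 1 1 <= n%:R * (4 * a).
Proof.
rewrite pair_var_maj3E ler_wpM2l //; have [] := leader_facts.
move: (freq c i) (freq c j) (gam c) => a b g b0 ba ab1 ga gab.
have g0 : 0 <= g by have := sqr_ge0 a; have := sqr_ge0 b; lra.
have := sqr_ge0 (a * (1 + a - g) - b * (1 + b - g)).
have : a * (a - g) <= a * 1 by rewrite ler_wpM2l; lra.
have : b * (b - g) <= b * 1 by rewrite ler_wpM2l; lra.
lra.
Qed.

(** Randomness dies out near consensus. The factor [1 - a] is essential for plurality, where the
    drift carries it too. *)
Lemma pair_var_maj3_le_compl : pair_var ThreeMajority c i j 1 1 <= n%:R * (14 * (a * (1 - a))).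
Proof.
rewrite pair_var_maj3E ler_wpM2l //; have [] := leader_facts.
move: (freq c i) (freq c j) (gam c) => a b g b0 ba ab1 ga gab.
have g0 : 0 <= g by have := sqr_ge0 a; have := sqr_ge0 b; lra.
set x := a * (1 + a - g); set y := b * (1 + b - g).
have -> : x + y - (x - y) ^+ 2 = x * (1 - x) + y * (1 - y) + 2 * (x * y) by ring.
have xa : a <= x by rewrite /x; nra.
have x2 : x <= 2 * a by rewrite /x; nra.
have y0 : 0 <= y by rewrite /y mulr_ge0; nra.
have y2 : y <= 2 * b by rewrite /y; nra.
(* [b] is at most both [a] and [1 - a], and the larger of these is at least 1/2. *)
have b2 : b <= 2 * (a * (1 - a)) by have [?|?] := leP a (1 / 2); nra.
have x1 : x <= 1.
  rewrite /x; nra.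
have : x * (1 - x) <= 2 * a * (1 - a) by rewrite ler_pM //; lra.
have : y * (1 - y) <= y by nra.
have : x * y <= y by nra.
nra.
Qed.

(** A small gap excludes configurations close to consensus, where the variance vanishes: the squared
    mean [(x - y) ^+ 2] then removes at most half of [x - y]. *)
Lemma pair_var_maj3_ge : a - b <= 1 / 4 ->
  n%:R * (a / 2) <= pair_var ThreeMajority c i j 1 1.
Proof.
move=> ab4; rewrite pair_var_maj3E ler_wpM2l //; move: ab4; have [] := leader_facts.
move: (freq c i) (freq c j) (gam c) => a b g b0 ba ab1 ga gab ab4.
have g0 : 0 <= g by have := sqr_ge0 a; have := sqr_ge0 b; lra.
set x := a * (1 + a - g); set y := b * (1 + b - g).
have xa : a <= x by rewrite /x; nra.
have y0 : 0 <= y by rewrite /y mulr_ge0; nra.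
have xy : x - y = (a - b) * (1 + a + b - g) by rewrite /x /y; ring.
have xy0 : 0 <= x - y by rewrite xy mulr_ge0; nra.
have xyh : x - y <= 1 / 2 by rewrite xy; nra.
have : (x - y) ^+ 2 <= 1 / 2 * (x - y) by rewrite expr2 ler_wpM2r.
nra.
Qed.

Lemma single_var_maj3 (al : R) : pair_var ThreeMajority c j i al 0 =
  n%:R * (al ^+ 2 * (b * (1 + b - g) * (1 - b * (1 + b - g)))).
Proof.
rewrite /pair_var; under eq_bigr do rewrite !update_prob_maj3 //.
by rewrite sumr_const card_ord -[_ *+ n]mulr_natl; ring.
Qed.

Let bern (x y : R) := x + y - (x - y) ^+ 2.

Lemma pair_var_choices2E : pair_var TwoChoices c i j 1 1 =
  n%:R * (a * bern (a ^+ 2 + (1 - g)) (b ^+ 2) + b * bern (a ^+ 2) (b ^+ 2 + (1 - g))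
    + (1 - a - b) * bern (a ^+ 2) (b ^+ 2)).
Proof.
rewrite /pair_var.
pose F (s t : bool) : R := bern (a ^+ 2 + s%:R * (1 - g)) (b ^+ 2 + t%:R * (1 - g)).
transitivity (\sum_v F (c v == i) (c v == j)).
  by apply: eq_bigr => v _; rewrite !update_prob_choices2 // /F /bern; ring.
by rewrite sum_by_class // !(cnt_freq n_gt0) /F /bern /=; ring.
Qed.

Let bern_le_sum (x y : R) : bern x y <= x + y.
Proof. by rewrite /bern lerBlDr lerDl sqr_ge0. Qed.

Let bern_le_compl (x y : R) : 0 <= y -> x + y <= 1 -> bern x y <= 1 - x + 3 * y.
Proof. move=> y0 xy; have := sqr_ge0 (1 - x + y); have := sqr_ge0 (1-x); rewrite /bern; nra. Qed.

Let bernC (x y : R) : bern x y = bern y x.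
Proof. by rewrite /bern; ring. Qed.

(** Under 2-Choices a vertex abandons its opinion only if two samples agree, and joins [i] or [j]
    from outside only with probability [a ^+ 2] or [b ^+ 2]. Since [gam <= a], the total is
    quadratic in [a], not linear as for 3-Majority. *)
Lemma pair_var_choices2_le : pair_var TwoChoices c i j 1 1 <= n%:R * (10 * a ^+ 2).
Proof.
rewrite pair_var_choices2E ler_wpM2l //; have [] := leader_facts.
move: (freq c i) (freq c j) (gam c) => a b g b0 ba ab1 ga gab.
have g0 : 0 <= g by have := sqr_ge0 a; have := sqr_ge0 b; lra.
have a1 : a <= 1 by lra.
have h1 : bern (a ^+ 2 + (1 - g)) (b ^+ 2) <= g - a ^+ 2 + 3 * b ^+ 2.
  apply: le_trans (bern_le_compl _ _) _; [exact: sqr_ge0|lra|lra].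
have h2 : bern (a ^+ 2) (b ^+ 2 + (1 - g)) <= g - b ^+ 2 + 3 * a ^+ 2.
  rewrite bernC; apply: le_trans (bern_le_compl _ _) _; [exact: sqr_ge0|lra|lra].
have h3 := bern_le_sum (a ^+ 2) (b ^+ 2).
have k1 : a * bern (a ^+ 2 + (1 - g)) (b ^+ 2) <= a * (g - a ^+ 2 + 3 * b ^+ 2) by rewrite ler_wpM2l; lra.
have k2 : b * bern (a ^+ 2) (b ^+ 2 + (1 - g)) <= b * (g - b ^+ 2 + 3 * a ^+ 2) by rewrite ler_wpM2l.
have k3 : (1 - a - b) * bern (a ^+ 2) (b ^+ 2) <= (1 - a - b) * (a ^+ 2 + b ^+ 2) by rewrite ler_wpM2l; lra.
have e1 : a * g <= a ^+ 2 by rewrite expr2 ler_wpM2l; lra.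
have e2 : b * g <= a ^+ 2 by rewrite expr2 ler_pM //; nra.
have e3 : b ^+ 2 <= a ^+ 2 by rewrite lerXn2r ?nnegrE //; lra.
have e4 : a * b ^+ 2 <= a ^+ 2 by have := sqr_ge0 b; nra.
have e5 : b * a ^+ 2 <= a ^+ 2 by have := sqr_ge0 a; nra.
have e6 : 0 <= a * a ^+ 2 by rewrite mulr_ge0 ?sqr_ge0; lra.
have e7 : 0 <= b * b ^+ 2 by rewrite mulr_ge0 ?sqr_ge0; lra.
have e8 : 0 <= b * a ^+ 2 by rewrite mulr_ge0 ?sqr_ge0; lra.
have e9 : 0 <= a * b ^+ 2 by rewrite mulr_ge0 ?sqr_ge0; lra.
nra.
Qed.

Lemma pair_var_choices2_le_compl :
  pair_var TwoChoices c i j 1 1 <= n%:R * (11 * (a ^+ 2 * (1 - a))).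
Proof.
rewrite pair_var_choices2E ler_wpM2l //; have [] := leader_facts.
move: (freq c i) (freq c j) (gam c) => a b g b0 ba ab1 ga gab.
have g0 : 0 <= g by have := sqr_ge0 a; have := sqr_ge0 b; lra.
have a1 : a <= 1 by lra.
have h1 : bern (a ^+ 2 + (1 - g)) (b ^+ 2) <= g - a ^+ 2 + 3 * b ^+ 2.
  apply: le_trans (bern_le_compl _ _) _; [exact: sqr_ge0|lra|lra].
have h2 : bern (a ^+ 2) (b ^+ 2 + (1 - g)) <= g - b ^+ 2 + 3 * a ^+ 2.
  rewrite bernC; apply: le_trans (bern_le_compl _ _) _; [exact: sqr_ge0|lra|lra].
have h3 := bern_le_sum (a ^+ 2) (b ^+ 2).
have b2 : b <= 2 * (a * (1 - a)) by have [?|?] := leP a (1 / 2); nra.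
have e3 : b ^+ 2 <= a ^+ 2 by rewrite lerXn2r ?nnegrE //; lra.
have bb : b ^+ 2 <= a * (1 - a) by nra.
have k1 : a * bern (a ^+ 2 + (1 - g)) (b ^+ 2) <= a * (4 * (a * (1 - a))) by rewrite ler_wpM2l; nra.
have k2 : b * bern (a ^+ 2) (b ^+ 2 + (1 - g)) <= b * (a + 3 * a ^+ 2).
  by rewrite ler_wpM2l //; have := sqr_ge0 b; lra.
have k2' : b * a <= 2 * (a ^+ 2 * (1 - a)) by nra.
have k2'' : b * a ^+ 2 <= (1 - a) * a ^+ 2 by rewrite ler_wpM2r ?sqr_ge0; lra.
have k3 : (1 - a - b) * bern (a ^+ 2) (b ^+ 2) <= (1 - a) * (2 * a ^+ 2).
  apply: le_trans (_ : _ <= (1 - a - b) * (2 * a ^+ 2)) _; first by rewrite ler_wpM2l; lra.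
  by rewrite ler_wpM2r; [|have := sqr_ge0 a; lra|lra].
nra.
Qed.

(** The hypothesis forces [a <= 2 / 3], so [1 - gam] is at least 1/3: this is the constant. The
    supporters of [j] make up for discarding those of [i], because [4 * b >= a + b]. *)
Lemma pair_var_choices2_ge : a <= 2 * b ->
  n%:R * (a ^+ 2 / 3) <= pair_var TwoChoices c i j 1 1.
Proof.
move=> ab2; rewrite pair_var_choices2E ler_wpM2l //; move: ab2; have [] := leader_facts.
move: (freq c i) (freq c j) (gam c) => a b g b0 ba ab1 ga gab ab2.
have g0 : 0 <= g by have := sqr_ge0 a; have := sqr_ge0 b; lra.
have a1 : a <= 2 / 3 by lra.
have berng (x y : R) : 0 <= x -> 0 <= y -> x + y <= 1 -> 4 * (x * y) <= bern x y.
  move=> x0 y0 xy; rewrite /bern; have : (x + y) ^+ 2 <= x + y by nra.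
  have -> : (x + y) ^+ 2 = (x - y) ^+ 2 + 4 * (x * y) by ring.
  lra.
have A2 := sqr_ge0 a; have B2 := sqr_ge0 b.
have e3 : b ^+ 2 <= a ^+ 2 by rewrite lerXn2r ?nnegrE //; lra.
have h1 : 4 * ((1 - g) * b ^+ 2) <= bern (a ^+ 2 + (1 - g)) (b ^+ 2).
  apply: le_trans (berng _ _ _ _ _); nra.
have h2 : 4 * ((1 - g) * a ^+ 2) <= bern (a ^+ 2) (b ^+ 2 + (1 - g)).
  apply: le_trans (berng _ _ _ _ _); nra.
have h3 : (1 - g) * a ^+ 2 <= bern (a ^+ 2) (b ^+ 2).
  rewrite /bern; have : (a ^+ 2 - b ^+ 2) ^+ 2 <= a ^+ 2 * g.
    by rewrite expr2 ler_pM; lra.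
  lra.
have k1 : 0 <= a * bern (a ^+ 2 + (1 - g)) (b ^+ 2).
  by rewrite mulr_ge0; [|lra|apply: le_trans h1; rewrite !mulr_ge0; lra].
have k2 : b * (4 * ((1 - g) * a ^+ 2)) <= b * bern (a ^+ 2) (b ^+ 2 + (1 - g)) by rewrite ler_wpM2l.
have k3 : (1 - a - b) * ((1 - g) * a ^+ 2) <= (1 - a - b) * bern (a ^+ 2) (b ^+ 2) by rewrite ler_wpM2l; lra.
have : 1 / 3 * a ^+ 2 <= (1 - g) * a ^+ 2 by rewrite ler_wpM2r; lra.
have : 0 <= (4 * b - a - b) * ((1 - g) * a ^+ 2) by rewrite mulr_ge0 ?mulr_ge0; lra.
lra.
Qed.

End Leader.
End Variances.

(** * From drift to consensus time *)

Section StarPotential.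
Context {R : realType}.
Variables (p : protocol) (n k : nat).
Hypothesis n_gt0 : (0 < n)%N.
Implicit Types (c : config n k) (o i j : 'I_k).

Lemma exists_leader c : exists i, forall o, freq c o <= freq c i :> R.
Proof.
have o0 := c (Ordinal n_gt0).
case: (@arg_maxnP 'I_k o0 predT (opinion_count c)) => // i _ imax; exists i => o.
by rewrite ler_pM2r ?invr_gt0 ?ltr0n // ler_nat; exact: imax.
Qed.

Lemma update_prob_dead c v j : opinion_count c j = 0%N -> update_prob R p c v j = 0.
Proof.
move=> j0; have f0 : freq c j = 0 :> R by rewrite /freq /cnt j0 mul0r.
have cvj : (c v == j) = false.
  apply/negP => cvj; move: j0; rewrite /opinion_count (cardsD1 v) inE cvj //.
case: p; first by rewrite update_prob_maj3 // f0 mul0r.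
by rewrite update_prob_choices2 // f0 cvj expr0n mul0r addr0.
Qed.

(** Extinct opinions never return. Without this factor an extinct rival would keep contributing
    [f x 0], for which no drift is assumed. *)
Definition alive c j : R := (0 < opinion_count c j)%N%:R.

Lemma expect_alive_dead c j (F : config n k -> R) : opinion_count c j = 0%N ->
  expect p c (fun c' => alive c' j * F c') = 0.
Proof.
move=> j0; apply: big1 => c' _; rewrite /alive.
case: posnP => [_|]; first by rewrite mul0r mulr0.
rewrite card_gt0 => /set0Pn[v]; rewrite inE => /eqP cvj.
by rewrite /trans (bigD1 v) //= cvj update_prob_dead // !mul0r.
Qed.

Lemma consensus_or_alive c i : ~~ is_consensus c -> exists2 j, j != i & (0 < opinion_count c j)%N.
Proof.
move=> nc; case: (pickP (fun j => (j != i) && (0 < opinion_count c j)%N)) => [j /andP[? ?]|none].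
  by exists j.
case/negP: nc; apply/existsP; exists i; apply/forallP => v; apply: contraT => cvi.
have := none (c v); rewrite cvi /= => /negbT; rewrite -eqn0Ngt /opinion_count (cardsD1 v).
by rewrite inE eqxx.
Qed.

Variables (f : R -> R -> R) (l0 U d : R).
Hypotheses (l0_gt0 : 0 < l0) (U_gt0 : 0 < U) (dU : d <= U) (d_ge0 : 0 <= d).
Hypothesis f_ge0 : forall x y, 0 <= x -> 0 <= y -> 0 <= f x y.
Hypothesis f_low : forall x y, 0 <= x -> 1 <= y -> l0 <= f x y.
Hypothesis f_up : forall x y, 0 <= y -> y <= x -> x <= n%:R -> f x y <= U.
Hypothesis f_monol : forall x x' y, 0 <= x -> x <= x' -> 0 <= y -> f x' y <= f x y.
Hypothesis f_monor : forall x y y', 0 <= x -> 0 <= y -> y <= y' -> f x y <= f x y'.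
Hypothesis f_drift : forall c i j, i != j -> (forall o, freq c o <= freq c i :> R) ->
  1 <= cnt c j :> R ->
  expect p c (fun c' => f (cnt c' i) (cnt c' j)) <= f (cnt c i) (cnt c j) - d.

Definition star_potential i c : R := \sum_(j | j != i) alive c j * f (cnt c i) (cnt c j).

Lemma alive_ge0 c j : 0 <= alive c j. Proof. exact: ler0n. Qed.

Lemma star_potential_ge0 i c : 0 <= star_potential i c.
Proof. by apply: sumr_ge0 => j _; rewrite mulr_ge0 ?f_ge0 ?cnt_ge0 ?alive_ge0. Qed.

(** Replacing [i] by the leader raises the first argument of every common term and swaps the
    arguments of the remaining one into decreasing order; [f] decreases in its first argument and
    increases in its second. *)
Lemma star_potential_leader i l c : (forall o, freq c o <= freq c l :> R) ->
  star_potential l c <= star_potential i c.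
Proof.
move=> lmax; have [->//|il] := eqVneq i l.
have cmax o : cnt c o <= cnt c l :> R.
  by have := lmax o; rewrite /freq ler_pM2r ?invr_gt0 ?ltr0n.
have l_alive : alive c l = 1.
  rewrite /alive; suff -> : (0 < opinion_count c l)%N by [].
  rewrite lt0n; apply: contraT; rewrite negbK => /eqP cl0.
  have := cmax (c (Ordinal n_gt0)); rewrite {2}/cnt cl0 lern0 => /eqP.
  rewrite /opinion_count => /eqP; rewrite cards_eq0 => /eqP e0.
  by have := congr1 (fun A : {set 'I_n} => Ordinal n_gt0 \in A) e0; rewrite !inE eqxx.
rewrite /star_potential (bigD1 i) //= [leRHS](bigD1 l) 1?eq_sym //= l_alive mul1r.
apply: lerD.
  have [_|i_gt0] := posnP (opinion_count c i).
    apply: le_trans (_ : _ <= 1 * f (cnt c l) (cnt c i)) _.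
      by rewrite ler_wpM2r ?f_ge0 ?cnt_ge0 // /alive; case: (_ < _)%N.
    rewrite mul1r; apply: le_trans (f_monol _ (cmax i) _) _; rewrite ?cnt_ge0 //.
    by apply: f_monor; rewrite ?cnt_ge0.
  rewrite /alive i_gt0 mul1r; apply: le_trans (f_monol _ (cmax i) _) _; rewrite ?cnt_ge0 //.
  by apply: f_monor; rewrite ?cnt_ge0.
rewrite (eq_bigl (fun j => (j != i) && (j != l))); last by move=> j; rewrite andbC.
by apply: ler_sum => j _; rewrite ler_wpM2l ?alive_ge0 // f_monol ?cnt_ge0.
Qed.

(** The bound is stated for every centre [i]: after a step the induction hypothesis is used with the
    old leader as centre, whoever leads now, and the change of centre costs nothing by
    [star_potential_leader]. As [f <= U], losing [d] means losing at least the fraction [d / U]. *)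
Lemma avoid_le_star t c i :
  l0 * (1 - hit p (@is_consensus n k) t c) <= (1 - d / U) ^+ t * star_potential i c.
Proof.
have rate0 : 0 <= 1 - d / U by rewrite subr_ge0 ler_pdivrMr ?mul1r.
elim: t c i => [|t IH] c i.
  rewrite /= expr0 mul1r; case: ifPn => [_|nc]; first by rewrite subrr mulr0 star_potential_ge0.
  rewrite subr0 mulr1; have [j ji j_gt0] := consensus_or_alive i nc.
  rewrite /star_potential (bigD1 j) //= /alive j_gt0 mul1r.
  apply: le_trans (_ : l0 <= f (cnt c i) (cnt c j)) _; first by rewrite f_low ?cnt_ge0 // /cnt ler1n.
  by rewrite lerDl; apply: sumr_ge0 => j' _; rewrite mulr_ge0 ?f_ge0 ?cnt_ge0 ?alive_ge0.
rewrite /=; case: ifPn => [_|nc].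
  by rewrite subrr mulr0 mulr_ge0 ?exprn_ge0 ?star_potential_ge0.
have [l lmax] := exists_leader c.
apply: le_trans (_ : _ <= (1 - d / U) ^+ t.+1 * star_potential l c) _; last first.
  by rewrite ler_wpM2l ?exprn_ge0 // star_potential_leader.
rewrite -[X in X - _](expect_cst p n_gt0 c) -expectB -expectZ.
apply: le_trans (ler_expect _ _ (fun c' => IH c' l)) _.
rewrite expectZ exprSr -mulrA ler_wpM2l ?exprn_ge0 // /star_potential expect_sum mulr_sumr.
apply: ler_sum => j jl.
have [j0|j_gt0] := posnP (opinion_count c j).
  by rewrite expect_alive_dead // /alive j0 mul0r mulr0.
rewrite {2}/alive j_gt0 mul1r.
apply: le_trans (_ : _ <= f (cnt c l) (cnt c j) - d) _.
  apply: le_trans (f_drift _ lmax _); rewrite 1?eq_sym //; last by rewrite /cnt ler1n.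
  apply: ler_expect => c'; rewrite -[leRHS]mul1r ler_wpM2r ?f_ge0 ?cnt_ge0 //.
  by rewrite /alive; case: (_ < _)%N.
have fU : f (cnt c l) (cnt c j) <= U.
  apply: f_up; rewrite ?cnt_ge0 //; first by have := lmax j; rewrite /freq ler_pM2r ?invr_gt0 ?ltr0n.
  by rewrite (cnt_freq n_gt0) -[leRHS]mulr1 ler_wpM2l // freq_le1.
rewrite mulrBl mul1r lerD2l lerN2 mulrAC -mulrA.
by rewrite -[leRHS]mulr1 ler_wpM2l // ler_pdivrMr ?mul1r.
Qed.

Lemma avoid_consensus_le t c :
  1 - hit p (@is_consensus n k) t c <= k%:R * U / l0 * (1 - d / U) ^+ t.
Proof.
have [l lmax] := exists_leader c.
have := avoid_le_star t c l; rewrite mulrC -ler_pdivlMr // => /le_trans; apply.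
have P0 := star_potential_ge0 l c.
have PU : star_potential l c <= k%:R * U.
  rewrite /star_potential; apply: le_trans (_ : _ <= \sum_(j | j != l) U) _.
    apply: ler_sum => j jl; apply: le_trans (_ : _ <= 1 * f (cnt c l) (cnt c j)) _.
      by rewrite ler_wpM2r ?f_ge0 ?cnt_ge0 // /alive; case: (_ < _)%N.
    rewrite mul1r; apply: f_up; rewrite ?cnt_ge0 //.
      by have := lmax j; rewrite /freq ler_pM2r ?invr_gt0 ?ltr0n.
    by rewrite (cnt_freq n_gt0) -[leRHS]mulr1 ler_wpM2l // freq_le1.
  rewrite sumr_const -[_ *+ _]mulr_natl ler_wpM2r ?(ltW U_gt0) // ler_nat.
  by apply: leq_trans (max_card _) _; rewrite card_ord.
rewrite -[leLHS]mulrA [leRHS]mulrC ler_wpM2l //.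
  by rewrite exprn_ge0 // subr_ge0 ler_pdivrMr ?mul1r.
by rewrite ler_pM2r ?invr_gt0.
Qed.

End StarPotential.

(** * Size and gap potentials *)

Section DyadicSums.
Context {R : realType}.
Implicit Types (x z : R).

(** [H] is a self-similar majorant: the hypothesis makes the sum telescope, with a bound uniform in
    the number of scales. *)
Lemma dyadic_sum_le (g H : R -> R) M z :
  (forall x, 0 <= x -> g x + H (x / 2) <= H x) -> (forall x, 0 <= x -> 0 <= H x) ->
  0 <= z -> \sum_(m < M) g (z / 2 ^+ m) <= H z.
Proof.
move=> gH H0; elim: M z => [|M IH] z z0; first by rewrite big_ord0 H0.
rewrite big_ord_recl expr0 divr1; apply: le_trans (gH _ z0); rewrite lerD2l.
apply: le_trans (IH _ _); last by rewrite divr_ge0.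
by apply: ler_sum => m _; rewrite lift0 exprS invfM mulrA.
Qed.

(** Some scale brings [z] to order 1, unless [z] is already smaller, and then scale 0 leaves it
    unchanged. Thus one term of a dyadic sum can supply a drift independent of the number of
    scales. *)
Lemma dyadic_pick M z : 0 < z -> z <= 2 ^+ M ->
  exists m : 'I_M.+1, z / 2 ^+ m <= 1 /\ (1 / 2 <= z / 2 ^+ m \/ z / 2 ^+ m = z).
Proof.
elim: M z => [|M IH] z z0 zM.
  by exists ord0; rewrite expr0 divr1; split => //; right.
have [z1|z1] := leP z 1; first by exists ord0; rewrite expr0 divr1; split => //; right.
have [||m [m1 m2]] := IH (z / 2); first by rewrite divr_gt0.
  by rewrite ler_pdivrMr // -exprSr.
exists (lift ord0 m); rewrite lift0 exprS invfM mulrA; split => //; left.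
by case: m2 => // ->; lra.
Qed.

Lemma expRN_ge_quarter z : z <= 1 -> 1 / 4 <= expR (- z).
Proof.
move=> z1; apply: le_trans (_ : _ <= expR (- 1)) _; last by rewrite ler_expR lerN2.
have -> : (- 1 : R) = - (1 / 2) + - (1 / 2) by field.
rewrite expRD; have := expR_ge1Dx (- (1 / 2) : R); have := expR_ge0 (- (1 / 2) : R).
nra.
Qed.

Lemma sum_zexpN_le M z : 0 <= z ->
  \sum_(m < M) z / 2 ^+ m * expR (- (z / 2 ^+ m)) <= 3.
Proof.
(* [3 * x / (1 + x)] is a bounded majorant whose decrease from [x] to [x / 2] is
   [3 * x / ((1 + x) * (2 + x))], which dominates [x * expR (- x)]. *)
move=> z0; apply: le_trans (_ : _ <= 3 * z / (1 + z)) _; last first.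
  by rewrite ler_pdivrMr; lra.
apply: (@dyadic_sum_le (fun x => x * expR (- x)) (fun x => 3 * x / (1 + x))) => // x x0;
  last by rewrite divr_ge0 ?mulr_ge0 // addr_ge0.
have xx : 3 * x / (1 + x) - 3 * (x / 2) / (1 + x / 2) = x * (3 / ((1 + x) * (2 + x))).
  by field; apply/andP; split; rewrite gt_eqF //; lra.
suff : x * expR (- x) <= x * (3 / ((1 + x) * (2 + x))) by rewrite -xx; lra.
have D0 : 0 < (1 + x) * (2 + x) by rewrite mulr_gt0; lra.
rewrite ler_wpM2l // expRN ler_pdivlMr // mulrC ler_pdivrMr ?expR_gt0 //.
by have := expR_ge_quad x0; nra.
Qed.

End DyadicSums.

Section SizeTerm.
Context {R : realType}.

(* A bounded-scale substitute for [ln x], built from exponentials so that its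
   expected change follows from Laplace transforms. *)
Definition log_like M (x : R) : R := \sum_(m < M) (1 - expR (- (x / 8 / 2 ^+ m))).

Lemma log_like_ge0 M x : 0 <= x -> 0 <= log_like M x.
Proof.
move=> x0; apply: sumr_ge0 => m _; rewrite subr_ge0 expR_le1 oppr_le0.
by rewrite !divr_ge0.
Qed.

Lemma log_like_le M x : log_like M x <= M%:R.
Proof.
rewrite -[M in M%:R]card_ord -sumr_const; apply: ler_sum => m _.
by rewrite gerBl expR_ge0.
Qed.

Lemma log_like_nondecreasing M x y : x <= y -> log_like M x <= log_like M y.
Proof.
move=> xy; apply: ler_sum => m _; rewrite lerD2l lerN2 ler_expR lerN2.
by rewrite !ler_wpM2r.
Qed.

Lemma log_like_ge M x : 1 <= x -> 1 / 16 <= log_like M.+1 x.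
Proof.
move=> x1; rewrite /log_like big_ord_recl expr0 divr1.
apply: le_trans (_ : _ <= 1 - expR (- (x / 8))) _; last first.
  by rewrite lerDl; apply: sumr_ge0 => m _; rewrite subr_ge0 expR_le1 oppr_le0 !divr_ge0 //; lra.
have x8 : 1 / 8 <= x / 8 by lra.
have : expR (- (x / 8)) <= expR (- (1 / 8)) by rewrite ler_expR lerN2.
have /expRN_le_quad : (0 : R) <= 1 / 8 by lra.
lra.
Qed.

Variables (p : protocol) (n k : nat).
Hypothesis n_gt0 : (0 < n)%N.
Implicit Types (c : config n k) (i j : 'I_k).

(** Two effects: the drift of the count times the logarithmic derivative of the potential, and a
    negative second-order term because [1 - expR (- z)] is concave. The factor 3/8 is
    [(1 - 2 * h) / 2] at [h = 1 / 8]. *)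
Lemma expect_log_like M c i j : i != j ->
  expect p c (fun c' => log_like M (cnt c' j)) <=
  log_like M (cnt c j)
  + (freq c j - gam c) * \sum_(m < M) (cnt c j / 8 / 2 ^+ m) * expR (- (cnt c j / 8 / 2 ^+ m))
  - \sum_(m < M) expR (- (mean_cnt c j / 8 / 2 ^+ m)) *
      (3 / 8 * pair_var p c j i (8^-1 / 2 ^+ m) 0).
Proof.
move=> ij; rewrite /log_like expect_sum mulr_sumr -big_split -sumrB /=.
apply: ler_sum => m _.
rewrite expectB expect_cst //.
set al : R := 8^-1 / 2 ^+ m.
have al0 : 0 <= al by rewrite divr_ge0 ?invr_ge0 ?exprn_ge0.
(* Reason for the division by 8 in [log_like]: the rates stay below the 1/6 demanded by
   [laplace_bounds]. *)
have al8 : al <= 1 / 8.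
  by rewrite /al ler_pdivrMr ?exprn_gt0 // div1r ler_peMr ?invr_ge0 // exprn_ege1 // ler1n.
have E (x : R) : x / 8 / 2 ^+ m = al * x by rewrite /al; field; rewrite expf_neq0.
rewrite !E.
have -> : expect p c (fun c' => expR (- (cnt c' j / 8 / 2 ^+ m))) =
    expect p c (fun c' => expR (0 * cnt c' i - al * cnt c' j)).
  by apply: eq_expect => c'; rewrite E mul0r sub0r.
have ji : j != i by rewrite eq_sym.
have al_bd : 0 <= al <= 1 / 8 by rewrite al0.
have z_bd : 0 <= (0 : R) <= 1 / 8 by lra.
have h6 : (1 / 8 : R) <= 1 / 6 by lra.
have /andP[low _] := laplace_bounds p n_gt0 c ji al_bd z_bd h6.
rewrite mul0r sub0r in low.
set V := pair_var _ _ _ _ _ _ in low *; set Ex := expect _ _ _ in low *.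
have {}low : expR (- (al * mean_cnt c j)) * (1 + 3 / 8 * V) <= Ex.
  by apply: le_trans low; rewrite ler_wpM2l ?expR_ge0 //; lra.
suff : expR (- (al * cnt c j)) - expR (- (al * mean_cnt c j)) <=
   (freq c j - gam c) * ((al * cnt c j) * expR (- (al * cnt c j))) by lra.
have -> : - (al * mean_cnt c j) = - (al * cnt c j) + - (al * cnt c j * (freq c j - gam c)).
  by rewrite /mean_cnt; ring.
rewrite expRD; have := expR_ge1Dx (- (al * cnt c j * (freq c j - gam c))).
have := expR_ge0 (- (al * cnt c j)).
set e := expR (- (al * cnt c j)); set e' := expR _; set y := al * cnt c j => e0 h.
have : e * (1 - y * (freq c j - gam c)) <= e * e' by rewrite ler_wpM2l //; lra.
lra.
Qed.

Lemma size_weight_bounds M (x : R) : 1 <= x -> x <= 2 ^+ M ->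
  1 / 32 <= \sum_(m < M.+1) (x / 8 / 2 ^+ m) * expR (- (x / 8 / 2 ^+ m)) <= 3.
Proof.
move=> x1 xM; have x0 : 0 < x / 8 by lra.
rewrite sum_zexpN_le ?(ltW x0) // andbT.
have [|m [m1 m2]] := @dyadic_pick R M _ x0; first by apply: le_trans xM; lra.
rewrite (bigD1 m) //=; apply: le_trans (_ : _ <= x / 8 / 2 ^+ m * expR (- (x / 8 / 2 ^+ m))) _.
  have := expRN_ge_quarter m1; have : 1 / 8 <= x / 8 / 2 ^+ m by case: m2 => [|->]; lra.
  by set u := x / 8 / 2 ^+ m; nra.
rewrite lerDl; apply: sumr_ge0 => l _; rewrite mulr_ge0 ?expR_ge0 //.
by rewrite divr_ge0 ?exprn_ge0 // ltW.
Qed.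

(** The weight of the drift is only known to lie between 1/32 and 3, so the growth term takes the
    larger value and the shrinking term the smaller one. *)
Lemma expect_log_like_le M c i j : i != j -> 1 <= cnt c j :> R -> cnt c j <= 2 ^+ M :> R ->
  expect p c (fun c' => log_like M.+1 (cnt c' j)) <=
  log_like M.+1 (cnt c j) + 3 * freq c j - gam c / 32.
Proof.
move=> ij j1 jM; apply: le_trans (expect_log_like _ _ ij) _.
have /andP[] := size_weight_bounds j1 jM; set S := \sum_(m < M.+1) _ => S1 S3.
have b0 : 0 <= freq c j :> R by exact: freq_ge0.
have g0 : 0 <= gam c :> R by exact: gam_ge0.
apply: le_trans (_ : _ <= log_like M.+1 (cnt c j) + (freq c j - gam c) * S) _.
  rewrite lerBlDr lerDl; apply: sumr_ge0 => m _.
  by rewrite !mulr_ge0 ?expR_ge0 ?pair_var_ge0 // 1?eq_sym.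
nra.
Qed.

End SizeTerm.

Section CubicProfile.
Context {R : realType}.
Implicit Types (V S A B : R).

(* Increasing, and concave along multiplicative noise only for [1/3 < v < 1]: there the
   noise lowers the expectation of [cubic v], which is what breaks ties. *)
Definition cubic (v : R) : R := 3 * v - 3 * v ^+ 2 + v ^+ 3.

Lemma cubicE v : cubic v = 1 - (1 - v) ^+ 3.
Proof. by rewrite /cubic; ring. Qed.

Lemma cubic_le v w : 0 <= v -> v <= w -> cubic v <= cubic w.
Proof.
move=> v0 vw; rewrite -subr_ge0.
have -> : cubic w - cubic v = (w - v) * ((1 - v) ^+ 2 + (1 - v) * (1 - w) + (1 - w) ^+ 2).
  by rewrite /cubic; ring.
rewrite mulr_ge0 ?subr_ge0 //.
have := sqr_ge0 ((1 - v) + (1 - w)); have := sqr_ge0 (1 - v); have := sqr_ge0 (1 - w); nra.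
Qed.

Lemma cubic_ge0 v : 0 <= v -> 0 <= cubic v.
Proof. by move=> v0; rewrite (_ : 0 = cubic 0) ?cubic_le // /cubic; ring. Qed.

Lemma expR_le_slope (x q : R) : 0 <= x -> x * q <= q - 1 -> 1 < q -> expR x <= 1 + q * x.
Proof.
move=> x0 xq q1; have x1 : x < 1 by nra.
apply: le_trans (expR_le_inv x1) _; rewrite -div1r ler_pdivrMr ?subr_gt0 //; nra.
Qed.

(** [A1], [A2], [A3] stand for the first three moments of [V] under multiplicative noise of variance
    [S], whose factors are about [1 + S / 2], [1 + 2 * S], [1 + 9 / 2 * S]; the coefficients are
    these with two percent of slack. To first order the change is
    [3 / 2 * S * V * (1 - V) * (1 - 3 * V)], negative between 1/3 and 1. *)
Lemma cubic_noise_gain V S A1 A2 A3 : 1 / 2 <= V <= 2 / 3 -> 0 <= S <= 1 / 1000 ->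
  A1 <= V * expR (51 / 100 * S) -> V ^+ 2 * (1 + 49 / 25 * S) <= A2 ->
  A3 <= V ^+ 3 * expR (459 / 100 * S) ->
  3 * A1 - 3 * A2 + A3 <= cubic V - S / 10.
Proof.
move=> /andP[V1 V2] /andP[S0 S1] h1 h2 h3.
have e1 : expR (51 / 100 * S) <= 1 + 52 / 100 * S.
  apply: le_trans (@expR_le_slope _ (52 / 51) _ _ _) _; lra.
have e3 : expR (459 / 100 * S) <= 1 + 47 / 10 * S.
  apply: le_trans (@expR_le_slope _ (470 / 459) _ _ _) _; lra.
have V0 : 0 <= V by lra.
have {}h1 : A1 <= V * (1 + 52 / 100 * S) by apply: le_trans h1 _; rewrite ler_wpM2l.
have {}h3 : A3 <= V ^+ 3 * (1 + 47 / 10 * S) by apply: le_trans h3 _; rewrite ler_wpM2l ?exprn_ge0.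
have key : V * (156 / 100 - 588 / 100 * V + 47 / 10 * V ^+ 2) <= - (1 / 10).
  have : 156 / 100 - 588 / 100 * V + 47 / 10 * V ^+ 2 <= - (1 / 5) by nra.
  nra.
have : V * (156 / 100 - 588 / 100 * V + 47 / 10 * V ^+ 2) * S <= - (1 / 10) * S by rewrite ler_wpM2r.
rewrite /cubic; move: h1 h2 h3.
have -> : V ^+ 3 = V * V ^+ 2 by ring.
nra.
Qed.

(** Away from ties the noise may hurt, but only in proportion to [V], which decays exponentially in
    the gap. *)
Lemma cubic_noise_cost V S A1 A2 A3 : 0 <= V <= 2 / 3 -> 0 <= S ->
  A1 <= V * expR (51 / 100 * S) -> V ^+ 2 <= A2 ->
  A3 <= V ^+ 3 * expR (459 / 100 * S) ->
  3 * A1 - 3 * A2 + A3 <= cubic V + 4 * V * (expR (5 * S) - 1).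
Proof.
move=> /andP[V0 V2] S0 h1 h2 h3.
have e1 : expR (51 / 100 * S) <= expR (5 * S) by rewrite ler_expR; lra.
have e3 : expR (459 / 100 * S) <= expR (5 * S) by rewrite ler_expR; lra.
have e0 : 1 <= expR (5 * S) by apply: le_trans (expR_ge1Dx _); lra.
have V22 : V ^+ 2 <= 4 / 9 by clear h1 h2 h3 e1 e3 e0; nra.
have V3 : V ^+ 3 <= V * (4 / 9) by rewrite exprS ler_wpM2l.
have V30 : 0 <= V ^+ 3 by rewrite exprn_ge0.
have {}h1 : A1 <= V * expR (5 * S) by apply: le_trans h1 _; rewrite ler_wpM2l.
have {}h3 : A3 <= V ^+ 3 * expR (5 * S) by apply: le_trans h3 _; rewrite ler_wpM2l.
have : V ^+ 3 * (expR (5 * S) - 1) <= V * (4 / 9) * (expR (5 * S) - 1) by rewrite ler_wpM2r; lra.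
have : 0 <= V * (expR (5 * S) - 1) by rewrite mulr_ge0; lra.
rewrite /cubic; lra.
Qed.

End CubicProfile.

Section BiasExponentials.
Context {R : realType}.
Variables (p : protocol) (n k : nat).
Hypothesis n_gt0 : (0 < n)%N.
Variables (c : config n k) (i j : 'I_k).
Hypothesis ij : i != j.
Implicit Types (mu : R).

Local Notation delta := (cnt c i - cnt c j : R).
Local Notation r := (freq c i + freq c j - gam c : R).
Local Notation Vh := (pair_var p c i j 1 1 : R).

(** By [mean_diff] the expected gap is [delta * (1 + r)]. The constants are [(1 - 2 * h) / 2] and
    [(1 + 2 * h) / 2] at [h = 1 / 100]. *)
Lemma bias_exp_bounds mu : 0 <= mu <= 1 / 100 ->
  expR (- (mu * (delta * (1 + r)))) * (1 + 49 / 100 * (mu ^+ 2 * Vh))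
    <= expect p c (fun c' => expR (- (mu * (cnt c' i - cnt c' j))))
    <= expR (- (mu * (delta * (1 + r)))) * expR (51 / 100 * (mu ^+ 2 * Vh)).
Proof.
move=> mu_bd; have /andP[mu0 mu1] := mu_bd.
have h6 : (1 / 100 : R) <= 1 / 6 by lra.
have := laplace_bounds p n_gt0 c ij mu_bd mu_bd h6.
have -> : mu * mean_cnt c j - mu * mean_cnt c i = - (mu * (delta * (1 + r))).
  by rewrite -mean_diff //; ring.
have -> : expect p c (fun c' => expR (mu * cnt c' j - mu * cnt c' i)) =
          expect p c (fun c' => expR (- (mu * (cnt c' i - cnt c' j)))).
  by apply: eq_expect => c'; congr expR; ring.
have V1 : pair_var p c i j mu mu <= mu ^+ 2 * Vh by apply: pair_var_le => //; rewrite mu0 lexx.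
have V2 : mu ^+ 2 * Vh <= pair_var p c i j mu mu by apply: pair_var_ge.
have -> : pair_var p c i j mu mu = mu ^+ 2 * Vh by apply/le_anti/andP.
rewrite expRD => /andP[lo up]; apply/andP; split.
  apply: le_trans lo; rewrite ler_wpM2l ?expR_ge0 //; lra.
apply: le_trans up _; rewrite ler_wpM2l ?expR_ge0 // ler_expR; lra.
Qed.

Hypothesis imax : forall o, freq c o <= freq c i :> R.

Lemma leader_delta_ge0 : 0 <= delta.
Proof.
by rewrite subr_ge0; have := imax j; rewrite /freq ler_pM2r ?invr_gt0 ?ltr0n.
Qed.

Lemma leader_drift_bounds : freq c j <= r <= 1.
Proof. by have [] := leader_facts n_gt0 ij imax; have := gam_ge0 c (R := R) ; lra. Qed.

(** The drift is taken from one scale, at which the rescaled gap is of order 1, while the noise of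
    all scales sums to a geometric series. The minimum covers gaps below [1 / nu], for which scale 0
    gives a drift linear in the gap. *)
Lemma expect_far M nu : 0 <= nu <= 1 / 100 -> nu ^+ 2 * Vh <= 1 -> nu * delta <= 2 ^+ M ->
  expect p c (fun c' => \sum_(m < M.+1) expR (- (nu / 2 ^+ m * (cnt c' i - cnt c' j))))
  <= \sum_(m < M.+1) expR (- (nu / 2 ^+ m * delta))
     - Num.min (1 / 2) (nu * delta) / 8 * r + 2 * (nu ^+ 2 * Vh).
Proof.
move=> /andP[nu0 nu1] nuV nuM.
have d0 := leader_delta_ge0; have /andP[br r1] := leader_drift_bounds.
have r0 : 0 <= r by apply: le_trans br; exact: freq_ge0.
have V0 : 0 <= Vh by exact: pair_var_ge0.
pose z := nu * delta; have z0 : 0 <= z by rewrite mulr_ge0.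
pose gain (m : 'I_M.+1) := expR (- (z / 2 ^+ m)) * (1 - expR (- (z / 2 ^+ m * r))).
have gain0 m : 0 <= gain m.
  by rewrite mulr_ge0 ?expR_ge0 // subr_ge0 expR_le1 oppr_le0 !mulr_ge0 ?invr_ge0 ?exprn_ge0.
have pow1 (m : nat) : 1 <= 2 ^+ m :> R by rewrite exprn_ege1 // ler1n.
have nu_m (m : nat) : 0 <= nu / 2 ^+ m <= 1 / 100.
  rewrite divr_ge0 ?exprn_ge0 //=; apply: le_trans nu1.
  by rewrite ler_pdivrMr ?exprn_gt0 // ler_peMr.
have term (m : 'I_M.+1) :
    expect p c (fun c' => expR (- (nu / 2 ^+ m * (cnt c' i - cnt c' j)))) <=
    expR (- (z / 2 ^+ m)) - gain m + (nu / 2 ^+ m) ^+ 2 * Vh.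
  have /andP[_ up] := bias_exp_bounds (nu_m m).
  apply: le_trans up _; set S := (nu / 2 ^+ m) ^+ 2 * Vh.
  have S0 : 0 <= S by rewrite mulr_ge0 ?sqr_ge0.
  have S1 : S <= 1.
    apply: le_trans nuV; rewrite ler_wpM2r // lerXn2r ?nnegrE //; first by case/andP: (nu_m m).
    by rewrite ler_pdivrMr ?exprn_gt0 // ler_peMr.
  have e1 : expR (51 / 100 * S) <= 1 + S.
    have [S3|S3] := leP S (9 / 10).
      by apply: le_trans (@expR_le_slope R _ (100 / 51) _ _ _) _; lra.
    have h : expR (51 / 100 * S) <= expR (51 / 100) by rewrite ler_expR; lra.
    apply: le_trans h _; have -> : (51 / 100 : R) = 2%:R * (51 / 200) by field.
    rewrite expRM_natl; have : expR (51 / 200 : R) <= 1 + 51 / 200 + (51 / 200) ^+ 2 / 2 + (51 / 200) ^+ 3 / 2.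
      by apply: expR_le_cubic; lra.
    have := expR_ge0 (51 / 200 : R); nra.
  have -> : - (nu / 2 ^+ m * (delta * (1 + r))) = - (z / 2 ^+ m) + - (z / 2 ^+ m * r).
    by rewrite /z; ring.
  rewrite expRD /gain.
  have a0 := expR_ge0 (- (z / 2 ^+ m)); have b0 := expR_ge0 (- (z / 2 ^+ m * r)).
  have a1 : expR (- (z / 2 ^+ m)) <= 1 by rewrite expR_le1 oppr_le0 divr_ge0 ?exprn_ge0.
  have b1 : expR (- (z / 2 ^+ m * r)) <= 1 by rewrite expR_le1 oppr_le0 !mulr_ge0 ?invr_ge0 ?exprn_ge0.
  move: a0 b0 a1 b1 e1; set A := expR (- (z / 2 ^+ m)); set B := expR (- (z / 2 ^+ m * r)).
  set D := expR _ => a0 b0 a1 b1 e1.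
  have ab0 : 0 <= A * B by rewrite mulr_ge0.
  have ab1 : A * B <= 1 by rewrite -[leRHS]mulr1 ler_pM.
  have : A * B * D <= A * B * (1 + S) by rewrite ler_wpM2l.
  nra.
rewrite expect_sum; apply: le_trans (ler_sum _ (fun m _ => term m)) _.
have -> : \sum_(m < M.+1) (expR (- (z / 2 ^+ m)) - gain m + (nu / 2 ^+ m) ^+ 2 * Vh) =
  \sum_(m < M.+1) expR (- (z / 2 ^+ m)) - \sum_(m < M.+1) gain m
  + (\sum_(m < M.+1) (nu / 2 ^+ m) ^+ 2) * Vh by rewrite big_split sumrB /= mulr_suml.
have e : \sum_(m < M.+1) expR (- (nu / 2 ^+ m * delta)) = \sum_(m < M.+1) expR (- (z / 2 ^+ m)).
  by apply: eq_bigr => m _; congr expR; rewrite /z; ring.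
rewrite e; apply: lerD.
  rewrite lerD2l lerN2; have [z_gt0|z_le0] := ltP 0 z; last first.
    have -> : nu * delta = 0 by apply/le_anti; rewrite z_le0.
    by rewrite (_ : Num.min (1 / 2) 0 = 0) ?mul0r ?sumr_ge0 // minEle; case: ifP => //; lra.
  have [m [m1 m2]] := dyadic_pick z_gt0 nuM.
  rewrite (bigD1 m) //=; apply: le_trans (_ : _ <= gain m) _; last first.
    by rewrite lerDl sumr_ge0.
  have zm : Num.min (1 / 2) (nu * delta) <= z / 2 ^+ m.
    by rewrite ge_min; case: m2 => [->//|->]; rewrite lexx orbT.
  have q := expRN_ge_quarter m1; rewrite /gain.
  have zr0 : 0 <= z / 2 ^+ m * r by rewrite mulr_ge0 ?divr_ge0 ?exprn_ge0.
  have zr1 : z / 2 ^+ m * r <= 1 by rewrite -[leRHS]mulr1 ler_pM ?divr_ge0 ?exprn_ge0.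
  have h := expRN_le_quad zr0.
  have h' : z / 2 ^+ m * r / 2 <= 1 - expR (- (z / 2 ^+ m * r)) by nra.
  have zmr : Num.min (1 / 2) (nu * delta) * r <= z / 2 ^+ m * r by rewrite ler_wpM2r.
  apply: le_trans (_ : _ <= 1 / 4 * (z / 2 ^+ m * r / 2)) _; first by lra.
  by rewrite ler_pM //; lra.
rewrite mulrA ler_wpM2r //.
exact: (@dyadic_sum_le R (fun x => x ^+ 2) (fun x => 2 * x ^+ 2) M.+1 nu
  (fun x _ => ltac:(have := sqr_ge0 x; lra)) (fun x _ => mulr_ge0 (ler0n _ _) (sqr_ge0 x)) nu0).
Qed.

End BiasExponentials.

Section DampedScale.
Context {R : realType}.

(** At a tie the cubic profile is evaluated at 2/3, inside its concave window. The first factor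
    switches the scale off once [x] exceeds about [1 / (K * rho ^+ 2)], so for a leader of count [x]
    the active scales resolve gaps of order [sqrt x] or more, the noise level of 2-Choices. With
    [K = 0] it is the plain profile. *)
Definition damped (K rho x y : R) : R :=
  expR (- (K * rho ^+ 2 * x)) * cubic (2 / 3 * expR (- (rho * (x - y)))).

Lemma damped_exp_bounds (p : protocol) (n k : nat) (n_gt0 : (0 < n)%N) (c : config n k) (i j : 'I_k) (K rho : R) (l : R) :
  i != j -> 0 < rho -> rho <= 1 / 10 ^+ 3 -> 0 <= K -> K * rho <= 1 / 10 ^+ 3 -> 1 <= l <= 3 ->
  let ka := K * rho ^+ 2 in
  let delta := cnt c i - cnt c j in let r := freq c i + freq c j - gam c in
  let Vh := pair_var p c i j 1 1 in
  let base := expR (ka * mean_cnt c i) *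
    expect p c (fun c' => expR (l * rho * cnt c' j - (l * rho + ka) * cnt c' i)) in
  (  expR (- (l * (rho * (delta * (1 + r))))) * (1 + 49 / 100 * (l ^+ 2 * (rho ^+ 2 * Vh)))
  <= base <=
  expR (- (l * (rho * (delta * (1 + r))))) * expR (51 / 100 * (l ^+ 2 * (rho ^+ 2 * Vh))) : Prop).
Proof.
move=> ij r0 r5 K0 Kr /andP[l1 l3] ka delta r Vh base.
have V0 : 0 <= Vh by exact: pair_var_ge0.
have lr0 : 0 <= l * rho by rewrite mulr_ge0 // ?(ltW r0) //; clear - l1; lra.
have ka0 : 0 <= ka by rewrite mulr_ge0 ?sqr_ge0.
have kaE : ka = rho * (K * rho) by rewrite /ka; ring.
have kal : ka <= 1 / 10 ^+ 3 * (l * rho).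
  rewrite kaE; apply: le_trans (_ : _ <= rho * (1 / 10 ^+ 3)) _; first by rewrite ler_wpM2l // ltW.
  have : rho * 1 <= rho * l by rewrite ler_wpM2l // ltW.
  by clear; lra.
pose h := l * rho + ka.
have lr3 : l * rho <= 3 * rho by rewrite ler_wpM2r // ltW.
have h3 : h <= 4 / 10 ^+ 3 by rewrite /h; clear - kal lr3 r5; lra.
have h0 : 0 <= h by rewrite /h addr_ge0.
have h6 : h <= 1 / 6 by clear - h3; lra.
have al_bd : 0 <= l * rho + ka <= h by rewrite -/h h0 lexx.
have be_bd : 0 <= l * rho <= h by rewrite lr0 /h lerDl.
(* Damping makes the weights of [i] and [j] unequal. As [ka] is at most a thousandth of [l * rho],
   the variance is squeezed between [(l * rho) ^+ 2 * Vh] and [(1 + 1 / 10 ^+ 3) ^+ 2] times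
   that. *)
have := laplace_bounds p n_gt0 c ij al_bd be_bd h6.
set W := pair_var _ _ _ _ _ _.
have W1 : W <= h ^+ 2 * Vh by apply: pair_var_le.
have W2 : (l * rho) ^+ 2 * Vh <= W by apply: pair_var_ge => //; rewrite lerDl.
have hsq : h ^+ 2 <= (1 + 1 / 10 ^+ 3) ^+ 2 * (l * rho) ^+ 2.
  have e0 : 0 <= 1 + 1 / 10 ^+ 3 :> R by rewrite addr_ge0 // divr_ge0 // exprn_ge0.
  have eh : h <= (1 + 1 / 10 ^+ 3) * (l * rho) by rewrite /h; clear - kal; lra.
  by rewrite -exprMn; apply: lerXn2r => //; rewrite nnegrE // mulr_ge0.
pose S := l ^+ 2 * (rho ^+ 2 * Vh).
have SE : (l * rho) ^+ 2 * Vh = S by rewrite /S; ring.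
have S0 : 0 <= S by rewrite -SE mulr_ge0 ?sqr_ge0.
have {}W1 : W <= (1 + 1 / 10 ^+ 3) ^+ 2 * S.
  by apply: le_trans W1 _; rewrite -SE mulrA ler_wpM2r.
rewrite SE in W2; have W0 : 0 <= W by apply: le_trans W2.
have -> : l * rho * mean_cnt c j - (l * rho + ka) * mean_cnt c i =
   - (ka * mean_cnt c i) - l * (rho * (delta * (1 + r))).
  by rewrite -mean_diff //; ring.
have e0 := expR_gt0 (ka * mean_cnt c i).
have cancel (t : R) : expR (ka * mean_cnt c i) * expR (- (ka * mean_cnt c i) + t) = expR t.
  by rewrite -expRD; congr expR; ring.
have cancel2 (t u : R) : expR (ka * mean_cnt c i) * expR (- (ka * mean_cnt c i) + t + u) = expR (t + u).
  by rewrite -expRD; congr expR; ring.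
move=> /andP[lo up]; rewrite /base -/S; apply/andP; split.
  apply: le_trans (ler_wpM2l (ltW e0) lo); rewrite [leRHS]mulrA cancel ler_wpM2l ?expR_ge0 //.
  have : W * h <= W * (4 / 10 ^+ 3) by rewrite ler_wpM2l.
  by clear - W2 W0 S0; lra.
apply: le_trans (ler_wpM2l (ltW e0) up) _; rewrite cancel2 -expRD ler_expR lerD2l.
have : W * h <= W * (4 / 10 ^+ 3) by rewrite ler_wpM2l.
by clear - W1 S0; lra.
Qed.

(** Expanding [cubic] leaves exponentials of the gap with rates [rho], [2 * rho] and [3 * rho], all
    carrying the same damping, whose value at the mean count factors out as [P]. *)
Lemma expect_damped (p : protocol) (n k : nat) (n_gt0 : (0 < n)%N) (c : config n k) (i j : 'I_k) (K rho : R) :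
  i != j -> (forall o, freq c o <= freq c i :> R) ->
  0 < rho -> rho <= 1 / 10 ^+ 3 -> 0 <= K -> K * rho <= 1 / 10 ^+ 3 ->
  let delta := cnt c i - cnt c j in let r := freq c i + freq c j - gam c in
  let Vh := pair_var p c i j 1 1 in
  let P := expR (- (K * rho ^+ 2 * mean_cnt c i)) in
  let V := 2 / 3 * expR (- (rho * (delta * (1 + r)))) in
  let S := rho ^+ 2 * Vh in
  (1 / 2 <= V -> S <= 1 / 1000 ->
    expect p c (fun c' => damped K rho (cnt c' i) (cnt c' j)) <= P * (cubic V - S / 10)) /\
  expect p c (fun c' => damped K rho (cnt c' i) (cnt c' j))
    <= P * (cubic V + 4 * V * (expR (5 * S) - 1)).
Proof.
move=> ij imax r0 r5 K0 Kr delta r Vh P V S.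
pose ka := K * rho ^+ 2.
pose base l : R := expR (ka * mean_cnt c i) *
  expect p c (fun c' => expR (l * rho * cnt c' j - (l * rho + ka) * cnt c' i)).
have P0 : 0 <= P by exact: expR_ge0.
have -> : expect p c (fun c' => damped K rho (cnt c' i) (cnt c' j)) =
    P * (3 * (2 / 3 * base 1) - 3 * (4 / 9 * base 2) + 8 / 27 * base 3).
  rewrite /base; set e := expR (ka * _).
  have Pe : P * e = 1 by rewrite /P /e -expRD addNr expR0.
  rewrite [RHS](_ : _ = P * e * (2 * expect p c (fun c' => expR (1 * rho * cnt c' j - (1 * rho + ka) * cnt c' i))
     - 4 / 3 * expect p c (fun c' => expR (2 * rho * cnt c' j - (2 * rho + ka) * cnt c' i))
     + 8 / 27 * expect p c (fun c' => expR (3 * rho * cnt c' j - (3 * rho + ka) * cnt c' i)))); last by field.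
  rewrite Pe mul1r -!expectZ -expectB -expectD; apply: eq_expect => c'.
  set x := cnt c' i; set y := cnt c' j; rewrite /damped -/ka /cubic.
  have -> : 1 * rho * y - (1 * rho + ka) * x = - (ka * x) + 1%:R * - (rho * (x - y)) by ring.
  have -> : 2 * rho * y - (2 * rho + ka) * x = - (ka * x) + 2%:R * - (rho * (x - y)) by ring.
  have -> : 3 * rho * y - (3 * rho + ka) * x = - (ka * x) + 3%:R * - (rho * (x - y)) by ring.
  by rewrite !expRD !expRM_natl; field.
have S0 : 0 <= S by rewrite mulr_ge0 ?sqr_ge0 ?pair_var_ge0.
have e0 := expR_ge0 (- (rho * (delta * (1 + r)))).
have V0 : 0 <= V by rewrite mulr_ge0.
have V2 : V <= 2 / 3.
  have := leader_delta_ge0 n_gt0 j imax; have /andP[] := leader_drift_bounds n_gt0 ij imax.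
  have := freq_ge0 c j (R := R); move=> b0 br _ d0.
  rewrite /V -[leRHS]mulr1 ler_wpM2l // expR_le1 oppr_le0 !mulr_ge0 ?(ltW r0) //.
  by move: b0 br; rewrite -/r => b0 br; clear - b0 br; lra.
have bd (m : nat) : (0 < m <= 3)%N -> 1 <= (m%:R : R) <= 3 by case/andP=> m0 m3; rewrite ler1n m0 ler_nat.
have /andP[_ A1] := damped_exp_bounds p n_gt0 c ij r0 r5 K0 Kr (bd 1%N isT).
have /andP[A2 _] := damped_exp_bounds p n_gt0 c ij r0 r5 K0 Kr (bd 2%N isT).
have /andP[_ A3] := damped_exp_bounds p n_gt0 c ij r0 r5 K0 Kr (bd 3%N isT).
have p1 : expR (- (1 * (rho * (delta * (1 + r))))) = expR (- (rho * (delta * (1 + r)))) by rewrite mul1r.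
have p2 : expR (- (2 * (rho * (delta * (1 + r))))) = expR (- (rho * (delta * (1 + r)))) ^+ 2.
  by rewrite -expRM_natl; congr expR; ring.
have p3 : expR (- (3 * (rho * (delta * (1 + r))))) = expR (- (rho * (delta * (1 + r)))) ^+ 3.
  by rewrite -expRM_natl; congr expR; ring.
rewrite p1 in A1; rewrite p2 in A2; rewrite p3 in A3.
have s1 : 51 / 100 * (1 ^+ 2 * (rho ^+ 2 * Vh)) = 51 / 100 * S by rewrite /S; field.
have s2 : 49 / 100 * (2 ^+ 2 * (rho ^+ 2 * Vh)) = 49 / 25 * S by rewrite /S; field.
have s3 : 51 / 100 * (3 ^+ 2 * (rho ^+ 2 * Vh)) = 459 / 100 * S by rewrite /S; field.
rewrite s1 in A1; rewrite s2 in A2; rewrite s3 in A3.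
have B1 : 2 / 3 * base 1 <= V * expR (51 / 100 * S).
  by rewrite /V -[leRHS]mulrA ler_wpM2l.
have B2 : V ^+ 2 * (1 + 49 / 25 * S) <= 4 / 9 * base 2.
  have -> : V ^+ 2 = 4 / 9 * expR (- (rho * (delta * (1 + r)))) ^+ 2 by rewrite /V; field.
  by rewrite -[leLHS]mulrA ler_wpM2l.
have B3 : 8 / 27 * base 3 <= V ^+ 3 * expR (459 / 100 * S).
  have -> : V ^+ 3 = 8 / 27 * expR (- (rho * (delta * (1 + r)))) ^+ 3 by rewrite /V; field.
  by rewrite -[leRHS]mulrA ler_wpM2l.
split=> [V1 S1|]; rewrite ler_wpM2l //.
  by apply: cubic_noise_gain B1 B2 B3; rewrite ?V1 ?S0.
apply: cubic_noise_cost B1 _ B3; rewrite ?V0 //.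
by apply: le_trans B2; rewrite ler_peMr ?sqr_ge0 //; clear - S0; lra.
Qed.

Lemma expect_cubic (p : protocol) (n k : nat) (n_gt0 : (0 < n)%N) (c : config n k) (i j : 'I_k) (mu : R) :
  i != j -> (forall o, freq c o <= freq c i :> R) -> 0 < mu -> mu <= 1 / 10 ^+ 3 ->
  let V := 2 / 3 * expR (- (mu * ((cnt c i - cnt c j) * (1 + (freq c i + freq c j - gam c))))) in
  let S := mu ^+ 2 * pair_var p c i j 1 1 in
  let E := expect p c (fun c' => cubic (2 / 3 * expR (- (mu * (cnt c' i - cnt c' j))))) in
  (1 / 2 <= V -> S <= 1 / 1000 -> E <= cubic V - S / 10) /\
  E <= cubic V + 4 * V * (expR (5 * S) - 1).
Proof.
move=> ij imax mu0 mu1 V S E.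
have K0 : 0 * mu <= 1 / 10 ^+ 3 by rewrite mul0r divr_ge0 // exprn_ge0.
have := expect_damped p n_gt0 ij imax mu0 mu1 (lexx 0) K0; rewrite /= !mul0r oppr0 expR0 !mul1r.
have -> : expect p c (fun c' => damped 0 mu (cnt c' i) (cnt c' j)) = E.
  by apply: eq_expect => c'; rewrite /damped !mul0r oppr0 expR0 mul1r.
by [].
Qed.

End DampedScale.

(** * 3-Majority: fast consensus *)

Section Maj3Potential.
Context {R : realType}.

(** At the scale comparable to the count [X] the rate is about [1 / X] and the variance of the count
    about [X], so concavity gains about [1 / X]: small opinions die by fluctuation. This noise term
    is discarded in [expect_log_like_le]. *)
Lemma expect_log_like_maj3 n k (n_gt0 : (0 < n)%N) M (c : config n k) (i j : 'I_k) :
  i != j -> (forall o, freq c o <= freq c i :> R) ->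
  1 <= cnt c j :> R -> cnt c j <= 2 ^+ M :> R ->
  expect ThreeMajority c (fun c' => log_like M.+1 (cnt c' j)) <=
  log_like M.+1 (cnt c j) + 3 * freq c j - gam c / 64 - (40 * 40 * 4 * cnt c j : R)^-1.
Proof.
move=> ij imax j1 jM; apply: le_trans (expect_log_like _ n_gt0 _ _ ij) _.
have /andP[] := size_weight_bounds j1 jM; set S := \sum_(m < M.+1) _ => S1 S3.
have b0 : 0 <= freq c j :> R by exact: freq_ge0.
have g0 : 0 <= gam c :> R by exact: gam_ge0.
have [_ ba ab1 ga gab] := leader_facts n_gt0 ij imax.
have X0 : 0 < cnt c j / 8 :> R by lra.
have [|m [m1 m2]] := @dyadic_pick R M _ X0; first by apply: le_trans jM; lra.
(* Since [a >= b], [gam] is at least [2 * b ^+ 2], and [b - 2 * b ^+ 2] never exceeds 1/8. *)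
have eb : freq c j - gam c <= 1 / 8 :> R.
  have b2 : freq c j ^+ 2 <= freq c i ^+ 2 :> R by rewrite lerXn2r ?nnegrE ?freq_ge0.
  by have := sqr_ge0 (freq c j - 1 / 4 : R); lra.
have g1 := gam_le1 n_gt0 c (R := R).
have mean_nn : 0 <= mean_cnt c j :> R by rewrite /mean_cnt mulr_ge0 ?cnt_ge0 //; lra.
have ji : j != i by rewrite eq_sym.
pose T (l : 'I_M.+1) := expR (- (mean_cnt c j / 8 / 2 ^+ l)) *
      (3 / 8 * pair_var ThreeMajority c j i (8^-1 / 2 ^+ l) 0) : R.
have T0 l : 0 <= T l by rewrite !mulr_ge0 ?expR_ge0 ?pair_var_ge0.
have : (1 - gam c) * (40 * 40 * 4 * cnt c j)^-1 <= T m.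
  rewrite /T single_var_maj3 //.
  set X := cnt c j in j1 X0 m1 m2 *; set b := freq c j in b0 ba ab1 gab eb *.
  set g := gam c in g0 ga gab eb g1 *.
  set zm := X / 8 / 2 ^+ m in m1 m2.
  have zm8 : 1 / 8 <= zm by case: m2 => [|->]; lra.
  have e2 : 1 / 16 <= expR (- (mean_cnt c j / 8 / 2 ^+ m)) :> R.
    have -> : - (mean_cnt c j / 8 / 2 ^+ m) = 2%:R * - (zm * (1 + b - g) / 2).
      by rewrite /mean_cnt -/X -/b -/g /zm; field; rewrite expf_neq0.
    rewrite expRM_natl; have : zm * (1 + b - g) / 2 <= 1.
      by have : zm * (1 + b - g) <= 1 * (1 + b - g) by [rewrite ler_wpM2r //; lra]; lra.
    by move=> /expRN_ge_quarter; nra.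
  have nb : n%:R * b = X by rewrite /b -cnt_freq.
  have -> : n%:R * ((8^-1 / 2 ^+ m) ^+ 2 * (b * (1 + b - g) * (1 - b * (1 + b - g)))) =
      zm ^+ 2 * (X^-1 * ((1 + b - g) * (1 - b * (1 + b - g)))).
    have nz : n%:R != 0 :> R by rewrite pnatr_eq0 -lt0n.
    have bz : b != 0 by apply/eqP => bE; move: nb; rewrite bE mulr0; lra.
    by rewrite /zm -nb; field; rewrite ?nz ?bz ?expf_neq0.
  have y : 7 / 16 <= 1 - b * (1 + b - g).
    have : b * (1 + b - g) <= 1 / 2 * (9 / 8) by rewrite ler_pM //; lra.
    lra.
  have Xi0 : 0 <= X^-1 by rewrite invr_ge0; lra.
  have z2 : 1 / 64 <= zm ^+ 2 by nra.
  have q1 : (1 - g) * (7 / 16) <= (1 + b - g) * (1 - b * (1 + b - g)) by rewrite ler_pM //; lra.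
  have q2 : X^-1 * ((1 - g) * (7 / 16)) <= X^-1 * ((1 + b - g) * (1 - b * (1 + b - g))) by rewrite ler_wpM2l.
  have q20 : 0 <= X^-1 * ((1 - g) * (7 / 16)) by rewrite !mulr_ge0 //; lra.
  have q3 : 1 / 64 * (X^-1 * ((1 - g) * (7 / 16))) <= zm ^+ 2 * (X^-1 * ((1 + b - g) * (1 - b * (1 + b - g)))).
    by rewrite ler_pM //; lra.
  have q4 : 1 / 16 * (3 / 8 * (1 / 64 * (X^-1 * ((1 - g) * (7 / 16))))) <=
     expR (- (mean_cnt c j / 8 / 2 ^+ m)) * (3 / 8 * (zm ^+ 2 * (X^-1 * ((1 + b - g) * (1 - b * (1 + b - g)))))).
    by rewrite ler_pM //; lra.
  (* The product of 1/16, 3/8, 1/64 and 7/16 is 21/131072, just above 1/6400. *)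
  apply: le_trans q4; rewrite invfM; lra.
have TS : T m <= \sum_(l < M.+1) T l by rewrite (bigD1 m) //= lerDl sumr_ge0.
have iX : (40 * 40 * 4 * cnt c j : R)^-1 <= 1 / 100.
  by rewrite div1r lef_pV2 ?posrE; lra.
have iX0 : 0 <= (40 * 40 * 4 * cnt c j : R)^-1 by rewrite invr_ge0; lra.
have : (freq c j - gam c) * S <= 3 * freq c j - gam c / 32 by nra.
(* The factor [1 - gam] of the gain is paid for by lowering the coefficient of [gam] from 1/32 to
   1/64. *)
have : gam c * (40 * 40 * 4 * cnt c j)^-1 <= gam c * (1 / 100) :> R by rewrite ler_wpM2l.
lra.
Qed.

Lemma weighted_amgm (P q w t : R) : 0 < P -> w ^+ 2 <= 4 * (P * q) -> w * t <= P * t ^+ 2 + q.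
Proof.
move=> P0 h; rewrite -(ler_pM2l (mulr_gt0 (ltr0n _ 4 : 0 < 4) P0)) -subr_ge0.
have -> : 4 * P * (P * t ^+ 2 + q) - 4 * P * (w * t) = (2 * P * t - w) ^+ 2 + (4 * (P * q) - w ^+ 2) by ring.
by rewrite addr_ge0 ?sqr_ge0 ?subr_ge0.
Qed.

End Maj3Potential.

Section Maj3Drift.
Context {R : realType}.
Implicit Types (h a b g X s z e S : R).

(* [h] below is the ratio between the weights of successive parts of the potential; the AM-GM
   step of [maj3_outer_arith] needs it this small. *)
Definition lam2 : R := 1 / 10 ^+ 6.
Definition is_tiny h := 0 < h /\ h * 10 ^+ 12 <= 1.

Definition maj3_rate h : R := h * (lam2 / 10 ^+ 2) / (10 ^+ 4 * 2).

(** The danger is the last term on the left, the noise cost of the cubic profile. If [g <= a / 2]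
    the gap drift [a + b - g] is at least [a / 2] and pays. Otherwise [a] is split into [b] plus the
    gap; the decay [e] reduces the gap part to order [h / s], and AM-GM distributes [1 / s] between
    [b = X / s ^+ 2] and [1 / X]. *)
Lemma maj3_outer_arith h a b g X s z e S : is_tiny h ->
  0 <= b -> b <= a -> a + b <= 1 -> g <= a -> a ^+ 2 + b ^+ 2 <= g ->
  1 <= X -> 0 < s -> b = X / s ^+ 2 -> a - b = 10 ^+ 3 * z / s ->
  0 <= e <= 1 -> z * e <= 1 -> 0 <= S <= 4 * lam2 * a ->
  h * (lam2 / 10 ^+ 2) * (3 * b - g / 64 - (40 * 40 * 4 * X)^-1) - 1 / 80 * (a + b - g)
    + 2 * h ^+ 2 * S + h * (64 * lam2 * a * e) <= - maj3_rate h * (g + X^-1 + b).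
Proof.
move=> [h0 h12] b0 ba ab1 ga gab X1 s0 bX abz /andP[e0 e1] ze /andP[S0 Sa].
have g0 : 0 <= g by have := sqr_ge0 a; have := sqr_ge0 b; lra.
have h6 : h <= 1 / 10 ^+ 6 by lra.
have a0 : 0 <= a by lra.
have -> : (40 * 40 * 4 * X)^-1 = X^-1 / (40 * 40 * 4) by rewrite invfM; lra.
have Y0 : 0 <= X^-1 by rewrite invr_ge0; lra.
rewrite /maj3_rate /lam2 in Sa *; set Y := X^-1 in Y0 *.
have hb : h * b <= 1 / 10 ^+ 6 * b by rewrite ler_wpM2r.
have hb0 : 0 <= h * b by rewrite mulr_ge0 // ltW.
have hg0 : 0 <= h * g by rewrite mulr_ge0 // ltW.
have hY0 : 0 <= h * Y by rewrite mulr_ge0 // ltW.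
have ha0 : 0 <= h * a by rewrite mulr_ge0 // ltW.
have hS0 : 0 <= h * S by rewrite mulr_ge0 // ltW.
have h2S : h ^+ 2 * S <= 1 / 10 ^+ 6 * (h * S) by rewrite expr2 -mulrA ler_wpM2r.
have hS : h * S <= 4 / 10 ^+ 6 * (h * a).
  by have := ler_wpM2l (ltW h0) Sa; lra.
have [ga2|ga2] := leP g (a / 2).
  have ha : h * a <= 1 / 10 ^+ 6 * a by rewrite ler_wpM2r.
  have hae : h * a * e <= h * a by rewrite -[leRHS]mulr1 ler_wpM2l.
  lra.
have hag : h * a <= 2 * (h * g) by have := ler_wpM2l (ltW h0) (ltW ga2); lra.
have hae : h * a * e <= h * b + 10 ^+ 3 * h / s.
  have -> : a = b + 10 ^+ 3 * z / s by lra.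
  have -> : h * (b + 10 ^+ 3 * z / s) * e = h * b * e + 10 ^+ 3 * h / s * (z * e) by field; rewrite gt_eqF.
  apply: lerD; first by rewrite -[leRHS]mulr1 ler_wpM2l.
  by rewrite -[leRHS]mulr1 ler_wpM2l // divr_ge0 ?mulr_ge0 ?ltW.
have amgm : 64 / 10 ^+ 3 * h / s <= b / 200 + h / (10 ^+ 8 * (40 * 40 * 8)) * Y.
  have A : 64 / 10 ^+ 3 * h * (X / s) <=
      1 / 200 * (X / s) ^+ 2 + h / (10 ^+ 8 * (40 * 40 * 8)).
    apply: weighted_amgm; first by lra.
    have : h * h <= h * (1 / 10 ^+ 12).
      by rewrite ler_wpM2l ?(ltW h0) //; lra.
    by lra.
  have X0 : 0 < X by lra.
  rewrite -(ler_pM2r X0).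
  have -> : 64 / 10 ^+ 3 * h / s * X = 64 / 10 ^+ 3 * h * (X / s) by ring.
  apply: le_trans A _; rewrite /Y bX le_eqVlt; apply/orP; left; apply/eqP.
  by field; rewrite !gt_eqF.
lra.
Qed.

(** Near a tie the noise gain, at least [h * lam2 * a / 20], has to beat the growth [3 * b] of the
    size term; the weight [lam2 / 10 ^+ 2] of that term is small enough for this, as [b <= a]. *)
Lemma maj3_inner_arith h a b g X S : is_tiny h ->
  0 <= b -> b <= a -> 0 <= g -> 1 <= X -> lam2 * (a / 2) <= S ->
  h * (lam2 / 10 ^+ 2) * (3 * b - g / 64 - (40 * 40 * 4 * X)^-1)
    + 2 * h ^+ 2 * S - h * (S / 10) <= - maj3_rate h * (g + X^-1 + b).
Proof.
move=> [h0 h12] b0 ba g0 X1 Sa.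
have h6 : h <= 1 / 10 ^+ 6 by lra.
have -> : (40 * 40 * 4 * X)^-1 = X^-1 / (40 * 40 * 4) by rewrite invfM; lra.
have Y0 : 0 <= X^-1 by rewrite invr_ge0; lra.
rewrite /maj3_rate /lam2 in Sa *; set Y := X^-1 in Y0 *.
have S0 : 0 <= S by lra.
have hb : h * b <= h * a by rewrite ler_wpM2l // ltW.
have hb0 : 0 <= h * b by rewrite mulr_ge0 // ltW.
have hg0 : 0 <= h * g by rewrite mulr_ge0 // ltW.
have hY0 : 0 <= h * Y by rewrite mulr_ge0 // ltW.
have h2S : h ^+ 2 * S <= 1 / 10 ^+ 6 * (h * S) by rewrite expr2 -mulrA ler_wpM2r // mulr_ge0 // ltW.
have := ler_wpM2l (ltW h0) Sa; lra.
Qed.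

(** The exponentials live on the much coarser scale [h ^+ 2 / (10 ^+ 3 * s)] with weight [h ^- 2]:
    beyond the noise level their drift is of order [r] with a constant free of [h], whereas their
    noise cost, of order [h ^+ 2 * S], is negligible against the gain [h * S / 10] of the cubic
    profile. *)
Definition maj3_potential h M s (x y : R) : R :=
  h * (lam2 / 10 ^+ 2) * log_like M.+1 y
  + h ^- 2 * (\sum_(m < M.+1) expR (- (h ^+ 2 * (1 / 10 ^+ 3 / s) / 2 ^+ m * (x - y))))
  + h * cubic (2 / 3 * expR (- (1 / 10 ^+ 3 / s * (x - y)))).

Lemma maj3_drift h n k (n_gt0 : (0 < n)%N) M (c : config n k) (i j : 'I_k) :
  is_tiny h -> 400 <= Num.sqrt n%:R :> R -> n%:R <= 2 ^+ M :> R ->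
  i != j -> (forall o, freq c o <= freq c i :> R) -> 1 <= cnt c j :> R ->
  expect ThreeMajority c (fun c' => maj3_potential h M (Num.sqrt n%:R) (cnt c' i) (cnt c' j))
  <= maj3_potential h M (Num.sqrt n%:R) (cnt c i) (cnt c j)
     - maj3_rate h * (gam c + (cnt c j)^-1 + freq c j).
Proof.
move=> hh s400 nM ij imax X1.
have [h0 h12] := hh; have h6 : h <= 1 / 10 ^+ 6 by lra.
set s := Num.sqrt n%:R in s400 *.
have s2 : s ^+ 2 = n%:R by rewrite sqr_sqrtr.
have s0 : 0 < s by lra.
have n0 : 0 < n%:R :> R by rewrite ltr0n.
have [b0 ba ab1 ga gab] := leader_facts n_gt0 ij imax.
have g0 := gam_ge0 c (R := R).
have d0 := leader_delta_ge0 n_gt0 j imax.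
have /andP[br r1] := leader_drift_bounds n_gt0 ij imax.
have XM : cnt c j <= 2 ^+ M :> R.
  by apply: le_trans nM; rewrite (cnt_freq n_gt0) -[leRHS]mulr1 ler_wpM2l // freq_le1.
have T := expect_log_like_maj3 n_gt0 ij imax X1 XM.
pose mu : R := 1 / 10 ^+ 3 / s.
have mu0 : 0 < mu by rewrite divr_gt0.
have mu3 : mu <= 1 / 300 by rewrite /mu ler_pdivrMr //; lra.
pose Vh : R := pair_var ThreeMajority c i j 1 1.
pose S := mu ^+ 2 * Vh.
have V_up : Vh <= n%:R * (4 * freq c i) by exact: pair_var_maj3_le.
have V_ge0 : 0 <= Vh by exact: pair_var_ge0.
have mu2n : mu ^+ 2 * n%:R = lam2 by rewrite -s2 /mu /lam2; field; rewrite gt_eqF.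
have S0 : 0 <= S by rewrite mulr_ge0 ?sqr_ge0.
have S_up : S <= 4 * lam2 * freq c i.
  have : S <= mu ^+ 2 * (n%:R * (4 * freq c i)) by rewrite ler_wpM2l ?sqr_ge0.
  by rewrite mulrA mu2n; lra.
have a1 : freq c i <= 1 :> R by exact: freq_le1.
have lam2E : lam2 = 1 / 10 ^+ 6 by [].
have S_small : S <= 4 / 10 ^+ 6.
  by apply: le_trans S_up _; rewrite lam2E; have := freq_ge0 c i (R := R); lra.
pose nu := h ^+ 2 * mu.
have h2 : h ^+ 2 <= 1 / 10 ^+ 12 by rewrite expr2; have := ler_wpM2l (ltW h0) h6; lra.
have h20 : 0 <= h ^+ 2 by exact: sqr_ge0.
have nu_bd : 0 <= nu <= 1 / 100.
  rewrite mulr_ge0 ?(ltW mu0) //=; have := ler_wpM2r (ltW mu0) h2; rewrite -/nu; lra.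
have nuS : nu ^+ 2 * Vh = h ^+ 2 * (h ^+ 2 * S) by rewrite /nu /S; ring.
have h2S : h ^+ 2 * S <= S.
  by have := ler_wpM2r S0 h2; lra.
have nuV : nu ^+ 2 * Vh <= 1.
  rewrite nuS; have : h ^+ 2 * (h ^+ 2 * S) <= h ^+ 2 * S by rewrite ler_wpM2l.
  by lra.
have nuM : nu * (cnt c i - cnt c j) <= 2 ^+ M.
  apply: le_trans nM; apply: le_trans (_ : _ <= 1 * (cnt c i - cnt c j)) _.
    by rewrite ler_wpM2r //; lra.
  rewrite mul1r lerBlDr (cnt_freq n_gt0); have : n%:R * freq c i <= n%:R * 1 :> R by rewrite ler_wpM2l.
  have := cnt_ge0 c j (R := R); lra.
have F := expect_far (p := ThreeMajority) n_gt0 ij imax nu_bd nuV nuM.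
have mu4 : mu <= 1 / 10 ^+ 3 by rewrite /mu ler_pdivrMr // ler_peMr ?divr_ge0 ?exprn_ge0 //; clear - s400; lra.
have [N1 N2] := expect_cubic ThreeMajority n_gt0 ij imax mu0 mu4.
rewrite -/Vh -/S in N1 N2 F.
set delta := cnt c i - cnt c j in d0 nuM F N1 N2.
set r := freq c i + freq c j - gam c in br r1 F N1 N2.
have r0 : 0 <= r by apply: le_trans br.
pose z := mu * delta; have z0 : 0 <= z by rewrite mulr_ge0 // ltW.
have zr : mu * (delta * (1 + r)) = z * (1 + r) by rewrite /z; ring.
rewrite zr in N1 N2.
set V := 2 / 3 * expR (- (z * (1 + r))) in N1 N2.
have Vv : cubic V <= cubic (2 / 3 * expR (- z)).
  apply: cubic_le; first by rewrite mulr_ge0 ?expR_ge0.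
  by rewrite ler_wpM2l // ler_expR lerN2; have := mulr_ge0 z0 r0; clear; lra.
pose Y : R := (cnt c j)^-1.
have split_pot (c' : config n k) : maj3_potential h M s (cnt c' i) (cnt c' j) =
    h * (lam2 / 10 ^+ 2) * log_like M.+1 (cnt c' j)
    + h ^- 2 * (\sum_(m < M.+1) expR (- (nu / 2 ^+ m * (cnt c' i - cnt c' j))))
    + h * cubic (2 / 3 * expR (- (mu * (cnt c' i - cnt c' j)))) by [].
rewrite (eq_expect _ _ split_pot) !expectD !expectZ split_pot -/delta.
set mn := Num.min _ _ in F.
have mn0 : 0 <= mn by rewrite le_min; case/andP: nu_bd => nu0 _; apply/andP; split; [exact: divr_ge0|exact: mulr_ge0].
have hq : 0 <= h * (lam2 / 10 ^+ 2) by rewrite mulr_ge0 ?(ltW h0) // lam2E !divr_ge0 ?exprn_ge0.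
have {}T := ler_wpM2l hq T.
have ih2 : 0 <= h ^- 2 by rewrite invr_ge0.
have {}F := ler_wpM2l ih2 F.
have hz2 : h ^- 2 * h ^+ 2 = 1 by rewrite mulVf // expf_neq0 // gt_eqF.
have FE : h ^- 2 * (\sum_(m < M.+1) expR (- (nu / 2 ^+ m * delta)) - mn / 8 * r + 2 * (nu ^+ 2 * Vh))
  = h ^- 2 * (\sum_(m < M.+1) expR (- (nu / 2 ^+ m * delta))) - (h ^- 2 * mn) / 8 * r + 2 * h ^+ 2 * S.
  rewrite nuS; have -> : 2 * h ^+ 2 * S = h ^- 2 * h ^+ 2 * (2 * h ^+ 2 * S) by rewrite hz2 mul1r.
  by ring.
rewrite FE in F; set Far := h ^- 2 * \sum_(m < M.+1) _ in F *.
set E1 := expect _ _ _ in T *; set E2 := expect _ _ _ in F *; set E3 := expect _ _ _ in N1 N2 *.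
(* Up to 1/10, [z * (1 + r)] is at most 1/5 and [V] stays in the window from 1/2 to 2/3; beyond, the
   exponentials give a drift of at least [r / 80]. *)
have [z1|z1] := leP z (1 / 10).
  have Vhalf : 1 / 2 <= V.
    have z2 : z * (1 + r) <= 1 / 5 by clear - z0 z1 r0 r1; nra.
    by have := expR_ge1Dx (- (z * (1 + r))); rewrite /V; clear - z2; lra.
  have {N2}N1 : h * E3 <= h * (cubic (2 / 3 * expR (- z)) - S / 10).
    rewrite ler_wpM2l ?(ltW h0) //; apply: le_trans (N1 Vhalf _) _; first by clear - S_small; lra.
    by clear - Vv; lra.
  have ab4 : freq c i - freq c j <= 1 / 4 :> R.
    have -> : freq c i - freq c j = delta / n%:R :> R by rewrite /delta /freq mulrBl.
    rewrite ler_pdivrMr // -s2; have -> : delta = z * (10 ^+ 3 * s).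
      by rewrite /z /mu; field; rewrite gt_eqF.
    have : z * (10 ^+ 3 * s) <= 1 / 10 * (10 ^+ 3 * s) by clear - z1 s0; nra.
    by clear - s400; nra.
  have S_low : lam2 * (freq c i / 2) <= S.
    rewrite -mu2n -mulrA ler_wpM2l ?sqr_ge0 //; exact: pair_var_maj3_ge.
  have Far0 : 0 <= h ^- 2 * mn / 8 * r by rewrite !mulr_ge0.
  have := maj3_inner_arith hh b0 ba g0 X1 S_low.
  rewrite -/Y; clear - T F N1 Far0; lra.
have mn10 : 1 / 10 <= h ^- 2 * mn.
  have : h ^+ 2 * (1 / 10) <= mn.
    rewrite le_min; apply/andP; split; first by clear - h2; lra.
    by rewrite /nu -[leRHS]mulrA ler_wpM2l // ltW.
  move=> /(ler_wpM2l ih2); have -> : h ^- 2 * (h ^+ 2 * (1 / 10)) = h ^- 2 * h ^+ 2 * (1 / 10) by ring.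
  by rewrite hz2 => H; clear - H; lra.
have {}mn10 : 1 / 80 * r <= h ^- 2 * mn / 8 * r by clear - mn10 r0; nra.
set e := expR (- z).
have e01 : 0 <= e <= 1 by rewrite expR_ge0 expR_le1 oppr_le0.
have ze : z * e <= 1.
  by rewrite /e expRN ler_pdivrMr ?expR_gt0 // mul1r; have := expR_ge1Dx z; clear; lra.
have abz : freq c i - freq c j = 10 ^+ 3 * z / s :> R.
  have -> : freq c i - freq c j = delta / n%:R :> R by rewrite /delta /freq mulrBl.
  by rewrite -s2 /z /mu; field; rewrite gt_eqF.
have bX : freq c j = cnt c j / s ^+ 2 :> R by rewrite s2.
have near : 4 * V * (expR (5 * S) - 1) <= 64 * lam2 * freq c i * e.
  have e5 : expR (5 * S) <= 1 + 6 / 5 * (5 * S).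
    by clear - S0 S_small; apply: expR_le_slope; lra.
  have Ve : V <= 2 / 3 * e.
    by rewrite ler_wpM2l // ler_expR lerN2; have := mulr_ge0 z0 r0; clear; lra.
  have V0 : 0 <= V by rewrite mulr_ge0 ?expR_ge0.
  have : V * (expR (5 * S) - 1) <= 2 / 3 * e * (6 * S).
    rewrite ler_pM //; last by clear - e5; lra.
    by rewrite subr_ge0; apply: le_trans (expR_ge1Dx _); clear - S0; lra.
  have : e * S <= e * (4 * lam2 * freq c i) by rewrite ler_wpM2l //; case/andP: e01.
  by clear; lra.
have {N1}N2 : h * E3 <= h * (cubic (2 / 3 * e) + 64 * lam2 * freq c i * e).
  by rewrite ler_wpM2l ?(ltW h0) //; apply: le_trans N2 _; exact: lerD.
have S_bd : 0 <= S <= 4 * lam2 * freq c i by rewrite S0.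
have := maj3_outer_arith hh b0 ba ab1 ga gab X1 s0 bX abz e01 ze S_bd.
rewrite -/Y -/r; clear - T F N2 mn10; lra.
Qed.

End Maj3Drift.

(** * From drift per round to a failure probability of order 1/n *)

Section Amplification.
Context {R : realType}.

Lemma expR_ln_nat (n : nat) : (0 < n)%N -> expR (ln n%:R) = n%:R :> R.
Proof. by move=> n0; rewrite lnK // posrE ltr0n. Qed.

Lemma ln_nat_le (n : nat) : (0 < n)%N -> ln n%:R <= n%:R :> R.
Proof.
move=> n0; have := expR_ge1Dx (ln n%:R : R); rewrite expR_ln_nat //.
by apply: le_trans; rewrite lerDr.
Qed.

Lemma ln_nat_ge (x : R) : exists n0 : nat, forall n : nat, (n0 <= n)%N -> x <= ln n%:R :> R.
Proof.
exists (Num.truncn (expR x)).+1 => n nn; rewrite -ler_expR expR_ln_nat; last by apply: leq_trans nn.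
have /truncn_itv/andP[_ /ltW le1] := expR_ge0 x.
by apply: le_trans le1 _; rewrite ler_nat.
Qed.

Lemma trunc_log2_le (n : nat) : (0 < n)%N -> 1 <= ln n%:R :> R ->
  ((trunc_log 2 n).+2)%:R <= 4 * ln n%:R :> R.
Proof.
move=> n0 L1; set m := trunc_log 2 n.
have e2 : expR (1 / 2) <= 2 :> R.
  apply: le_trans (expR_le_slope (q := 2) _ _ _) _; lra.
have : expR (m%:R * (1 / 2)) <= expR (ln n%:R) :> R.
  rewrite expRM_natl expR_ln_nat //; apply: le_trans (_ : _ <= 2 ^+ m) _.
    by rewrite lerXn2r ?nnegrE ?expR_ge0.
  by rewrite -natrX ler_nat trunc_logP.
by rewrite ler_expR -[m.+2]addn2 natrD; lra.
Qed.

(** Origin of the exponent 3: the decay rate [d / U] is of order [1 / (Y * L)], so one factor [L]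
    undoes this, one brings the decay to [n ^- 3], and one absorbs the constant [24 / ka]. The
    prefactor is at most [4 * A * n ^ 2], which leaves order [1 / n]. *)
Lemma amplify (A ka Y U l0 d M L : R) (n k : nat) : (k <= n)%N -> (0 < n)%N ->
  0 < ka -> 0 <= A -> 1 <= Y -> 0 < U -> 0 < l0 -> 0 <= d -> d <= U -> 0 < M ->
  U / l0 <= A * M -> ka <= d / U * (M * Y) -> L = ln n%:R ->
  1 <= L -> 24 / ka <= L -> M <= 4 * L ->
  k%:R * U / l0 * (1 - d / U) ^+ Num.truncn (Y * L ^+ 3) <= 4 * A / n%:R.
Proof.
move=> kn n0 ka0 A0 Y1 U0 l00 d0 dU M0 UA kad LE L1 Lka ML.
have n0R : 0 < n%:R :> R by rewrite ltr0n.
set t := Num.truncn _; set q := d / U in kad *.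
have q0 : 0 <= q by rewrite divr_ge0 // ltW.
have q1 : q <= 1 by rewrite ler_pdivrMr ?mul1r.
have YL : 1 <= Y * L ^+ 3 by rewrite mulr_ege1 // exprn_ege1.
have tge : Y * L ^+ 3 / 2 <= t%:R.
  have /truncn_itv/andP[_] : 0 <= Y * L ^+ 3 by apply: le_trans YL.
  have t1 : 1 <= t%:R :> R by rewrite ler1n truncn_gt0.
  by rewrite -/t -natr1; lra.
have qt : 3 * L <= t%:R * q.
  apply: le_trans (_ : _ <= Y * L ^+ 3 / 2 * q) _; last by rewrite ler_wpM2r.
  have kaL : 24 <= L * ka by rewrite -ler_pdivrMr.
  have YM : ka / (4 * L) <= q * Y.
    rewrite ler_pdivrMr ?mulr_gt0 //; last by lra.
    apply: le_trans kad _; rewrite (_ : q * (M * Y) = q * Y * M); last by ring.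
    by rewrite ler_wpM2l // mulr_ge0 //; lra.
  apply: le_trans (_ : _ <= L ^+ 3 / 2 * (ka / (4 * L))) _.
    rewrite (_ : _ * (ka / _) = L * (L * ka) / 8); last by field; rewrite gt_eqF //; lra.
    have : L * 24 <= L * (L * ka) by rewrite ler_wpM2l //; lra.
    lra.
  rewrite (_ : Y * _ / 2 * q = L ^+ 3 / 2 * (q * Y)); last by ring.
  by rewrite ler_wpM2l // divr_ge0 // exprn_ge0 //; lra.
have pow : (1 - q) ^+ t <= (n%:R ^+ 3)^-1.
  apply: le_trans (_ : _ <= expR (- q) ^+ t) _.
    by rewrite lerXn2r ?nnegrE ?expR_ge0 ?subr_ge0 //; exact: expR_ge1Dx.
  rewrite -expRM_natl mulrN expRN lef_pV2 ?posrE ?exprn_gt0 ?expR_gt0 //.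
  by rewrite -[X in X ^+ 3](expR_ln_nat n0) -expRM_natl ler_expR -LE.
have Ln : L <= n%:R by rewrite LE ln_nat_le.
have fac : k%:R * U / l0 <= n%:R * (A * (4 * n%:R)).
  rewrite -mulrA ler_pM ?ler_nat //; first by rewrite divr_ge0 // ltW.
  by apply: le_trans UA _; rewrite ler_wpM2l //; lra.
apply: le_trans (_ : _ <= n%:R * (A * (4 * n%:R)) * (n%:R ^+ 3)^-1) _.
  rewrite ler_pM //; last by rewrite exprn_ge0 // subr_ge0.
  by rewrite divr_ge0 ?mulr_ge0 ?(ltW U0) ?(ltW l00).
by rewrite le_eqVlt; apply/orP; left; apply/eqP; field; rewrite gt_eqF.
Qed.

Lemma sqrt_nat_ge400 (n : nat) : (20 ^ 2 * 20 ^ 2 <= n)%N -> 400 <= Num.sqrt n%:R :> R.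
Proof.
move=> nn; rewrite -[leLHS]ger0_norm ?ler0n // -sqrtr_sqr; apply: ler_wsqrtr.
by rewrite (_ : 400 ^+ 2 = (20 ^ 2 * 20 ^ 2)%N%:R) ?ler_nat // natrM natrX; ring.
Qed.

End Amplification.

Section Maj3Upper.
Context {R : realType}.

Theorem maj3_consensus_fast : exists (D : R) (n0 : nat), forall n k : nat,
  (n0 <= n)%N -> (0 < k)%N -> (k <= n)%N -> forall c : config n k,
  1 - hit ThreeMajority (@is_consensus n k)
        (Num.truncn (Num.min (Num.sqrt n%:R) k%:R * ln n%:R ^+ 3 : R)) c <= D / n%:R.
Proof.
pose h : R := 1 / 10 ^+ 12.
have hh : is_tiny h.
  have p : 0 < 10 ^+ 12 :> R by rewrite exprn_gt0.
  by split; [rewrite divr_gt0|rewrite /h divfK ?gt_eqF].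
(* Only [is_tiny h] is kept, so that the arithmetic treats [h] as an atom. *)
move: h hh => h hh; have [h0 h12] := hh.
have h6 : h <= 1 / 10 ^+ 6 by lra.
have h1 : h <= 1 by lra.
pose q : R := h * (lam2 / 10 ^+ 2).
have lam2E : lam2 = 1 / 10 ^+ 6 :> R by [].
have q0 : 0 < q by rewrite mulr_gt0 // lam2E; lra.
have q1 : q <= 1 by rewrite /q lam2E; clear - h0 h1; lra.
have ih1 : 1 <= h ^- 2.
  by rewrite invf_ge1 ?exprn_gt0 // exprn_ile1 // ltW.
have rate0 : 0 < maj3_rate h by rewrite /maj3_rate -/q divr_gt0 //; lra.
have rate1 : maj3_rate h <= 1 by rewrite /maj3_rate -/q; lra.
pose ka := maj3_rate h / (3 * h ^- 2).
pose A := 3 * h ^- 2 * 16 / q.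
have [n1 Hn1] := ln_nat_ge (24 / ka + 1 : R).
exists (4 * A), (n1 + 20 ^ 2 * 20 ^ 2).+1 => n k nn k0 kn c.
have n0 : (0 < n)%N by apply: leq_trans nn.
have k1 : 1 <= k%:R :> R by rewrite ler1n.
have ka0 : 0 < ka by rewrite divr_gt0 // mulr_gt0 //; lra.
have ika0 : 0 <= 24 / ka by rewrite divr_ge0 // ltW.
set L : R := ln n%:R; set s := Num.sqrt n%:R.
have Lka : 24 / ka + 1 <= L by apply: Hn1; apply: leq_trans nn; rewrite -addnS leq_addr.
have L1 : 1 <= L by lra.
have s400 : 400 <= s.
  by apply: sqrt_nat_ge400; apply: leq_trans nn; rewrite -addSn leq_addl.
have s0 : 0 < s by lra.
have s2 : s ^+ 2 = n%:R by rewrite sqr_sqrtr.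
pose M := (trunc_log 2 n).+1; pose Y := Num.min s k%:R.
have M0 : 0 < M.+1%:R :> R by rewrite ltr0n.
have nM : n%:R <= 2 ^+ M :> R by rewrite -natrX ler_nat ltnW // trunc_log_ltn.
have Y1 : 1 <= Y by rewrite le_min k1 andbT; lra.
have Y0 : 0 < Y by lra.
pose U := 3 * h ^- 2 * M.+1%:R; pose l0 := q / 16; pose d := maj3_rate h / Y.
have M1 : 1 <= M.+1%:R :> R by rewrite ler1n.
have ih0 : 0 <= h ^- 2 by lra.
have ihM : h ^- 2 <= h ^- 2 * M.+1%:R by rewrite -[leLHS]mulr1 ler_wpM2l.
have l00 : 0 < l0 by rewrite divr_gt0.
have U0 : 0 < U by rewrite mulr_gt0 // mulr_gt0 //; lra.
have d0 : 0 <= d by rewrite divr_ge0 // ltW.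
have dU : d <= U.
  apply: le_trans (_ : _ <= 1) _; last by rewrite /U; lra.
  by rewrite ler_pdivrMr // mul1r; lra.
have pos1 y : 0 <= y -> 0 <= q * log_like M.+1 y by move=> y0; rewrite mulr_ge0 ?log_like_ge0 // ltW.
have pos2 (z : R) : 0 <= h ^- 2 * (\sum_(m < M.+1) expR (- (h ^+ 2 * (1 / 10 ^+ 3 / s) / 2 ^+ m * z))).
  by rewrite mulr_ge0 // sumr_ge0 // => m _; exact: expR_ge0.
have pos3 (z : R) : 0 <= h * cubic (2 / 3 * expR (- (1 / 10 ^+ 3 / s * z))).
  by rewrite mulr_ge0 ?cubic_ge0 ?mulr_ge0 ?expR_ge0 // ltW.
have mu0 : 0 <= 1 / 10 ^+ 3 / s by rewrite !divr_ge0 // ?exprn_ge0 // ltW.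
have nu0 m : 0 <= h ^+ 2 * (1 / 10 ^+ 3 / s) / 2 ^+ m.
  by rewrite divr_ge0 ?exprn_ge0 // mulr_ge0 // sqr_ge0.
have incr (z z' : R) : z' <= z ->
    h ^- 2 * (\sum_(m < M.+1) expR (- (h ^+ 2 * (1 / 10 ^+ 3 / s) / 2 ^+ m * z)))
    + h * cubic (2 / 3 * expR (- (1 / 10 ^+ 3 / s * z)))
    <= h ^- 2 * (\sum_(m < M.+1) expR (- (h ^+ 2 * (1 / 10 ^+ 3 / s) / 2 ^+ m * z')))
    + h * cubic (2 / 3 * expR (- (1 / 10 ^+ 3 / s * z'))).
  move=> zz; apply: lerD.
    rewrite ler_wpM2l // ler_sum // => m _.
    by rewrite ler_expR lerN2 ler_wpM2l.
  rewrite ler_wpM2l ?(ltW h0) // cubic_le ?mulr_ge0 ?expR_ge0 // ler_wpM2l //.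
  by rewrite ler_expR lerN2 ler_wpM2l.
apply: (le_trans (y := k%:R * U / l0 * (1 - d / U) ^+ Num.truncn (Y * L ^+ 3))).
  apply: (avoid_consensus_le n0 (f := maj3_potential h M s)) => //.
  - by move=> x y x0 y0; rewrite /maj3_potential -/q addr_ge0 ?addr_ge0 ?pos1.
  - move=> x y x0 y1; rewrite /maj3_potential -/q -addrA ler_wpDr ?addr_ge0 //.
    by rewrite /l0 ler_wpM2l ?(ltW q0) // -[leLHS]mul1r log_like_ge.
  - move=> x y y0 yx xn; rewrite /maj3_potential -/q -addrA.
    have xy : 0 <= x - y by lra.
    apply: le_trans (lerD (lexx _) (incr _ _ xy)) _.
    have T1 : q * log_like M.+1 y <= 1 * M.+1%:R.
      by rewrite ler_pM ?log_like_ge0 ?log_like_le // ltW.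
    have T2 : \sum_(m < M.+1) expR (- (h ^+ 2 * (1 / 10 ^+ 3 / s) / 2 ^+ m * 0)) <= M.+1%:R :> R.
      rewrite (eq_bigr (fun=> 1)) ?sumr_const ?card_ord // => m _.
      by rewrite mulr0 oppr0 expR0.
    have {}T2 := ler_wpM2l ih0 T2.
    have T3 : h * cubic (2 / 3 * expR (- (1 / 10 ^+ 3 / s * 0))) <= 1 * 1.
      have c0 : 0 <= cubic (2 / 3 * 1) :> R by rewrite cubic_ge0 // mulr_ge0.
      have c1 : cubic (2 / 3 * 1) <= 1 :> R by rewrite /cubic; clear; lra.
      by rewrite mulr0 oppr0 expR0 ler_pM // ltW.
    have : M.+1%:R <= h ^- 2 * M.+1%:R by rewrite -[leLHS]mul1r ler_wpM2r //; lra.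
    rewrite /U; lra.
  - move=> x x' y x0 xx y0; rewrite /maj3_potential -!addrA lerD2l incr //; lra.
  - move=> x y y' x0 y0 yy; rewrite /maj3_potential -!addrA lerD ?incr //; last by lra.
    by rewrite ler_wpM2l ?(ltW q0) // log_like_nondecreasing.
  - move=> c' i j ij imax X1; apply: le_trans (maj3_drift n0 hh s400 nM ij imax X1) _.
    rewrite lerD2l lerN2 /d ler_wpM2l ?(ltW rate0) //.
    set X := cnt c' j in X1 *; have X0 : 0 < X by lra.
    have iX0 : 0 <= X^-1 by rewrite invr_ge0 ltW.
    have b0 : 0 <= freq c' j :> R by exact: freq_ge0.
    have g0 : 0 <= gam c' :> R by exact: gam_ge0.
    (* With few opinions [gam >= 1 / k] gives the rate. With many, [1 / X + X / n] is at least
       [1 / sqrt n] whatever the size [X] of the rival. *)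
    rewrite /Y; case: (leP s k%:R) => sk; last first.
      by have := gam_ge_invk n0 c' (R := R); clear - iX0 b0; lra.
    have : s^-1 <= X^-1 + freq c' j.
      rewrite (_ : freq c' j = X / s ^+ 2); last by rewrite s2.
      have := sqr_ge0 (X - s) => sq.
      rewrite -subr_ge0 (_ : _ - _ = ((X - s) ^+ 2 + X * s) / (X * s ^+ 2)); last by field; rewrite !gt_eqF.
      by apply: divr_ge0; [apply: addr_ge0 => //|]; apply: mulr_ge0; rewrite ?sqr_ge0 ?(ltW X0) ?(ltW s0).
    by clear - g0; lra.
apply: (amplify (ka := ka) (M := M.+1%:R)) => //.
- by rewrite divr_ge0 ?(ltW q0) // !mulr_ge0.
- rewrite /U /l0 /A le_eqVlt; apply/orP; left; apply/eqP; field.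
  by rewrite !gt_eqF.
- rewrite /ka /d /U le_eqVlt; apply/orP; left; apply/eqP; field.
  by rewrite !gt_eqF.
- by lra.
- exact: trunc_log2_le.
Qed.

End Maj3Upper.

(** * 2-Choices: fast consensus *)

Section SmallOpinions.
Context {R : realType}.

Lemma bernoulli_sub (x : R) m : 0 <= x <= 1 -> 1 - m%:R * x <= (1 - x) ^+ m.
Proof.
move=> /andP[x0 x1]; elim: m => [|m IH]; first by rewrite mul0r subr0 expr0.
rewrite exprS; apply: le_trans (ler_wpM2l (_ : 0 <= 1 - x) IH); last by rewrite subr_ge0.
have := mulr_ge0 (ler0n R m) (sqr_ge0 x); rewrite -natr1; lra.
Qed.

Lemma bernoulli_add (x : R) m : 0 <= x -> 1 + m%:R * x <= (1 + x) ^+ m.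
Proof.
move=> x0; elim: m => [|m IH]; first by rewrite mul0r addr0 expr0.
rewrite exprS; apply: le_trans (ler_wpM2l (_ : 0 <= 1 + x) IH); last by rewrite addr_ge0.
have := mulr_ge0 (ler0n R m) (sqr_ge0 x); rewrite -natr1; lra.
Qed.

Lemma expr_pow_nat_le (w : R) s : 0 <= w <= 1 / 2 -> w ^+ s * s.+1%:R <= 1.
Proof.
move=> /andP[w0 w1]; elim: s => [|s IH]; first by rewrite mul1r.
rewrite exprS; have s2 : s.+2%:R <= 2 * s.+1%:R :> R by rewrite -natrM ler_nat mul2n -addnn addSnnS leq_addl.
have ws0 : 0 <= w ^+ s by exact: exprn_ge0.
apply: le_trans (_ : _ <= 1 / 2 * w ^+ s * (2 * s.+1%:R)) _; last by lra.
by rewrite ler_pM ?mulr_ge0 // ler_wpM2r.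
Qed.

(** The generating function of the count is a product over the vertices. A supporter leaves [j] with
    probability [gam - b ^+ 2], which adds at least half of that to its factor [w]; any other vertex
    joins with probability [b ^+ 2]. Bernoulli's inequality linearises both powers. *)
Lemma expect_pow_cnt (n k : nat) (n_gt0 : (0 < n)%N) (c : config n k) (j : 'I_k) (w : R) : 0 < w <= 1 / 2 ->
  w ^+ opinion_count c j * (1 + cnt c j * (gam c - freq c j ^+ 2) / (2 * w)) * (1 - cnt c j * freq c j)
  <= expect TwoChoices c (fun c' => w ^+ opinion_count c' j).
Proof.
move=> /andP[w0 w1]; set b := freq c j; set g := gam c; set m := opinion_count c j.
have b0 : 0 <= b := freq_ge0 c j; have b1 : b <= 1 := freq_le1 n_gt0 c j.
have bg : b ^+ 2 <= g := gam_ge_sq c j.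
have b21 : b ^+ 2 <= 1 by rewrite expr_le1.
have u0 : 0 <= 1 - b ^+ 2 by lra.
pose phi (v : 'I_n) (o : 'I_k) : R := if o == j then w else 1.
have countE (c' : config n k) : w ^+ opinion_count c' j = \prod_v phi v (c' v).
  rewrite /opinion_count /phi -big_mkcond /= prodr_const; congr (_ ^+ _).
  by apply: eq_card => v; rewrite !inE.
have -> : expect TwoChoices c (fun c' => w ^+ opinion_count c' j) =
    \prod_v (1 - (1 - w) * update_prob R TwoChoices c v j).
  rewrite (eq_expect _ _ countE) expect_prod; apply: eq_bigr => v _.
  have := update_prob_sum1 (R := R) TwoChoices n_gt0 c v.
  move: (update_prob R TwoChoices c v) => u; rewrite (bigD1 j) //= => S.
  rewrite (bigD1 j) //= /phi eqxx (eq_bigr u); last by move=> o /negbTE ->; rewrite mulr1.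
  by rewrite (canRL (addKr _) S); ring.
pose q := w * (1 + (g - b ^+ 2) / (2 * w)).
have q0 : 0 <= q by rewrite mulr_ge0 ?(ltW w0) // addr_ge0 // divr_ge0 ?mulr_ge0 ?(ltW w0) ?subr_ge0.
have low v : (if c v == j then q else 1 - b ^+ 2) <= 1 - (1 - w) * update_prob R TwoChoices c v j.
  rewrite update_prob_choices2 // -/b -/g; case: eqP => _.
    rewrite mul1r /q; have -> : w * (1 + (g - b ^+ 2) / (2 * w)) = w + (g - b ^+ 2) / 2.
      by field; rewrite gt_eqF.
    have : w * (g - b ^+ 2) <= 1 / 2 * (g - b ^+ 2) by rewrite ler_wpM2r // subr_ge0.
    lra.
  rewrite mul0r addr0; have := mulr_ge0 (ltW w0) (sqr_ge0 b); lra.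
apply: le_trans (_ : _ <= \prod_v (if c v == j then q else 1 - b ^+ 2)) _; last first.
  apply: ler_prod => v _; rewrite low andbT; case: ifP => _ //; lra.
have -> : \prod_v (if c v == j then q else 1 - b ^+ 2) = q ^+ m * (1 - b ^+ 2) ^+ #|[pred v | c v != j]|.
  rewrite (bigID (fun v => c v == j)) /=; congr (_ * _).
    rewrite (eq_bigr (fun=> q)) => [|v ->//]; rewrite prodr_const; congr (_ ^+ _).
    by rewrite /m /opinion_count; apply: eq_card => v; rewrite !inE.
  by rewrite (eq_bigr (fun=> 1 - b ^+ 2)) => [|v /negbTE ->//]; rewrite prodr_const.
have sz : #|[pred v | c v != j]|%:R = n%:R - m%:R :> R.
  apply/eqP; rewrite eq_sym subr_eq -natrD eqr_nat addnC.
  have := cardC [pred v | c v == j]; rewrite card_ord => nE.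
  by rewrite -[eqbLHS]nE; apply/eqP; congr (_ + _)%N; rewrite /m /opinion_count; apply: eq_card => v; rewrite !inE.
have lhs0 : 0 <= w ^+ m * (1 + cnt c j * (g - b ^+ 2) / (2 * w)).
  by rewrite mulr_ge0 ?exprn_ge0 ?(ltW w0) // addr_ge0 // divr_ge0 ?mulr_ge0 ?cnt_ge0 ?subr_ge0 ?(ltW w0).
have [X1|X1] := leP (cnt c j * b) 1; last first.
  apply: le_trans (_ : _ <= 0) _; first by rewrite mulr_ge0_le0 // subr_le0 ltW.
  by apply: mulr_ge0; exact: exprn_ge0.
have sX : 0 <= 1 - cnt c j * b by lra.
have -> : q ^+ m = w ^+ m * (1 + (g - b ^+ 2) / (2 * w)) ^+ m by exact: exprMn.
apply: ler_pM; [exact: lhs0|exact: sX| |].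
- rewrite ler_wpM2l ?exprn_ge0 ?(ltW w0) // -[cnt c j]/(m%:R) -mulrA.
  by apply: bernoulli_add; rewrite divr_ge0 ?subr_ge0 ?mulr_ge0 ?(ltW w0).
- apply: le_trans (bernoulli_sub _ _); last by rewrite sqr_ge0.
  rewrite sz -[m%:R]/(cnt c j) (cnt_freq n_gt0) -/b.
  have := mulr_ge0 (ler0n R n) (mulr_ge0 b0 (sqr_ge0 b)); lra.
Qed.

(* The strict concavity of [1 - w ^+ y] near [y = 0] turns the death rate of an opinion of
   bounded size into a gain of order [1 / n]; [w] is taken small enough for this to beat the
   upward drift, and for the upward drift of larger opinions to be negligible. *)
Lemma small_opinion_gain (m1 : nat) (eps B : R) : 0 < eps -> 0 < B ->
  exists w W : R, [/\ 0 < w <= 1 / 2, 0 < W & exists n0 : nat,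
    forall n k (c : config n k) (j : 'I_k), (n0 <= n)%N -> 1 <= cnt c j :> R ->
    expect TwoChoices c (fun c' => W * (1 - w ^+ opinion_count c' j))
      <= W * (1 - w ^+ opinion_count c j) + eps * freq c j /\
    ((opinion_count c j <= m1)%N ->
      expect TwoChoices c (fun c' => W * (1 - w ^+ opinion_count c' j))
      <= W * (1 - w ^+ opinion_count c j) - B / n%:R)].
Proof.
move=> eps0 B0; pose m := m1.+1.
have m0 : 0 < m%:R :> R by rewrite ltr0n.
have m1R : 1 <= m%:R :> R by rewrite ler1n.
(* The first bound makes the gain from deaths beat the upward drift [X * b] for counts up to [m];
   the second keeps [W * w ^+ mj * X] below [eps] for larger counts. *)
pose w : R := Num.min (1 / (16 * m%:R)) (eps / (16 * B * m%:R)).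
have w0 : 0 < w by rewrite lt_min !divr_gt0 ?mulr_gt0.
have w16 : w * (16 * m%:R) <= 1.
  by rewrite -ler_pdivlMr ?mulr_gt0 // ge_min lexx.
have weps : w * (16 * B * m%:R) <= eps.
  by rewrite -ler_pdivlMr ?mulr_gt0 // ge_min lexx orbT.
have w2 : w <= 1 / 2.
  have : w * 16 <= w * (16 * m%:R) by rewrite ler_wpM2l ?(ltW w0) // ler_peMr.
  lra.
have w12 : 0 < w <= 1 / 2 by rewrite w0.
have w0' := ltW w0.
(* [w ^+ m1] bounds [w ^+ mj] from below for all counts concerned, so this normalisation yields a
   gain of at least [B / n]. *)
pose W := 16 * B / w ^+ m1.
have W0 : 0 < W by rewrite divr_gt0 ?exprn_gt0 // mulr_gt0.
(* For such [n] a count up to [m] has [b ^+ 2 <= 1 / (2 * n)], so [gam - b ^+ 2] keeps at least half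
   of [1 / n]. *)
exists w, W; split=> //; exists (2 * m ^ 2)%N => n k c j nn X1.
have n0 : (0 < n)%N by apply: leq_trans nn; rewrite muln_gt0 expn_gt0.
have n0R : 0 < n%:R :> R by rewrite ltr0n.
set X : R := cnt c j in X1 *; set mj := opinion_count c j.
have XE : X = mj%:R by [].
set b : R := freq c j; pose g : R := gam c.
have bE : b = X / n%:R by [].
have b0 : 0 <= b := freq_ge0 c j.
have bg : b ^+ 2 <= g := gam_ge_sq c j.
have gn : n%:R^-1 <= g := gam_ge_invn n0 c.
have X0 : 0 <= X by apply: le_trans X1.
have := expect_pow_cnt n0 c j w12; rewrite -/X -/b -/g -/mj.
have wj0 : 0 <= w ^+ mj by rewrite exprn_ge0.
rewrite expectZ expectB expect_cst //; set E := expect _ _ _ => lowE.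
have p0 : 0 <= X * (g - b ^+ 2) / (2 * w).
  by rewrite divr_ge0 ?mulr_ge0 ?subr_ge0.
set q := X * _ / _ in p0 lowE; have E0 : 0 <= E.
  by apply: expect_ge0 => c'; rewrite exprn_ge0.
have small : (mj <= m1)%N -> W * (1 - E) <= W * (1 - w ^+ mj) - B / n%:R.
  move=> jm.
  have Xm : X <= m%:R by rewrite XE ler_nat ltnW.
  have nm : 2 * m%:R ^+ 2 <= n%:R :> R by rewrite -natrX -natrM ler_nat.
  have b2 : b ^+ 2 <= n%:R^-1 / 2.
    rewrite bE expr_div_n ler_pdivrMr ?exprn_gt0 //.
    rewrite (_ : n%:R^-1 / 2 * n%:R ^+ 2 = n%:R / 2); last by field; rewrite gt_eqF.
    have : X ^+ 2 <= m%:R ^+ 2 by rewrite lerXn2r ?nnegrE // ltW.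
    lra.
  have qlow : X / (4 * w * n%:R) <= q.
    rewrite /q (_ : X / (4 * w * n%:R) = X * (n%:R^-1 / 2) / (2 * w)); last by field; rewrite !gt_eqF.
    by rewrite ler_wpM2r ?invr_ge0 ?mulr_ge0 // ler_wpM2l //; lra.
  have Xb : X * b <= X * (m%:R / n%:R).
    by rewrite ler_wpM2l // bE ler_wpM2r // invr_ge0 ltW.
  set Y := X / n%:R in bE.
  have Y0 : 0 <= Y by [].
  have qY : Y / (4 * w) <= q.
    by apply: le_trans qlow; rewrite /Y le_eqVlt; apply/orP; left; apply/eqP; field; rewrite !gt_eqF.
  have XbY : X * b <= Y * m%:R.
    by apply: le_trans Xb _; rewrite /Y le_eqVlt; apply/orP; left; apply/eqP; field; rewrite gt_eqF.
  have mw : m%:R <= (16 * w)^-1.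
    by rewrite -[leRHS]mul1r ler_pdivlMr ?mulr_gt0 //; lra.
  have XbY2 : X * b <= Y / (16 * w).
    by apply: le_trans XbY _; rewrite ler_wpM2l.
  have Xbh : X * b <= 1 / 2.
    apply: le_trans Xb _; rewrite mulrA ler_pdivrMr //.
    have : X * m%:R <= m%:R * m%:R by rewrite ler_wpM2r // ltW.
    lra.
  have Z1 : Y / (4 * w) = 4 * (Y / (16 * w)) by field; rewrite gt_eqF.
  have Z0 : 0 <= Y / (16 * w) by rewrite divr_ge0 // mulr_ge0.
  have fac : 1 + Y / (16 * w) <= (1 + q) * (1 - X * b).
    have A1 : 0 <= Y / (16 * w) * (1 / 2 - X * b) by rewrite mulr_ge0 // subr_ge0.
    have A2 : 0 <= (q - 4 * (Y / (16 * w))) * (1 - X * b) by rewrite mulr_ge0 //; lra.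
    lra.
  have gain : w ^+ mj + B / n%:R / W <= E.
    apply: le_trans lowE; rewrite -[leRHS]mulrA; apply: le_trans (ler_wpM2l wj0 fac).
    rewrite mulrDr mulr1 lerD2l /W.
    rewrite (_ : B / n%:R / (16 * B / w ^+ m1) = w ^+ m1 * (n%:R^-1 / 16)); last by field; rewrite !gt_eqF ?exprn_gt0.
    rewrite ler_pM ?exprn_ge0 ?divr_ge0 ?invr_ge0 ?ler0n //.
      rewrite -(subnKC jm) exprD ler_piMr // exprn_ile1 //; lra.
    rewrite /Y (_ : X / n%:R / (16 * w) = X / w * (n%:R^-1 / 16)); last by field; rewrite !gt_eqF.
    rewrite ler_peMl ?divr_ge0 ?invr_ge0 ?ler0n // ler_pdivlMr // mul1r; lra.
  have := ler_wpM2l (ltW W0) gain; rewrite mulrDr.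
  have -> : W * (B / n%:R / W) = B / n%:R by rewrite mulrC divfK ?gt_eqF.
  by clear; lra.
split=> //; have [jm|jm] := leqP mj m1.
  apply: le_trans (small jm) _; rewrite lerD2l.
  have t1 : 0 <= B / n%:R by rewrite divr_ge0 // ltW.
  have t2 : 0 <= eps * b by rewrite mulr_ge0 // ltW.
  by clear - t1 t2; lra.
have lowE2 : w ^+ mj - w ^+ mj * X * b <= E.
  have [Xb1|Xb1] := leP (X * b) 1; last first.
    by apply: le_trans E0; rewrite -mulrA subr_le0 ler_peMr // ltW.
  apply: le_trans lowE; rewrite -[leRHS]mulrA -mulrA -{1}[w ^+ mj]mulr1 -mulrBr ler_wpM2l //.
  by rewrite ler_peMl ?subr_ge0 // lerDl.
have WX : W * (w ^+ mj * X) <= eps.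
  have jE : mj = (m1 + (mj - m).+1)%N by rewrite -addSnnS subnKC.
  set s := (mj - m)%N in jE.
  have Xs : X <= m%:R * s.+1%:R.
    by rewrite XE -natrM ler_nat jE /m mulSn mulnS addnC leq_add2l leq_addr.
  have -> : W * (w ^+ mj * X) = 16 * B * (w * (w ^+ s * X)).
    by rewrite /W jE exprD exprS; field; rewrite expf_neq0 // gt_eqF.
  have ws : w ^+ s * X <= m%:R.
    apply: le_trans (_ : _ <= w ^+ s * (m%:R * s.+1%:R)) _.
      by rewrite ler_wpM2l // exprn_ge0.
    rewrite mulrCA ler_piMr ?(ltW m0) // expr_pow_nat_le //.
    by rewrite w0'.
  apply: le_trans weps; rewrite [leRHS](_ : _ = 16 * B * (w * m%:R)); last by ring.
  rewrite ler_wpM2l ?mulr_ge0 ?(ltW B0) //.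
  by rewrite ler_wpM2l.
have : W * (w ^+ mj * X) * b <= eps * b by rewrite ler_wpM2r.
have : W * (w ^+ mj - w ^+ mj * X * b) <= W * E by rewrite ler_wpM2l // ltW.
clear; lra.
Qed.

End SmallOpinions.

Section DampedSteps.
Context {R : realType}.

(** The derivative [3 * (1 - v) ^+ 2] is at least 1/3 up to [v = 2 / 3]. *)
Lemma cubic_diff_ge (V W : R) : 0 <= V -> V <= W -> W <= 2 / 3 ->
  cubic V <= cubic W - (W - V) / 3.
Proof.
move=> V0 VW W2; rewrite !cubicE -subr_ge0.
rewrite (_ : _ - _ = (W - V) * ((1 - V - 1 / 3) * (1 - V + 1 / 3) + (1 - V - 1 / 3) * (1 - W)
   + (1 - W - 1 / 3) * (1 - W + 1 / 3) + 1 / 3 * (1 - W - 1 / 3))); last by field.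
by rewrite mulr_ge0 ?subr_ge0 // !addr_ge0 // mulr_ge0 //; lra.
Qed.

Lemma expR_quarter_le : expR (1 / 4) <= 4 / 3 :> R.
Proof. by apply: le_trans (expR_le_slope (q := 4 / 3) _ _ _) _; lra. Qed.

Lemma expR2_le : expR 2 <= 10 :> R.
Proof.
have -> : (2 : R) = 8%:R * (1 / 4) by field.
rewrite expRM_natl; apply: le_trans (lerXn2r 8 _ _ expR_quarter_le) _; rewrite ?nnegrE ?expR_ge0 //.
by lra.
Qed.

Lemma expRB1_le (t : R) : expR t - 1 <= t * expR t.
Proof.
have := ler_wpM2r (expR_ge0 t) (expR_ge1Dx (- t)); rewrite -expRD addNr expR0; lra.
Qed.

Lemma expR_deficit_ge (y : R) : 0 <= y <= 1 -> y / 2 <= 1 - expR (- y).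
Proof.
move=> /andP[y0 y1]; have := ler_wpM2l (expR_ge0 (- y)) (expR_ge1Dx y).
rewrite -expRD addNr expR0; have e0 := expR_ge0 (- y).
have [ye|ye] := leP (expR (- y)) (1 / 2); first lra.
have := mulr_ge0 y0 (_ : 0 <= expR (- y) - 1 / 2); lra.
Qed.

(** [q] measures the squared scale against the leader's count: [K * q <= 1] means essentially
    undamped, large [K * q] almost switched off. In order: the unconditional noise cost, suppressed
    by damping; the gain from the growth of the gap; and, near a tie, monotonicity and then strict
    gain from the concave window. *)
Lemma damped_step (n k : nat) (n_gt0 : (0 < n)%N) (c : config n k) (i j : 'I_k) (K rho : R) :
  i != j -> (forall o, freq c o <= freq c i :> R) ->
  0 < rho -> 10 ^+ 6 <= K -> K * rho <= 1 / 10 ^+ 3 ->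
  let E := expect TwoChoices c (fun c' => damped K rho (cnt c' i) (cnt c' j)) in
  let F := damped K rho (cnt c i) (cnt c j) in
  let z := rho * (cnt c i - cnt c j) in let q := rho ^+ 2 * cnt c i in
  let cost := 134 * (freq c i * q * expR (- z) * expR (- (K * q / 2))) in
  [/\ E <= F + cost,
      z <= 1 / 100 -> K * q <= 1 ->
        E <= F + cost - z * (freq c i + freq c j - gam c) / 100,
      freq c i <= 2 * freq c j :> R -> z <= 1 / 10 -> K * q <= 100 -> E <= F &
      freq c i <= 2 * freq c j :> R -> z <= 1 / 10 -> K * q <= 1 ->
        E <= F - q * freq c i / 300].
Proof.
move=> ij imax rho0 K6 Krho E F z q cost.
have K100 : 100 <= K by apply: le_trans K6; clear; lra.
have K0 : 0 < K by apply: lt_le_trans K100.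
have [b0 ba ab1 ga gab] := leader_facts n_gt0 ij imax.
have d0 := leader_delta_ge0 n_gt0 j imax.
have /andP[br r1] := leader_drift_bounds n_gt0 ij imax.
have rho3 : rho <= 1 / 10 ^+ 3.
  by apply: le_trans Krho; rewrite ler_peMl ?(ltW rho0) //; apply: le_trans K100; rewrite ler1n.
have := expect_damped TwoChoices n_gt0 ij imax rho0 rho3 (ltW K0) Krho.
have Vup := pair_var_choices2_le n_gt0 ij imax.
have Vlow := pair_var_choices2_ge n_gt0 ij imax.
have Vh0 := pair_var_ge0 TwoChoices n_gt0 c (1 : R) 1 ij.
have xE : cnt c i = n%:R * freq c i :> R := cnt_freq n_gt0 c i.
rewrite -/E /=.
set Vh := pair_var _ _ _ _ _ _ in Vup Vlow Vh0 *.
set a := freq c i in ba ab1 ga gab Vup Vlow xE br r1 *.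
set b := freq c j in b0 ba ab1 gab Vlow br r1 *.
set r := a + b - gam c in br r1 *.
set S := rho ^+ 2 * Vh; set P := expR (- (_ * mean_cnt c i)).
set V := 2 / 3 * expR _ => -[gain crude].
have a0 : 0 <= a by apply: le_trans ba.
have r0 : 0 <= r by apply: le_trans br.
have x0 : 0 <= cnt c i :> R by exact: cnt_ge0.
have q0 : 0 <= q by rewrite mulr_ge0 ?sqr_ge0.
have z0 : 0 <= z by rewrite mulr_ge0 // ltW.
have S0 : 0 <= S by rewrite mulr_ge0 ?sqr_ge0.
have Sq : S <= 10 * (q * a).
  rewrite (_ : 10 * (q * a) = rho ^+ 2 * (n%:R * (10 * a ^+ 2))); last by rewrite /q xE; ring.
  by rewrite ler_wpM2l ?sqr_ge0.
have g0 := gam_ge0 c (R := R).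
have mE : mean_cnt c i = cnt c i + cnt c i * (a - gam c) by rewrite /mean_cnt -/a; ring.
have m1 : cnt c i <= mean_cnt c i :> R by rewrite mE lerDl mulr_ge0 // subr_ge0.
have m2 : mean_cnt c i <= 2 * cnt c i :> R.
  have : cnt c i * (a - gam c) <= cnt c i * 1 by rewrite ler_wpM2l //; clear - ab1 b0 g0; lra.
  by rewrite mE; clear; lra.
have Kr0 : 0 <= K * rho ^+ 2 by rewrite mulr_ge0 ?sqr_ge0 // ltW.
pose P0 := expR (- (K * rho ^+ 2 * cnt c i)).
have P00 : 0 <= P0 by exact: expR_ge0.
have PP0 : P <= P0 by rewrite ler_expR lerN2 ler_wpM2l.
have Pge0 : 0 <= P by exact: expR_ge0.
have Kq0 : 0 <= K * q by rewrite mulr_ge0 // ltW.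
have Plow : K * q <= 1 -> 1 / 10 <= P.
  move=> Kq1; have : (expR 2)^-1 <= P.
    rewrite -expRN ler_expR lerN2; apply: le_trans (ler_wpM2l Kr0 m2) _.
    by move: Kq1; rewrite /q; clear; lra.
  apply: le_trans; rewrite div1r lef_pV2 ?posrE ?expR_gt0 //; exact: expR2_le.
pose V0 := 2 / 3 * expR (- z).
have FE : F = P0 * cubic V0 by [].
have zr : rho * ((cnt c i - cnt c j) * (1 + r)) = z + z * r by rewrite /z; ring.
have Vge0 : 0 <= V by rewrite mulr_ge0 ?expR_ge0.
have VE : V = V0 * expR (- (z * r)).
  by rewrite /V /V0 zr -[RHS]mulrA -expRD; congr (_ * expR _); ring.
have ez0 := expR_ge0 (- z).
have zr0 : 0 <= z * r by rewrite mulr_ge0.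
have VV0 : V <= V0.
  by rewrite VE ler_piMr ?mulr_ge0 // expR_le1 oppr_le0.
have V00 : 0 <= V0 by rewrite mulr_ge0.
have V023 : V0 <= 2 / 3 by rewrite /V0 ler_piMr // expR_le1 oppr_le0.
have cV0 : 0 <= cubic V0 by exact: cubic_ge0.
have PF : P * cubic V0 <= F by rewrite FE ler_wpM2r.
have cV : cubic V <= cubic V0 by apply: cubic_le.
have costP : P * (4 * V * (expR (5 * S) - 1)) <= cost.
  have e1 : expR (5 * S) - 1 <= 50 * (q * a) * expR (50 * q).
    have Sq5 : 5 * S <= 50 * (q * a) by clear - Sq; lra.
    have S50 : 0 <= 5 * S by exact: mulr_ge0.
    apply: le_trans (expRB1_le _) _; apply: ler_pM; rewrite ?expR_ge0 //.
    rewrite ler_expR; have : q * a <= q * 1 by rewrite ler_wpM2l //; clear - ab1 b0; lra.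
    by clear - Sq; lra.
  have e1' : 0 <= expR (5 * S) - 1.
    by rewrite subr_ge0; apply: le_trans (expR_ge1Dx _); clear - S0; lra.
  (* Half of the damping exponent absorbs the noise factor, as [K >= 100]. *)
  have P1 : P * expR (50 * q) <= expR (- (K * q / 2)).
    apply: le_trans (ler_wpM2r (expR_ge0 _) PP0) _.
    rewrite -expRD ler_expR /q; have := ler_wpM2r q0 K100; rewrite /q.
    by clear; lra.
  apply: le_trans (_ : _ <= P * (4 * V0 * (50 * (q * a) * expR (50 * q)))) _.
    have VV4 : 4 * V <= 4 * V0 by rewrite ler_wpM2l.
    have V4 : 0 <= 4 * V by exact: mulr_ge0.
    by apply: ler_wpM2l => //; apply: ler_pM.
  rewrite (_ : _ * (_ * _) = 4 * V0 * (50 * (q * a)) * (P * expR (50 * q))); last by ring.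
  have c0 : 0 <= 4 * V0 * (50 * (q * a)).
    by apply: mulr_ge0; apply: mulr_ge0 => //; exact: mulr_ge0.
  apply: le_trans (ler_wpM2l c0 P1) _.
  rewrite /V0 /cost -/a; have := mulr_ge0 (mulr_ge0 (mulr_ge0 q0 a0) ez0) (expR_ge0 (- (K * q / 2))).
  by clear; lra.
split.
- apply: le_trans crude _; rewrite mulrDr; apply: lerD => //.
  by apply: le_trans PF; rewrite ler_wpM2l.
- move=> z1 Kq1; apply: le_trans crude _; rewrite mulrDr addrAC; apply: lerD => //.
  have def : z * r / 2 <= 1 - expR (- (z * r)).
    apply: expR_deficit_ge; rewrite zr0 /=.
    have : z * r <= z * 1 by rewrite ler_wpM2l.
    by clear - z1; lra.
  have V0low : 66 / 100 <= V0.
    by rewrite /V0; have := expR_ge1Dx (- z); clear - z1; lra.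
  have dV : 66 / 100 * (z * r / 2) <= V0 - V.
    rewrite VE -{1}[V0]mulr1 -mulrBr; apply: ler_pM => //; clear - zr0; lra.
  have := cubic_diff_ge Vge0 VV0 V023 => cd.
  have := ler_wpM2l Pge0 cd; rewrite mulrBr => cd2.
  have : 1 / 10 * ((V0 - V) / 3) <= P * ((V0 - V) / 3).
    rewrite ler_wpM2r ?Plow // divr_ge0 // subr_ge0 //.
  by move: zr0; clear - PF cd2 dV; lra.
- move=> ab z1 Kq; apply: le_trans (gain _ _) _.
  + have : expR (- (z + z * r)) >= 1 - (z + z * r) by exact: expR_ge1Dx.
    have : z * r <= z * 1 by rewrite ler_wpM2l.
    by rewrite /V zr; clear - z1; lra.
  (* With [S <= 10 * (q * a)], the size of [K] brings [S] below the 1/1000 required by the concave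
     window even for [K * q] up to 100. *)
  + have : K * q * a <= 100 * 1 by apply: ler_pM => //; clear - ab1 b0; lra.
    have : 10 ^+ 6 * (q * a) <= K * (q * a) by rewrite ler_wpM2r // mulr_ge0.
    by move: Sq; clear; lra.
  + apply: le_trans PF; rewrite ler_wpM2l //; move: cV; clear - S0; lra.
- move=> ab z1 Kq; apply: le_trans (gain _ _) _.
  + have : expR (- (z + z * r)) >= 1 - (z + z * r) by exact: expR_ge1Dx.
    have : z * r <= z * 1 by rewrite ler_wpM2l.
    by rewrite /V zr; clear - z1; lra.
  + have : K * q * a <= 1 * 1 by apply: ler_pM => //; clear - ab1 b0; lra.
    have : 10 ^+ 6 * (q * a) <= K * (q * a) by rewrite ler_wpM2r // mulr_ge0.
    by move: Sq; clear; lra.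
  + have Slow : q * a / 3 <= S.
      rewrite (_ : q * a / 3 = rho ^+ 2 * (n%:R * (a ^+ 2 / 3))); last by rewrite /q xE; ring.
      by rewrite ler_wpM2l ?sqr_ge0 // Vlow.
    have : P * (S / 10) >= 1 / 10 * (q * a / 30).
      have s30 : q * a / 30 <= S / 10 by clear - Slow; lra.
      have qa0 : 0 <= q * a / 30 by rewrite divr_ge0 // mulr_ge0.
      by apply: ler_pM => //; exact: Plow.
    have := ler_wpM2l Pge0 cV; rewrite mulrBr.
    by clear - PF; lra.
Qed.

End DampedSteps.

Section DyadicNoise.
Context {R : realType}.

Lemma xexpN_le1 (y : R) : y * expR (- y) <= 1.
Proof.
rewrite expRN ler_pdivrMr ?expR_gt0 // mul1r; have := expR_ge1Dx y; lra.
Qed.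

Lemma sum_sqr_expN_le M (z : R) : 0 <= z ->
  \sum_(m < M) (z / 2 ^+ m) ^+ 2 * expR (- (z / 2 ^+ m)) <= 12.
Proof.
move=> z0; apply: le_trans (_ : _ <= 4 * \sum_(m < M) (z / 2) / 2 ^+ m * expR (- ((z / 2) / 2 ^+ m))) _.
  rewrite mulr_sumr; apply: ler_sum => m _; set y := z / 2 / 2 ^+ m.
  have -> : z / 2 ^+ m = 2 * y by rewrite /y; field; rewrite expf_neq0.
  have y0 : 0 <= y by rewrite !divr_ge0 // exprn_ge0.
  have -> : - (2 * y) = - y + - y by ring.
  rewrite expRD; have := ler_wpM2l (mulr_ge0 y0 (expR_ge0 (- y))) (xexpN_le1 y); lra.
have : 0 <= z / 2 by rewrite divr_ge0.
by move/(sum_zexpN_le M); lra.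
Qed.

Lemma sum_sqr_le M (z : R) : 0 <= z -> \sum_(m < M) (z / 2 ^+ m) ^+ 2 <= 2 * z ^+ 2.
Proof.
move=> z0; apply: (dyadic_sum_le (g := fun x => x ^+ 2) (H := fun x => 2 * x ^+ 2)) => // x x0.
  by have := sqr_ge0 x; lra.
by rewrite mulr_ge0 ?sqr_ge0.
Qed.

(** For [z >= 7] one has [z ^+ 2 >= 2 * z + 35], because [(z - 7) * (z + 5) >= 0]. It serves for the
    strongly damped scales, where [K * q / 2 = z ^+ 2] exceeds 50. *)
Lemma sqr_expN_sqr_le (z : R) : 7 <= z -> z ^+ 2 * expR (- z ^+ 2) <= expR (- 35) * (z * expR (- z)).
Proof.
move=> z7; have z0 : 0 <= z by lra.
have e1 : expR (- z ^+ 2) <= expR (- z) * (expR (- z) * expR (- 35)).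
  by rewrite -!expRD ler_expR; have := mulr_ge0 (_ : 0 <= z - 7) (_ : 0 <= z - 7); nra.
apply: le_trans (ler_wpM2l (sqr_ge0 z) e1) _.
have A : 0 <= expR (- 35) * (z * expR (- z)) by rewrite !mulr_ge0 ?expR_ge0.
have := ler_wpM2l A (xexpN_le1 z); lra.
Qed.

Lemma expRN35_le : expR (- 35) <= 1 / 10 ^+ 9 :> R.
Proof.
have e1 : 2 <= expR 1 :> R by have := expR_ge1Dx (1 : R); lra.
have : 2 ^+ 35 <= expR 35 :> R.
  rewrite -[35 in leRHS]mulr1 expRM_natl; apply: lerXn2r => //; rewrite nnegrE ?expR_ge0 //.
move=> e35; rewrite expRN div1r lef_pV2 ?posrE ?expR_gt0 ?mulr_gt0 ?exprn_gt0 //.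
apply: le_trans e35; rewrite (_ : 2 ^+ 35 = (2 ^+ 7) ^+ 3 * (2 ^+ 7) ^+ 2 :> R); last by rewrite -!exprM -exprD.
lra.
Qed.

End DyadicNoise.

Section Choices2Scales.
Context {R : realType}.

(* The three regimes: [j] far behind the leader, [j] within a factor two of the leader
   but the gap already exceeds the noise level, and gap below the noise level. *)
Lemma damped_sum_step (n k : nat) (n_gt0 : (0 < n)%N) M (c : config n k) (i j : 'I_k) (K rho : R) :
  i != j -> (forall o, freq c o <= freq c i :> R) -> 1 <= cnt c j :> R ->
  n%:R <= 2 ^+ M :> R ->
  0 < rho -> rho <= 1 / 10 ^+ 5 -> 10 ^+ 13 <= K -> K * rho <= 1 / 10 ^+ 3 ->
  let d := cnt c i - cnt c j in
  let E := expect TwoChoices c (fun c' => \sum_(m < M.+1) damped K (rho / 2 ^+ m) (cnt c' i) (cnt c' j)) in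
  let F := \sum_(m < M.+1) damped K (rho / 2 ^+ m) (cnt c i) (cnt c j) in
  [/\ 2 * freq c j < freq c i :> R -> E <= F + (40 * 40 * 5) / n%:R - rho * freq c j / 100,
      freq c i <= 2 * freq c j :> R -> K * cnt c i <= 10 ^+ 4 * d ^+ 2 ->
        E <= F - rho * freq c j / (20 * 20) &
      freq c i <= 2 * freq c j :> R -> 10 ^+ 4 * d ^+ 2 <= K * cnt c i ->
        E <= F - rho ^+ 2 * freq c i / (20 * 30)].
Proof.
move=> ij imax X1 nM rho0 rho5 K13 Krho; move=> d E F; set x := cnt c i in d F *.
have K6 : 10 ^+ 6 <= K by apply: le_trans K13; clear; lra.
have K0 : 0 < K by apply: lt_le_trans K6; rewrite exprn_gt0.
have [b0 ba ab1 ga gab] := leader_facts n_gt0 ij imax.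
have d0 : 0 <= d := leader_delta_ge0 n_gt0 j imax.
have /andP[br r1] := leader_drift_bounds n_gt0 ij imax.
have n0 : 0 < n%:R :> R by rewrite ltr0n.
have xE : x = n%:R * freq c i := cnt_freq n_gt0 c i.
have XE : cnt c j = n%:R * freq c j :> R := cnt_freq n_gt0 c j.
have xX : x = d + cnt c j by rewrite /d; ring.
have x1 : 1 <= x by rewrite xX; lra.
have xn : x <= n%:R by rewrite xE ler_piMr ?(ltW n0) // freq_le1.
have x0 : 0 < x by lra.
have p2 (m : nat) : 0 < 2 ^+ m :> R by rewrite exprn_gt0.
pose rh (m : nat) := rho / 2 ^+ m.
have rh0 m : 0 < rh m by rewrite divr_gt0.
have rhle m : rh m <= rho.
  by rewrite ler_pdivrMr // ler_peMr ?(ltW rho0) // exprn_ege1 // ler1n.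
have Krh m : K * rh m <= 1 / 10 ^+ 3.
  by apply: le_trans Krho; rewrite ler_wpM2l // ltW.
have step (m : nat) := damped_step n_gt0 ij imax (rh0 m) K6 (Krh m).
rewrite -/x -/d /= in step.
set a := freq c i in ba ab1 ga gab xE br r1 step *.
set b := freq c j in b0 ba ab1 gab XE br r1 step *.
set r := a + b - gam c in br r1 step.
pose q m := rh m ^+ 2 * x; pose z m := rh m * d.
pose cost m := 134 * (a * q m * expR (- z m) * expR (- (K * q m / 2))).
pose f m := damped K (rh m) x (cnt c j).
pose e m := expect TwoChoices c (fun c' => damped K (rh m) (cnt c' i) (cnt c' j)).
have a0 : 0 <= a by apply: le_trans ba.
have q0 m : 0 < q m by rewrite mulr_gt0 // exprn_gt0.
have z0 m : 0 <= z m by rewrite mulr_ge0 // ltW.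
have EE : E = \sum_(m < M.+1) e m by exact: expect_sum.
have FE : F = \sum_(m < M.+1) f m by [].
have cost0 m : 0 <= cost m by rewrite !mulr_ge0 ?expR_ge0 // ltW.
have cost_le1 m : cost m <= 134 * a * (q m * expR (- z m)).
  rewrite /cost [leRHS](_ : _ = 134 * (a * q m * expR (- z m)) * 1); last by ring.
  rewrite mulrA; apply: ler_wpM2l; first by rewrite !mulr_ge0 ?expR_ge0 // ltW.
  by rewrite expR_le1 oppr_le0 divr_ge0 // mulr_ge0 ?(ltW K0) ?(ltW (q0 m)).
have costs_gap : 0 < d -> \sum_(m < M.+1) cost m <= 134 * 12 * (a * x / d ^+ 2).
  move=> d1; have := sum_sqr_expN_le M.+1 (_ : 0 <= rho * d) => /(_ (mulr_ge0 (ltW rho0) d0)) S.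
  apply: le_trans (_ : _ <= 134 * a * (x / d ^+ 2) * 12) _; last by clear; lra.
  have A0 : 0 <= 134 * a * (x / d ^+ 2) by rewrite !mulr_ge0 ?invr_ge0 ?sqr_ge0 // ltW.
  apply: le_trans (ler_wpM2l A0 S); rewrite mulr_sumr; apply: ler_sum => m _.
  apply: le_trans (cost_le1 m) _; rewrite /q /z /rh le_eqVlt; apply/orP; left; apply/eqP.
  have -> : rho * d / 2 ^+ m = rho / 2 ^+ m * d by rewrite mulrAC.
  by field; rewrite !gt_eqF.
have costs_small : \sum_(m < M.+1) cost m <= 134 * 2 * (a * x * rho ^+ 2).
  apply: le_trans (_ : _ <= 134 * a * x * (2 * rho ^+ 2)) _; last by clear; lra.
  have A0 : 0 <= 134 * a * x by rewrite !mulr_ge0 // ltW.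
  apply: le_trans (ler_wpM2l A0 (sum_sqr_le M.+1 (ltW rho0))); rewrite mulr_sumr; apply: ler_sum => m _.
  apply: le_trans (cost_le1 m) _; rewrite [leRHS](_ : _ = 134 * a * (q m * 1)); last by rewrite /q /rh; ring.
  rewrite ler_wpM2l ?mulr_ge0 // ler_wpM2l ?(ltW (q0 m)) //.
  by rewrite expR_le1 oppr_le0.
have sumD (m0 : 'I_M.+1) (u : nat -> R) :
    \sum_(m < M.+1) u m = u m0 + \sum_(m < M.+1 | m != m0) u m by rewrite (bigD1 m0).
(* One scale supplies its drift; the others are only charged their noise cost. *)
have use_drift (m0 : 'I_M.+1) : z m0 <= 1 / 100 -> K * q m0 <= 1 ->
    E <= F + \sum_(m < M.+1) cost m - z m0 * r / 100.
  move=> zm qm; rewrite EE FE (sumD m0 e) (sumD m0 f) (sumD m0 cost).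
  have [_ A _ _] := step m0; have {}A := A zm qm.
  have B : \sum_(m < M.+1 | m != m0) e m <= \sum_(m < M.+1 | m != m0) f m + \sum_(m < M.+1 | m != m0) cost m.
    by rewrite -big_split; apply: ler_sum => m _; have [] := step m.
  move: A B; rewrite -/(e m0) -/(f m0) -/(cost m0) -/(z m0) -/(q m0); clear; lra.
have pick_z : 0 < d -> exists m0 : 'I_M.+1, z m0 <= 1 / 100 /\ (1 / 200 <= z m0 \/ z m0 = rho * d).
  move=> d1; have [||m0 [A B]] := @dyadic_pick R M (100 * (rho * d)).
  - by rewrite !mulr_gt0.
  - have : rho * d <= 1 / 10 ^+ 5 * d by rewrite ler_wpM2r.
    by move: nM xn xX X1; clear - d0; lra.
  have zE : 100 * z m0 = 100 * (rho * d) / 2 ^+ m0 by rewrite /z /rh; field; rewrite gt_eqF.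
  exists m0; split; first by move: A; rewrite -zE; clear; lra.
  case: B => B; [left|right]; move: B; rewrite -zE; clear; lra.
split.
- move=> ab.
  have xX2 : 2 * cnt c j < x.
    by rewrite xE XE mulrCA ltr_pM2l.
  have dx : x <= 2 * d by rewrite /d; clear - xX2; lra.
  have d1 : 1 <= d by clear - dx xX2 X1; lra.
  have dp : 0 < d by apply: lt_le_trans d1.
  have [m0 [zm zz]] := pick_z dp.
  have zrho : rho <= z m0.
    case: zz => [zz|->]; first by clear - zz rho5; lra.
    by rewrite ler_peMr // ltW.
  have qm : K * q m0 <= 1.
    have qz : q m0 <= rh m0 * (2 * z m0).
      rewrite /q /z expr2 -mulrA ler_wpM2l ?(ltW (rh0 _)) //.
      by rewrite mulrCA ler_wpM2l // ltW.
    have : K * q m0 <= K * rh m0 * (2 * z m0) by rewrite -mulrA ler_wpM2l // ltW.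
    have : K * rh m0 * (2 * z m0) <= 1 / 10 ^+ 3 * (2 * z m0).
      by rewrite ler_wpM2r ?Krh // mulr_ge0.
    by clear - zm; lra.
  apply: le_trans (use_drift m0 zm qm) _; apply: lerB.
    rewrite lerD2l; apply: le_trans (costs_gap dp) _.
    (* The gap is comparable to the leader here, so the noise costs order [1 / n] whatever the
       counts. This is paid later: by the small-opinion term for a rival of bounded size, and
       otherwise by the drift [rho * b / 100]. *)
    have axd : a * x / d ^+ 2 <= 4 / n%:R.
      have -> : a = x / n%:R by rewrite xE mulrC mulKf // gt_eqF.
      rewrite ler_pdivrMr ?exprn_gt0 // -subr_ge0.
      rewrite (_ : _ - _ = (2 * d - x) * (2 * d + x) / n%:R); last by field; rewrite gt_eqF.
      by rewrite divr_ge0 // mulr_ge0 ?subr_ge0 // addr_ge0 ?mulr_ge0 // ltW.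
    move: axd; rewrite (_ : 40 * 40 * 5 / n%:R = 40 * 10 * 5 * (4 / n%:R)); last by field; rewrite gt_eqF.
    have := invr_ge0 (n%:R : R); rewrite ler0n; clear; lra.
  have : rho * b <= z m0 * r by apply: ler_pM => //; exact: ltW.
  by clear; lra.
- move=> ab Kx.
  have d1 : 1 <= d.
    have Kd : 10 ^+ 13 <= 10 ^+ 4 * d ^+ 2.
      apply: le_trans Kx; rewrite -[leLHS]mulr1; apply: ler_pM => //.
    have : ~~ (d < 1).
      apply/negP => d1; have : d * d <= 1 * 1 by apply: ler_pM => //; exact: ltW.
      by move: Kd; clear; lra.
    by rewrite -leNgt.
  have dp : 0 < d by apply: lt_le_trans d1.
  have [m0 [zm zz]] := pick_z dp.
  have xd : x / d ^+ 2 <= 10 ^+ 4 / K.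
    rewrite ler_pdivrMr ?exprn_gt0 // mulrAC ler_pdivlMr //.
    by rewrite mulrC.
  have qm : K * q m0 <= 1.
    have -> : q m0 = z m0 ^+ 2 * (x / d ^+ 2) by rewrite /q /z; field; rewrite gt_eqF.
    have : z m0 ^+ 2 * (x / d ^+ 2) <= (1 / 100) ^+ 2 * (10 ^+ 4 / K).
      apply: ler_pM; rewrite ?sqr_ge0 ?divr_ge0 ?sqr_ge0 ?(ltW x0) //.
      by rewrite lerXn2r ?nnegrE.
    move/(ler_wpM2l (ltW K0)) => H; apply: le_trans H _.
    rewrite le_eqVlt; apply/orP; left; apply/eqP.
    by field; rewrite gt_eqF.
  apply: le_trans (use_drift m0 zm qm) _; rewrite -addrA lerD2l.
  have zb : z m0 * b <= z m0 * r by rewrite ler_wpM2l.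
  case: (leP (1 / 100) (rho * d)) => rd.
    have zl : 1 / 200 <= z m0 by case: zz => // ->; clear - rd; lra.
    have c1 := costs_gap dp.
    have c2 : a * x / d ^+ 2 <= 2 * b * (1 / 10 ^+ 9).
      rewrite -mulrA; apply: ler_pM; rewrite ?divr_ge0 ?sqr_ge0 ?(ltW x0) //.
      apply: le_trans xd _; rewrite ler_pdivrMr //.
      by move: K13; clear; lra.
    have c3 : 1 / 200 * b <= z m0 * b by rewrite ler_wpM2r.
    have c4 : rho * b <= 1 / 10 ^+ 5 * b by rewrite ler_wpM2r.
    by move: c1 c2 c3 c4 zb; clear - b0; lra.
  have zl : rho * d / 2 <= z m0.
    case: zz => [zz|->]; first by clear - rd zz; lra.
    by have := mulr_ge0 (ltW rho0) d0; clear; lra.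
  have c1 := costs_small.
  have c2 : a * x * rho ^+ 2 <= 2 * b * (rho * d * (1 / 10 ^+ 11 )).
    rewrite -mulrA; apply: ler_pM => //; first by rewrite mulr_ge0 ?sqr_ge0 // ltW.
    have -> : x * rho ^+ 2 = x / d ^+ 2 * ((rho * d) * (rho * d)) by field; rewrite gt_eqF.
    have rd0 : 0 <= rho * d by rewrite mulr_ge0 // ltW.
    have u1 : rho * d * (rho * d) <= 1 / 100 * (rho * d) by rewrite ler_wpM2r // ltW.
    have u2 : x / d ^+ 2 <= 1 / 10 ^+ 9.
      apply: le_trans xd _; rewrite ler_pdivrMr //.
      by move: K13; clear; lra.
    apply: le_trans (_ : _ <= 1 / 10 ^+ 9 * (1 / 100 * (rho * d))) _; last by clear; lra.
    by apply: ler_pM; rewrite ?divr_ge0 ?sqr_ge0 ?mulr_ge0 ?(ltW x0) ?(ltW rho0).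
  have c3 : rho * d / 2 * b <= z m0 * b by rewrite ler_wpM2r.
  have c4 : rho * b <= rho * d * b by rewrite ler_wpM2r // ler_peMr // ltW.
  by move: c1 c2 c3 c4 zb; have := mulr_ge0 (ltW rho0) b0; clear; lra.
- move=> ab Kx.
  have z_of_q m : K * q m <= 100 -> z m <= 1 / 10.
    move=> Kq; rewrite -(ler_pXn2r (n := 2)) ?nnegrE //.
    have : rh m ^+ 2 * (10 ^+ 4 * d ^+ 2) <= rh m ^+ 2 * (K * x) by rewrite ler_wpM2l ?sqr_ge0.
    by move: Kq; rewrite /q /z; clear; lra.
  (* The tie-breaking scale is the one with [K * q] of order 1. In terms of [t m], the damping left
     in the cost is [expR (- t m ^+ 2)], so scales with large [t m] are nearly free. *)
  pose s := Num.sqrt (K * x / 2).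
  have Kx0 : 0 <= K * x / 2 by rewrite !mulr_ge0 // ltW.
  have s2 : s ^+ 2 = K * x / 2 by rewrite sqr_sqrtr.
  have s0 : 0 < s by rewrite sqrtr_gt0 !mulr_gt0.
  pose t (m : nat) := rho * s / 2 ^+ m.
  have t0 m : 0 < t m by rewrite divr_gt0 // mulr_gt0.
  have tq m : t m ^+ 2 = K * q m / 2.
    rewrite [LHS](_ : _ = rh m ^+ 2 * s ^+ 2); last by rewrite /t /rh; field; rewrite gt_eqF.
    by rewrite s2 /q; ring.
  (* Scales with [K * q <= 100] do not increase at all. If scale 0, which has the largest [q], is of
     this kind, there is no error; otherwise the errors carry the factor [expR (- 35)] and are
     summable over the scales. *)
  pose big : R := (100 < K * q 0)%R%:R.
  have big0 : 0 <= big by exact: ler0n.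
  have crude (m : nat) : e m <= f m + big * (134 * a * (2 / K) * expR (- 35)) * (t m * expR (- t m)).
    have [A _ B _] := step m.
    have tm0 : 0 <= t m * expR (- t m) by rewrite mulr_ge0 ?expR_ge0 // ltW.
    have c0 : 0 <= 134 * a * (2 / K) * expR (- 35) by rewrite !mulr_ge0 ?expR_ge0 ?invr_ge0 // ltW.
    have [Kq|Kq] := leP (K * q m) 100.
      apply: le_trans (B ab (z_of_q m Kq) Kq) _.
      by rewrite lerDl mulr_ge0 // mulr_ge0.
    have q0m : q m <= q 0%N.
      rewrite /q ler_wpM2r ?(ltW x0) // lerXn2r ?nnegrE ?(ltW (rh0 _)) //.
      by rewrite {2}/rh expr0 divr1.
    have -> : big = 1.
      by rewrite /big (lt_le_trans Kq) // ler_wpM2l // ltW.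
    apply: le_trans A _; rewrite lerD2l mul1r.
    have t7 : 7 <= t m.
      rewrite -(ler_pXn2r (n := 2)) ?nnegrE ?(ltW (t0 m)) // tq.
      by move: Kq; clear; lra.
    have := sqr_expN_sqr_le t7; rewrite tq => tt.
    have qq : q m * expR (- (K * q m / 2)) <= 2 / K * (expR (- 35) * (t m * expR (- t m))).
      have iK : 0 <= 2 / K by rewrite divr_ge0 // ltW.
      apply: le_trans (ler_wpM2l iK tt); rewrite le_eqVlt; apply/orP; left; apply/eqP.
      by field; rewrite gt_eqF.
    have A0 : 0 <= 134 * a by rewrite mulr_ge0.
    apply: le_trans (_ : _ <= 134 * a * (q m * expR (- (K * q m / 2)))) _.
      rewrite [leLHS](_ : _ = 134 * a * (q m * expR (- (K * q m / 2))) * expR (- z m)); last by rewrite /q /z; ring.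
      have A1 : 0 <= 134 * a * (q m * expR (- (K * q m / 2))).
        by rewrite mulr_ge0 // mulr_ge0 ?expR_ge0 // ltW.
      by rewrite ler_piMr // expR_le1 oppr_le0.
    apply: le_trans (ler_wpM2l A0 qq) _; rewrite le_eqVlt; apply/orP; left; apply/eqP; ring.
  have [||m0 [A B]] := @dyadic_pick R M (2 * (rho * s)).
  - by rewrite !mulr_gt0.
  - apply: le_trans nM; rewrite -(ler_pXn2r (n := 2)) ?nnegrE ?(ltW n0) //; last by rewrite !mulr_ge0 // ltW.
    rewrite !exprMn s2 [leLHS](_ : _ = 2 * (K * rho * (rho * x))); last by field.
    have n1 : 1 <= n%:R :> R by rewrite ler1n.
    have rx : rho * x <= 1 * n%:R by apply: ler_pM; rewrite ?(ltW rho0) ?(ltW x0) //; clear - rho5; lra.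
    have rx0 : 0 <= rho * x by rewrite mulr_ge0 // ltW.
    have : K * rho * (rho * x) <= 1 / 10 ^+ 3 * (rho * x) by rewrite ler_wpM2r.
    have : n%:R * 1 <= n%:R * n%:R :> R by rewrite ler_wpM2l // ltW.
    by move: rx rx0; clear; rewrite expr2; lra.
  have tE : 2 * (rho * s) / 2 ^+ m0 = 2 * t m0 by rewrite /t; ring.
  rewrite tE in A B.
  have tt : t m0 * t m0 = K * q m0 / 2 by rewrite -expr2 tq.
  have Kq1 : K * q m0 <= 1 / 2.
    have : t m0 * t m0 <= 1 / 2 * (1 / 2).
      by apply: ler_pM; rewrite ?(ltW (t0 m0)) //; clear - A; lra.
    by rewrite tt; clear; lra.
  have qlow : 1 / 8 <= K * q m0 \/ q m0 = q 0%N.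
    case: B => B; [left|right].
      have : 1 / 4 * (1 / 4) <= t m0 * t m0 by apply: ler_pM => //; clear - B; lra.
      by rewrite tt; clear; lra.
    have : t m0 ^+ 2 = t 0%N ^+ 2.
      by congr (_ ^+ 2); rewrite /t expr0 divr1; move: B; rewrite /t; clear; lra.
    rewrite !tq => H; have : K * q m0 = K * q 0%N by move: H; clear; lra.
    by apply: mulfI; rewrite gt_eqF.
  have [_ _ _ G] := step m0.
  have {}G : e m0 <= f m0 - q m0 * a / 300.
    by apply: G => //; [apply: z_of_q|]; apply: le_trans Kq1 _; clear; lra.
  set w := 134 * a * (2 / K) * expR (- 35) in crude.
  have w0 : 0 <= big * w by rewrite !mulr_ge0 ?expR_ge0 ?invr_ge0 // ltW.
  have sum_t : \sum_(m < M.+1 | m != m0) t m * expR (- t m) <= 3.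
    apply: le_trans (sum_zexpN_le M.+1 (_ : 0 <= rho * s)); last by rewrite mulr_ge0 // ltW.
    rewrite [leRHS](sumD m0 (fun m => t m * expR (- t m))) lerDr mulr_ge0 ?expR_ge0 // ltW //; exact: t0.
  have rest : \sum_(m < M.+1 | m != m0) e m <= \sum_(m < M.+1 | m != m0) f m + big * w * 3.
    apply: le_trans (_ : _ <= \sum_(m < M.+1 | m != m0) (f m + big * w * (t m * expR (- t m)))) _.
      by apply: ler_sum => m _; exact: crude.
    by rewrite big_split /= lerD2l -mulr_sumr ler_wpM2l.
  (* If [big] is 1, the picked scale has [K * q >= 1 / 8], so its gain is at least of order [a / K];
     the errors are smaller thanks to [expR (- 35)]. *)
  have noise : big * w * 3 <= q m0 * a / 600.
    have [Kq0|Kq0] := leP (K * q 0%N) 100.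
      have -> : big = 0 by rewrite /big ltNge Kq0.
      have qa0 : 0 <= q m0 * a by rewrite mulr_ge0 // ltW.
      by rewrite mul0r mul0r; move: qa0; clear; lra.
    have q8 : 1 / 8 <= K * q m0.
      by case: qlow => // q00; move: Kq0 Kq1; rewrite q00; clear; lra.
    have big1 : big <= 1 by rewrite /big lern1 leq_b1.
    have aK0 : 0 <= a / K by rewrite divr_ge0 // ltW.
    have wK : w <= a / K * (1 / 10 ^+ 6).
      rewrite /w (_ : 134 * a * (2 / K) = 134 * 2 * (a / K)); last by ring.
      rewrite -mulrA mulrCA ler_wpM2l //; have := expRN35_le (R := R); clear; lra.
    have aq : 1 / 8 * (a / K) <= q m0 * a.
      apply: le_trans (ler_wpM2r aK0 q8) _; rewrite le_eqVlt; apply/orP; left; apply/eqP.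
      by field; rewrite gt_eqF.
    have w00 : 0 <= w by rewrite !mulr_ge0 ?expR_ge0 ?invr_ge0 // ltW.
    have : big * w <= 1 * w by rewrite ler_wpM2r.
    by move: wK aq aK0; clear; lra.
  have rq : rho ^+ 2 <= q m0.
    case: qlow => [q8|->]; last first.
      by rewrite /q /rh expr0 divr1 ler_peMr ?sqr_ge0.
    rewrite -(ler_pM2l K0); apply: le_trans q8.
    rewrite (_ : K * rho ^+ 2 = K * rho * rho); last by ring.
    have : K * rho * rho <= 1 / 10 ^+ 3 * rho by rewrite ler_wpM2r // ltW.
    by move: rho5; clear; lra.
  have := ler_wpM2r a0 rq.
  rewrite EE FE (sumD m0 e) (sumD m0 f); move: G rest noise; clear; lra.
Qed.


End Choices2Scales.

Section Choices2Upper.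
Context {R : realType}.

(** [expR (ln w * y)] is [w] to the power [y], written for real [y] because the general drift
    argument takes functions of two reals. *)
Definition choices2_potential Q M K rho w W (x y : R) : R :=
  Q * log_like M.+1 y
  + (\sum_(m < M.+1) damped K (rho / 2 ^+ m) x y
     + W * (1 - expR (ln w * y))).

Lemma damped_ge0 (K rho x y : R) : 0 <= damped K rho x y.
Proof. by rewrite mulr_ge0 ?expR_ge0 // cubic_ge0 // mulr_ge0 ?expR_ge0. Qed.

Lemma damped_le1 (K rho x y : R) : 0 <= K -> 0 <= rho -> 0 <= y -> y <= x -> damped K rho x y <= 1.
Proof.
move=> K0 r0 y0 yx; have x0 : 0 <= x by apply: le_trans yx.
have e1 : expR (- (K * rho ^+ 2 * x)) <= 1.
  by rewrite expR_le1 oppr_le0 !mulr_ge0 ?sqr_ge0.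
have e2 : expR (- (rho * (x - y))) <= 1.
  by rewrite expR_le1 oppr_le0 mulr_ge0 // subr_ge0.
have v0 : 0 <= 2 / 3 * expR (- (rho * (x - y))) by rewrite mulr_ge0 ?expR_ge0.
have c1 : cubic (2 / 3 * expR (- (rho * (x - y)))) <= 1.
  apply: le_trans (cubic_le (w := 1) v0 _) _; first by move: e2; clear; lra.
  by rewrite /cubic; clear; lra.
rewrite -[1]mulr1; apply: ler_pM; rewrite ?expR_ge0 ?cubic_ge0 //.
Qed.

Lemma damped_mono (K rho x x' y y' : R) : 0 <= K -> 0 <= rho -> x <= x' -> y' <= y ->
  damped K rho x' y' <= damped K rho x y.
Proof.
move=> K0 r0 xx yy.
apply: ler_pM; rewrite ?expR_ge0 ?cubic_ge0 ?mulr_ge0 ?expR_ge0 //.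
  by rewrite ler_expR lerN2 ler_wpM2l // mulr_ge0 ?sqr_ge0.
apply: cubic_le; rewrite ?mulr_ge0 ?expR_ge0 // ler_wpM2l // ler_expR lerN2 ler_wpM2l //.
by move: xx yy; clear; lra.
Qed.

Theorem choices2_consensus_fast : exists (D : R) (n0 : nat), forall n k : nat,
  (n0 <= n)%N -> (0 < k)%N -> (k <= n)%N -> forall c : config n k,
  1 - hit TwoChoices (@is_consensus n k) (Num.truncn (k%:R * ln n%:R ^+ 3 : R)) c <= D / n%:R.
Proof.
pose K : R := 10 ^+ 13; pose rho : R := 1 / 10 ^+ 3 / K.
have K0 : 0 < K by rewrite exprn_gt0.
have rho0 : 0 < rho by rewrite !divr_gt0 ?exprn_gt0.
have Krho : K * rho <= 1 / 10 ^+ 3 by rewrite /rho mulrC divfK ?gt_eqF.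
have rho5 : rho <= 1 / 10 ^+ 5.
  by rewrite /rho ler_pdivrMr // /K; clear; lra.
have K13 : 10 ^+ 13 <= K by [].
move: K rho K0 rho0 Krho rho5 K13 => K rho K0 rho0 Krho rho5 K13.
pose Q := rho ^+ 2 / 10 ^+ 4.
have Q0 : 0 < Q by rewrite divr_gt0 ?exprn_gt0.
have Qrho : Q <= rho / 10 ^+ 9.
  rewrite /Q expr2 -mulrA; have := ler_wpM2l (ltW rho0) rho5; clear; lra.
(* Beyond this count the cost [8000 / n] of a far rival is at most [Q * b]; up to it, the
   small-opinion term with [B = 8000] cancels the cost. *)
pose m1 := (Num.truncn (40 * 40 * 5 / Q)).+1.
have m1Q : 40 * 40 * 5 <= Q * m1%:R.
  have q0 : 0 <= 40 * 40 * 5 / Q by rewrite divr_ge0 // ltW.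
  have /truncn_itv/andP[_ /ltW] := q0; rewrite -/m1 ler_pdivrMr //.
  by rewrite [leRHS]mulrC.
have B0 : 0 < 40 * 40 * 5 :> R by clear; lra.
have [w [W [/andP[w0 w1] W0 [n2 small]]]] := small_opinion_gain m1 Q0 B0.
have lw : ln w <= 0 by apply: ln_le0; move: w1; clear; lra.
pose l0 := Q / 16; pose ka := Q / 32 / (2 + W); pose A := (2 + W) * 16 / Q.
have W2 : 0 < 2 + W by rewrite addr_gt0.
have Q1 : Q <= 1 by move: Qrho rho5; clear; lra.
have l00 : 0 < l0 by rewrite divr_gt0.
have ka0 : 0 < ka by apply: divr_gt0 => //; exact: divr_gt0.
have [n1 Hn1] := ln_nat_ge (24 / ka + 1 : R).
exists (4 * A), (n1 + n2).+1 => n k nn k0 kn c.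
have n0 : (0 < n)%N by apply: leq_trans nn.
have k1 : 1 <= k%:R :> R by rewrite ler1n.
have ika0 : 0 <= 24 / ka by rewrite divr_ge0 // ltW.
set L : R := ln n%:R.
have Lka : 24 / ka + 1 <= L.
  by apply: Hn1; apply: leq_trans nn; rewrite -addnS leq_addr.
have L1 : 1 <= L by move: Lka ika0; clear; lra.
have nn2 : (n2 <= n)%N by apply: leq_trans nn; rewrite -addSn leq_addl.
pose M := (trunc_log 2 n).+1.
have M0 : 0 < M.+1%:R :> R by rewrite ltr0n.
have M1 : 1 <= M.+1%:R :> R by rewrite ler1n.
have nM : n%:R <= 2 ^+ M :> R by rewrite -natrX ler_nat ltnW // trunc_log_ltn.
pose U := (2 + W) * M.+1%:R; pose d := Q / 32 / k%:R.
have U0 : 0 < U by rewrite mulr_gt0.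
have d0 : 0 <= d by apply: divr_ge0; rewrite ?ler0n // divr_ge0 // ltW.
have dU : d <= U.
  apply: le_trans (_ : _ <= 1) _.
    by rewrite ler_pdivrMr ?ltr0n // mul1r; move: Q1 k1; clear; lra.
  rewrite /U; have : (2 + W) * 1 <= (2 + W) * M.+1%:R by rewrite ler_wpM2l // ltW.
  by move: W0; clear; lra.
have rm0 m : 0 <= rho / 2 ^+ m by rewrite divr_ge0 ?exprn_ge0 // ltW.
have sum0 (x y : R) : 0 <= \sum_(m < M.+1) damped K (rho / 2 ^+ m) x y.
  by apply: sumr_ge0 => m _; exact: damped_ge0.
have W1e (y : R) : 0 <= y -> 0 <= W * (1 - expR (ln w * y)) <= W.
  move=> y0; apply/andP; split.
    by rewrite mulr_ge0 ?(ltW W0) // subr_ge0 expR_le1 mulr_le0_ge0.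
  by rewrite ler_piMr ?(ltW W0) // lerBlDr lerDl expR_ge0.
apply: (le_trans (y := k%:R * U / l0 * (1 - d / U) ^+ Num.truncn (k%:R * L ^+ 3))).
  apply: (avoid_consensus_le n0 (f := choices2_potential Q M K rho w W)) => //.
  - move=> x y x0 y0; have /andP[W1 _] := W1e y y0.
    by rewrite /choices2_potential !addr_ge0 // mulr_ge0 ?(ltW Q0) ?log_like_ge0.
  - move=> x y x0 y1; have y0 : 0 <= y by apply: le_trans y1.
    have /andP[W1 _] := W1e y y0.
    rewrite /choices2_potential ler_wpDr ?addr_ge0 //.
    by rewrite /l0 ler_wpM2l ?(ltW Q0) // -[leLHS]mul1r log_like_ge.
  - move=> x y y0 yx xn; have /andP[_ W1] := W1e y y0.
    have T1 : Q * log_like M.+1 y <= 1 * M.+1%:R.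
      by rewrite ler_pM ?log_like_ge0 ?log_like_le // ltW.
    have T2 : \sum_(m < M.+1) damped K (rho / 2 ^+ m) x y <= M.+1%:R.
      apply: le_trans (_ : _ <= \sum_(m < M.+1) 1) _; last by rewrite sumr_const card_ord.
      by apply: ler_sum => m _; apply: damped_le1; rewrite // ltW.
    have : W * 1 <= W * M.+1%:R by rewrite ler_wpM2l // ltW.
    by rewrite /choices2_potential /U; move: T1 T2 W1; clear; lra.
  - move=> x x' y x0 xx y0; rewrite /choices2_potential lerD2l lerD2r.
    by apply: ler_sum => m _; apply: damped_mono; rewrite // ltW.
  - move=> x y y' x0 y0 yy; apply: lerD; last apply: lerD.
    + by rewrite ler_wpM2l ?(ltW Q0) // log_like_nondecreasing.
    + by apply: ler_sum => m _; apply: damped_mono; rewrite // ltW.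
    + rewrite ler_wpM2l ?(ltW W0) // lerD2l lerN2 ler_expR.
      by rewrite ler_wnM2l.
  - move=> c' i j ij imax X1.
    have [b0 ba ab1 ga gab] := leader_facts n0 ij imax.
    have n0R : 0 < n%:R :> R by rewrite ltr0n.
    have g0 := gam_ge0 c' (R := R).
    have gk := gam_ge_invk n0 c' (R := R).
    have XE := cnt_freq n0 c' j (R := R).
    have XM : cnt c' j <= 2 ^+ M :> R.
      by apply: le_trans nM; rewrite XE ler_piMr ?(ltW n0R) // freq_le1.
    have T1 := expect_log_like_le TwoChoices n0 ij X1 XM.
    have [TA TB TC] := damped_sum_step n0 ij imax X1 nM rho0 rho5 K13 Krho.
    have [T3 T4] := small n k c' j nn2 X1.
    have powE (c'' : config n k) : expR (ln w * cnt c'' j) = w ^+ opinion_count c'' j.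
      by rewrite expRM_natr lnK // posrE.
    have split_pot (c'' : config n k) : choices2_potential Q M K rho w W (cnt c'' i) (cnt c'' j) =
      Q * log_like M.+1 (cnt c'' j) + (\sum_(m < M.+1) damped K (rho / 2 ^+ m) (cnt c'' i) (cnt c'' j)
        + W * (1 - w ^+ opinion_count c'' j)) by rewrite /choices2_potential powE.
    rewrite (eq_expect _ _ split_pot) !expectD expectZ split_pot.
    set a := freq c' i in ba ab1 ga gab TA TB TC.
    set b := freq c' j in b0 ba ab1 gab XE T1 T3 T4 TA TB TC.
    set E1 := expect _ _ _ in T1 *; set E2 := expect _ _ _ in TA TB TC *.
    set E3 := expect _ _ _ in T3 T4 *.
    have {}T1 := ler_wpM2l (ltW Q0) T1.
    have Qb0 : 0 <= Q * b by rewrite mulr_ge0 // ltW.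
    have Qrb : Q * b <= rho * b / 10 ^+ 9 by have := ler_wpM2r b0 Qrho; clear; lra.
    have dg : d <= Q * gam c' / 32.
      by rewrite /d; have := ler_wpM2l (ltW Q0) gk; clear; lra.
    have rb0 : 0 <= rho * b by rewrite mulr_ge0 // ltW.
    case: (leP a (2 * b)) => ab.
      case: (leP (K * cnt c' i) (10 ^+ 4 * (cnt c' i - cnt c' j) ^+ 2)) => gap.
        by move: (TB ab gap) T1 T3 dg Qb0 Qrb rb0; clear; lra.
      have Qa : Q * b <= rho ^+ 2 * a / 10 ^+ 4.
        by have := ler_wpM2l (ltW Q0) ba; rewrite /Q; clear; lra.
      by move: (TC ab (ltW gap)) T1 T3 dg Qb0 Qa; clear; lra.
    have {}TA := TA ab.
    case: (leqP (opinion_count c' j) m1) => jm.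
      by move: (T4 jm) TA T1 dg Qb0 Qrb rb0; clear; lra.
    have nb : 40 * 40 * 5 / n%:R <= Q * b.
      have bE : b = cnt c' j / n%:R by rewrite XE mulrC mulKf ?gt_eqF.
      rewrite bE mulrA ler_pM2r ?invr_gt0 //; apply: le_trans m1Q _.
      by rewrite ler_wpM2l ?(ltW Q0) // ler_nat ltnW.
    by move: nb T3 TA T1 dg Qb0 Qrb rb0; clear; lra.
apply: (amplify (ka := ka) (M := M.+1%:R)) => //.
- by rewrite !mulr_ge0 ?invr_ge0 // ltW.
- rewrite /U /l0 /A le_eqVlt; apply/orP; left; apply/eqP; field.
  by rewrite !gt_eqF.
- rewrite /ka /d /U le_eqVlt; apply/orP; left; apply/eqP; field.
  by rewrite !gt_eqF // ltr0n.
- by move: Lka; clear; lra.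
- exact: trunc_log2_le.
Qed.

End Choices2Upper.

(** * Slow consensus *)

Section SlowGrowth.
Context {R : realType}.

Lemma exists_other (k : nat) (j : 'I_k) : (2 <= k)%N -> exists i, i != j.
Proof.
move=> k2; have [->|j0] := eqVneq j (Ordinal (ltnW k2)); first by exists (Ordinal k2).
by exists (Ordinal (ltnW k2)); rewrite eq_sym.
Qed.

(** Superharmonicity is needed only below 1, since a probability never exceeds 1. The index of [H]
    counts the rounds left, so the potential may weaken with time. *)
Lemma hit_le_potential (p : protocol) (n k : nat) (n_gt0 : (0 < n)%N) (P : pred (config n k))
    (H : nat -> config n k -> R) (N : nat) :
  (forall M c, 0 <= H M c) -> (forall M c, P c -> 1 <= H M c) ->
  (forall M c, (M < N)%N -> H M.+1 c < 1 -> expect p c (H M) <= H M.+1 c) ->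
  forall c, hit p P N c <= H N c.
Proof.
move=> H0 H1; elim: N => [|N IH] Hstep c /=; case: ifP => Pc; rewrite ?H1 ?H0 //.
have [H1c|H1c] := ltP (H N.+1 c) 1.
  apply: le_trans (Hstep _ _ (ltnSn N) H1c); apply: ler_expect => c'.
  by apply: IH => M c'' MN; apply: Hstep; apply: ltnW.
apply: le_trans H1c; rewrite -[leRHS](expect_cst (R := R) p n_gt0 c).
by apply: ler_expect => c'; exact: hit_le1.
Qed.

(** Only an inequality: for integer [x], [hit] also counts a consensus first reached at time [x],
    which the event on the right permits. *)
Lemma tau_ge_hit (p : protocol) (n k : nat) (n_gt0 : (0 < n)%N) (c : config n k) (x : R) :
  1 - hit p (@is_consensus n k) (Num.truncn x) c <= prob_tau_ge R p c x.
Proof.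
rewrite -probTraj_exists // lerBlDr /prob_tau_ge.
set T := Num.truncn x.
rewrite [leLHS](_ : _ = probTraj R p c (fun w : traj n k T => [exists t, xpredT (w t)])); last first.
  by rewrite (probTraj_exists p xpredT T c n_gt0); case: T.
rewrite /probTraj (bigID (fun w : traj n k T =>
  [forall t : 'I_T.+1, ((nat_of_ord t)%:R < x) ==> ~~ is_consensus (w t)])) /=.
have w0 (w : traj n k T) : 0 <= traj_weight R p w by apply: prodr_ge0 => t _; exact: trans_ge0.
apply: lerD; rewrite big_mkcond [leRHS]big_mkcond /=; apply: ler_sum => w _.
  set e := [exists _, _]; set f := [forall _, _].
  by case: (w ord0 == c) => //=; case: e; case: f => //=.
set e := [exists _, _]; case: (w ord0 == c) => //=; rewrite andbC.
case: ifP => [/andP[]|_]; last by case: ifP.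
rewrite negb_forall => /existsP[t]; rewrite negb_imply negbK => /andP[_ ct] _.
by rewrite ifT //; apply/existsP; exists t.
Qed.

(** [phi] controls the variance per unit of count: it will be 1 for 3-Majority and the frequency
    bound for 2-Choices. Dropping [gam >= 0] leaves growth by [1 + F], to which the noise adds
    [2 * phi * be]. *)
Lemma expect_expR_cnt (p : protocol) (n k : nat) (n_gt0 : (0 < n)%N) (c : config n k) (j i : 'I_k) (be F phi : R) :
  i != j -> 0 <= be <= 1 / 6 -> freq c j <= F -> 0 <= phi ->
  pair_var p c i j 0 be <= 2 * phi * be ^+ 2 * cnt c j ->
  expect p c (fun c' => expR (be * cnt c' j)) <= expR (be * (1 + F + 2 * phi * be) * cnt c j).
Proof.
move=> ij be_bd bF phi0 V; have /andP[be0 be6] := be_bd.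
have z6 : 0 <= (0 : R) <= be by rewrite lexx.
have be_bd' : 0 <= be <= be by rewrite be0 lexx.
have /andP[_] := laplace_bounds p n_gt0 c ij z6 be_bd' be6.
have -> : expect p c (fun c' => expR (be * cnt c' j - 0 * cnt c' i)) = expect p c (fun c' => expR (be * cnt c' j)).
  by apply: eq_expect => c'; rewrite mul0r subr0.
move=> up; apply: le_trans up _; rewrite ler_expR.
have X0 := cnt_ge0 c j (R := R); have g0 := gam_ge0 c (R := R).
have V0 := pair_var_ge0 p n_gt0 c 0 be ij.
set W := pair_var _ _ _ _ _ _ in V V0 *.
have W1 : W / 2 * (1 + 2 * be) <= W.
  have := ler_wpM2l V0 be6.
  by move: V0; clear; lra.
have m1 : be * mean_cnt c j <= be * (cnt c j * (1 + F)).
  rewrite ler_wpM2l // /mean_cnt ler_wpM2l //; move: bF g0; clear; lra.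
by move: W1 m1 V; clear; lra.
Qed.

Lemma single_var_le_maj3 (n k : nat) (n_gt0 : (0 < n)%N) (c : config n k) (i j : 'I_k) (be : R) :
  pair_var ThreeMajority c i j 0 be <= 2 * 1 * be ^+ 2 * cnt c j.
Proof.
have b0 := freq_ge0 c j (R := R); have b1 := freq_le1 n_gt0 c j (R := R).
have g0 := gam_ge0 c (R := R); have g1 := gam_ge_sq c j (R := R).
rewrite /pair_var (eq_bigr (fun=> be ^+ 2 * (freq c j * (1 + freq c j - gam c)) -
   (be * (freq c j * (1 + freq c j - gam c))) ^+ 2)); last first.
  by move=> v _; rewrite !update_prob_maj3 // expr0n /= !mul0r add0r sub0r sqrrN.
rewrite sumr_const card_ord -[leLHS]mulr_natl.
set u := freq c j * _.
have u2 : u <= 2 * freq c j.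
  have : freq c j * (1 + freq c j - gam c) <= freq c j * 2 :> R by rewrite ler_wpM2l //; move: b1 g0; clear; lra.
  by rewrite -/u; clear; lra.
rewrite (cnt_freq n_gt0 c j) [leRHS](_ : _ = n%:R * (be ^+ 2 * (2 * freq c j))); last by ring.
rewrite ler_wpM2l // lerBlDr; apply: ler_wpDr; first exact: sqr_ge0.
by rewrite ler_wpM2l ?sqr_ge0.
Qed.

Lemma single_var_le_choices2 (n k : nat) (n_gt0 : (0 < n)%N) (c : config n k) (i j : 'I_k) (be F : R) :
  (forall o, freq c o <= F) ->
  pair_var TwoChoices c i j 0 be <= 2 * F * be ^+ 2 * cnt c j.
Proof.
move=> bF; have b0 := freq_ge0 c j (R := R); have b1 := freq_le1 n_gt0 c j (R := R).
have gF := gam_le_freq n_gt0 bF; have g0 := gam_ge0 c (R := R); have gb := gam_ge_sq c j (R := R).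
have g1 := gam_le1 n_gt0 c (R := R).
set b := freq c j in b0 b1 gb *; set g := gam c in gF g0 gb g1.
apply: le_trans (_ : _ <= \sum_v be ^+ 2 * (b ^+ 2 + ((c v == j)%:R * g))) _.
  apply: ler_sum => v _; rewrite !update_prob_choices2 // -/b -/g.
  set u := b ^+ 2 + (c v == j)%:R * (1 - g).
  rewrite expr0n /= !mul0r add0r sub0r sqrrN exprMn -mulrBr ler_wpM2l ?sqr_ge0 // /u.
  have B0 := sqr_ge0 b; case: (c v == j); rewrite ?mul1r ?mul0r ?addr0.
    have : 0 <= (b ^+ 2 + (1 - g)) * (g - b ^+ 2) by rewrite mulr_ge0 ?subr_ge0 // addr_ge0 // subr_ge0.
    have : 0 <= (g - b ^+ 2) * (g - b ^+ 2) by rewrite -expr2 sqr_ge0.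
    by move: gb g1 g0 B0; clear; nra.
  by rewrite lerBlDr lerDl sqr_ge0.
have sg : \sum_v (c v == j)%:R * g = cnt c j * g by rewrite cntE mulr_suml.
rewrite -mulr_sumr big_split /= sg sumr_const card_ord.
rewrite -[b ^+ 2 *+ n]mulr_natl [leRHS](_ : _ = be ^+ 2 * (F * cnt c j + F * cnt c j)); last by ring.
rewrite ler_wpM2l ?sqr_ge0 //; apply: lerD.
  rewrite expr2 mulrA -(cnt_freq n_gt0) mulrC ler_wpM2r ?cnt_ge0 //; exact: bF.
by rewrite mulrC ler_wpM2r ?cnt_ge0.
Qed.

(** While the sum is below 1 every count is at most [B / lam], so the potential itself supplies the
    frequency bound. Growth is then at most [1 + beta] per round, which the shrinking exponent
    absorbs. At consensus the winner's term is at least 1 because [lam * n >= B]. *)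
Lemma consensus_slow (p : protocol) (n k : nat) (n_gt0 : (0 < n)%N) (lam beta B phi : R) (N : nat) (c : config n k) :
  (2 <= k)%N -> 0 < lam -> 0 <= beta -> 0 <= phi -> 0 <= B -> B <= lam * n%:R ->
  lam * (1 + beta) ^+ N <= 1 / 6 ->
  B / (lam * n%:R) + 2 * phi * (lam * (1 + beta) ^+ N) <= beta ->
  (forall (c' : config n k) i j (be : R), (forall o, freq c' o <= B / (lam * n%:R)) ->
     pair_var p c' i j 0 be <= 2 * phi * be ^+ 2 * cnt c' j) ->
  hit p (@is_consensus n k) N c <= \sum_i expR (lam * (1 + beta) ^+ N * cnt c i - B).
Proof.
move=> k2 lam0 beta0 phi0 B0 Bn lam6 rate Vle.
have n0 : 0 < n%:R :> R by rewrite ltr0n.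
pose H M (c' : config n k) := \sum_i expR (lam * (1 + beta) ^+ M * cnt c' i - B).
have b1 : 1 <= 1 + beta by rewrite lerDl.
have pow1 M : 1 <= (1 + beta) ^+ M by rewrite exprn_ege1.
have term_le M (c' : config n k) i : expR (lam * (1 + beta) ^+ M * cnt c' i - B) <= H M c'.
  by rewrite /H (bigD1 i) //= lerDl sumr_ge0 // => o _; exact: expR_ge0.
apply: (hit_le_potential n_gt0 (H := H)) => // {c}.
- by move=> M c; apply: sumr_ge0 => o _; exact: expR_ge0.
- move=> M c /existsP[i /forallP ci]; apply: le_trans (term_le M c i).
  rewrite -[leLHS]expR0 ler_expR subr_ge0; apply: le_trans Bn _.
  have -> : cnt c i = n%:R :> R.
    rewrite /cnt /opinion_count -[in RHS](card_ord n); congr (_%:R).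
    by apply: eq_card => v; rewrite !inE ci.
  by rewrite ler_wpM2r ?(ltW n0) // ler_peMr // ltW.
- move=> M c MN H1; rewrite /H expect_sum; apply: ler_sum => j _.
  have freqF o : freq c o <= B / (lam * n%:R).
    have := le_lt_trans (term_le M.+1 c o) H1; rewrite -[ltRHS]expR0 ltr_expR subr_lt0 => XB.
    rewrite ler_pdivlMr ?mulr_gt0 // [leLHS](_ : _ = lam * cnt c o); last by rewrite (cnt_freq n_gt0); ring.
    apply: le_trans (ltW XB); rewrite ler_wpM2r ?cnt_ge0 //.
    by rewrite ler_peMr // ltW.
  have [i ij] := exists_other j k2.
  have pM : lam * (1 + beta) ^+ M <= lam * (1 + beta) ^+ N.
    by rewrite ler_wpM2l ?(ltW lam0) // ler_weXn2l // ltnW.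
  rewrite exprSr mulrA; set be := lam * (1 + beta) ^+ M in pM *.
  have be0 : 0 <= be by rewrite mulr_ge0 ?(ltW lam0) // exprn_ge0 // addr_ge0.
  have be_bd : 0 <= be <= 1 / 6 by rewrite be0 (le_trans pM).
  have step := expect_expR_cnt n_gt0 ij be_bd (freqF j) phi0 (Vle c i j be freqF).
  have -> : expect p c (fun c' => expR (be * cnt c' j - B)) = expR (- B) * expect p c (fun c' => expR (be * cnt c' j)).
    by rewrite -expectZ; apply: eq_expect => c'; rewrite -expRD addrC.
  rewrite [X in _ <= expR X]addrC expRD ler_wpM2l ?expR_ge0 //; apply: le_trans step _.
  rewrite ler_expR ler_wpM2r ?cnt_ge0 //.
  rewrite ler_wpM2l // -addrA lerD2l; apply: le_trans rate.
  by rewrite lerD2l ler_wpM2l // mulr_ge0.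
Qed.

End SlowGrowth.

Section BalancedStart.
Context {R : realType}.

Lemma expR1_le : expR 1 <= 4 :> R.
Proof.
have -> : (1 : R) = 4%:R * (1 / 4) by field.
rewrite expRM_natl; apply: le_trans (lerXn2r 4 _ _ expR_quarter_le) _; rewrite ?nnegrE ?expR_ge0 //.
by lra.
Qed.

Lemma sum_le_invn (n k : nat) (P : pred 'I_k) (F : 'I_k -> R) : (0 < n)%N -> (k <= n)%N ->
  (forall i, P i -> F i <= expR (- (2%:R * ln n%:R))) -> \sum_(i | P i) F i <= n%:R^-1.
Proof.
move=> n_gt0 kn FP; have nR : 0 < n%:R :> R by rewrite ltr0n.
apply: le_trans (_ : _ <= \sum_(j : 'I_k) (n%:R ^+ 2)^-1) _.
  rewrite big_mkcond /=; apply: ler_sum => j _; case: ifP => [Pj|_].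
    by apply: le_trans (FP j Pj) _; rewrite expRN expRM_natl expR_ln_nat.
  by rewrite invr_ge0 sqr_ge0.
rewrite sumr_const card_ord -[leLHS]mulr_natr expr2 invfM -mulrA.
by rewrite ler_piMr ?invr_ge0 ?(ltW nR) // mulrC ler_pdivrMr // mul1r ler_nat.
Qed.

Lemma ln_sqr_le (a : R) : 1 <= a -> exists n0 : nat, forall n : nat, (n0 <= n)%N ->
  1 <= ln n%:R :> R /\ a * ln n%:R ^+ 2 <= n%:R :> R.
Proof.
move=> a1; have [n0 Hn0] := ln_nat_ge (6 * a); exists n0.+1 => n nn.
have n_gt0 : (0 < n)%N by apply: leq_trans nn.
have La := Hn0 n (ltnW nn); set L := ln n%:R in La *.
have L1 : 1 <= L by move: La a1; clear; lra.
have L0 : 0 <= L by apply: le_trans L1.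
split=> //; rewrite -(expR_ln_nat (R := R) n_gt0) -/L.
apply: le_trans (expR_ge1Dxn 2 L0); apply: ler_wpDl => //.
rewrite ler_pdivlMr ?ltr0n ?fact_gt0 // (_ : 3`! = 6)%N //.
have := ler_wpM2r (sqr_ge0 L) La; clear; rewrite -exprS; lra.
Qed.

(** Opinions are residues modulo [m]; within a class the quotient by [m] is injective, so at most
    [n / m + 1] vertices share an opinion. [m] may be below [k], as 3-Majority needs only about
    [sqrt n] opinions. *)
Lemma balanced_config (n k m : nat) : (0 < n)%N -> (2 <= m)%N -> (m <= k)%N -> (m <= n)%N ->
  exists2 c : config n k, ~~ is_consensus c & forall i, cnt c i <= 2 * n%:R / m%:R :> R.
Proof.
move=> n0 m2 mk mn; have m0 : (0 < m)%N by apply: ltnW.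
have lt_k (v : 'I_n) : (v %% m < k)%N by apply: leq_trans mk; rewrite ltn_mod.
pose c : config n k := [ffun v => Ordinal (lt_k v)].
exists c.
  apply/negP => /existsP[i /forallP ci]; have n1 : (1 < n)%N by apply: leq_trans mn.
  have := eqP (ci (Ordinal n0)); rewrite -(eqP (ci (Ordinal n1))) !ffunE => /(congr1 val) /=.
  by rewrite mod0n modn_small.
move=> i.
have m0R : 0 < m%:R :> R by rewrite ltr0n.
rewrite ler_pdivlMr // /cnt -natrM -natrM ler_nat.
pose f (v : 'I_n) : 'I_(n %/ m).+1 := inord (v %/ m).
have fE (v : 'I_n) : nat_of_ord (f v) = (v %/ m)%N.
  by rewrite inordK // ltnS leq_div2r // ltnW.
have /leq_trans : (opinion_count c i * m <= (n %/ m).+1 * m)%N.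
  rewrite leq_mul2r -[(n %/ m).+1](card_ord) orbC; apply/orP; left.
  apply: (@leq_card_in _ _ f) => u v; rewrite !inE => /eqP cu /eqP cv fuv.
  apply/val_inj => /=; rewrite (divn_eq u m) (divn_eq v m) -!fE fuv; congr (_ + _)%N.
  by move: cu; rewrite -cv !ffunE => /(congr1 val).
apply; rewrite mulSn addnC mul2n -addnn leq_add //; exact: leq_divM.
Qed.

(** Over [N] rounds the exponent varies by a factor at most [expR 1 <= 4], so [B] exceeds each
    initial exponent by [2 * L]: every term starts below [n ^- 2], and there are at most [n]
    terms. *)
Lemma balanced_slow (p : protocol) (n k m : nat) (lam beta phi L : R) (N : nat) (c : config n k) :
  (0 < n)%N -> (2 <= k)%N -> (0 < m)%N -> (forall i, cnt c i <= 2 * n%:R / m%:R :> R) -> (k <= n)%N ->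
  L = ln n%:R -> 0 <= L -> 0 < lam -> 4 * lam <= 1 / 6 -> 0 <= beta -> 0 <= phi ->
  let B := 8 * lam * n%:R / m%:R + 2 * L in
  B <= lam * n%:R -> B / (lam * n%:R) + 2 * phi * (4 * lam) <= beta -> N%:R * beta <= 1 ->
  (forall (c' : config n k) i j (be : R), (forall o, freq c' o <= B / (lam * n%:R)) ->
     pair_var p c' i j 0 be <= 2 * phi * be ^+ 2 * cnt c' j) ->
  1 - n%:R^-1 <= 1 - hit p (@is_consensus n k) N c :> R.
Proof.
move=> n_gt0 k2 m0 cm kn LE L0 lam0 lam6 beta0 phi0 B Bn rate Nb Vle.
have n0 : 0 < n%:R :> R by rewrite ltr0n.
have m0R : 0 < m%:R :> R by rewrite ltr0n.
have pow : (1 + beta) ^+ N <= 4.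
  apply: le_trans expR1_le; apply: le_trans (_ : _ <= expR (N%:R * beta)) _; last by rewrite ler_expR.
  by rewrite expRM_natl lerXn2r ?nnegrE ?expR_ge0 ?addr_ge0 // expR_ge1Dx.
have lp : lam * (1 + beta) ^+ N <= 4 * lam.
  by rewrite mulrC ler_wpM2r // ltW.
have B0 : 0 <= B by rewrite addr_ge0 ?mulr_ge0 ?invr_ge0 // ltW.
have lam6' := le_trans lp lam6.
have rate' : B / (lam * n%:R) + 2 * phi * (lam * (1 + beta) ^+ N) <= beta.
  by apply: le_trans rate; rewrite lerD2l ler_wpM2l // mulr_ge0.
rewrite lerD2l lerN2; apply: le_trans (consensus_slow n_gt0 c k2 lam0 beta0 phi0 B0 Bn lam6' rate' Vle) _.
apply: sum_le_invn => // i _; rewrite ler_expR -LE.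
have : lam * (1 + beta) ^+ N * cnt c i <= 4 * lam * (2 * n%:R / m%:R).
  by apply: ler_pM; rewrite ?cnt_ge0 ?mulr_ge0 ?exprn_ge0 ?addr_ge0 ?(ltW lam0).
by rewrite /B; clear; lra.
Qed.

Theorem maj3_consensus_slow : exists n0 : nat, forall n k : nat,
  (n0 <= n)%N -> (2 <= k)%N -> (k <= n)%N -> exists c : config n k,
  1 - n%:R^-1 <= prob_tau_ge R ThreeMajority c (Num.min (Num.sqrt n%:R) k%:R / ln n%:R ^+ 2).
Proof.
have [n1 H1] := ln_nat_ge (40 : R).
have a1 : 1 <= 24 ^+ 2 :> R by rewrite exprn_ege1 // ler1n.
have [n2 H2] := ln_sqr_le a1.
exists (n1 + n2 + 4).+1 => n k nn k2 kn.
have n_gt0 : (0 < n)%N by apply: leq_trans nn.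
have L40 : 40 <= ln n%:R :> R.
  by apply: H1; apply: leq_trans nn; rewrite -addnA -addnS leq_addr.
have [_ Lsq] : 1 <= ln n%:R :> R /\ 24 ^+ 2 * ln n%:R ^+ 2 <= n%:R :> R.
  by apply: H2; apply: leq_trans nn; rewrite -addnA addnCA -addnS leq_addr.
set L : R := ln n%:R in L40 Lsq *; set s : R := Num.sqrt n%:R.
have n0 : 0 < n%:R :> R by rewrite ltr0n.
have s0 : 0 <= s by exact: sqrtr_ge0.
have s2 : s * s = n%:R by rewrite -expr2 sqr_sqrtr.
have L0 : 0 < L by move: L40; clear; lra.
have n4 : 4 <= n%:R :> R by rewrite ler_nat; apply: leq_trans nn; apply: leqW; exact: leq_addl.
have s2le : 2 <= s.
  by rewrite -(ler_pXn2r (n := 2)) ?nnegrE // expr2 -natrM expr2 s2.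
pose m := minn k (Num.truncn s); set x := Num.min s k%:R / L ^+ 2.
have /andP[ts1 ts2] := truncn_itv s0.
have ts : (2 <= Num.truncn s)%N by rewrite truncn_ge_nat.
have m2 : (2 <= m)%N by rewrite leq_min k2.
have mk : (m <= k)%N by exact: geq_minl.
have ms : m%:R <= s by apply: le_trans ts1; rewrite ler_nat geq_minr.
have mn : (m <= n)%N by exact: leq_trans mk kn.
have m0R : 2 <= m%:R :> R by rewrite ler_nat.
have mM : Num.min s k%:R <= 2 * m%:R.
  rewrite /m; case: (leqP k (Num.truncn s)) => ks.
    by rewrite ge_min; apply/orP; right; rewrite ler_peMl // ler1n.
  rewrite ge_min; apply/orP; left; move: ts2; rewrite -natr1.
  have : 2 <= (Num.truncn s)%:R :> R by rewrite ler_nat.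
  by clear; lra.
have [c cons cm] := balanced_config n_gt0 m2 mk mn.
exists c; apply: le_trans (tau_ge_hit ThreeMajority n_gt0 c x).
have xM : x <= 2 * m%:R / L ^+ 2 by rewrite ler_wpM2r // invr_ge0 sqr_ge0.
have x0 : 0 <= x by rewrite divr_ge0 ?sqr_ge0 // le_min s0 ler0n.
(* For small [m] the claimed time is below 1, and it suffices that the start is not a consensus. *)
have [m20|m20] := ltP (m%:R : R) 20.
  have -> : Num.truncn x = 0%N.
    apply/eqP; rewrite truncn_eq // x0 /=; apply: le_lt_trans xM _.
    rewrite ltr_pdivrMr ?exprn_gt0 // mul1r.
    have : 40 * 40 <= L * L by apply: ler_pM.
    by move: m20; rewrite expr2; clear; lra.
  by rewrite /= (negbTE cons) subr0 lerBlDr lerDl invr_ge0 ltW.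
have m0 : 0 < m%:R :> R by move: m0R; clear; lra.
have nz : (n%:R != 0 :> R) * (m%:R != 0 :> R) * (L != 0) by rewrite !gt_eqF.
(* This makes [B] equal to [10 * L] and the frequency bound [10 / m]. The noise adds
   [8 * m * L / n], at most [8 * L / m] because [m <= sqrt n]; together they stay below
   [18 * L / m]. *)
pose lam := m%:R * L / n%:R; pose beta := 18 * L / m%:R.
have lam0 : 0 < lam by rewrite !mulr_gt0 ?invr_gt0.
have mmn : m%:R * m%:R <= n%:R :> R by rewrite -s2; apply: ler_pM => //; exact: ltW.
have Ln : L <= s / 24.
  rewrite -(ler_pXn2r (n := 2)) ?nnegrE ?(ltW L0) ?divr_ge0 // expr_div_n [s ^+ 2]expr2 s2.
  rewrite ler_pdivlMr; last by rewrite exprn_gt0.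
  by rewrite mulrC.
have lam6 : 4 * lam <= 1 / 6.
  rewrite /lam mulrA ler_pdivrMr //.
  have : m%:R * L <= s * (s / 24) by apply: ler_pM => //; exact: ltW.
  by rewrite mulrA s2; clear; lra.
have BE : 8 * lam * n%:R / m%:R + 2 * L = 10 * L by rewrite /lam; field; rewrite !nz.
have lamn : lam * n%:R = m%:R * L by rewrite /lam divfK ?nz.
apply: (balanced_slow (m := m) (lam := lam) (beta := beta) (phi := 1) (L := L)) => //.
- exact: leq_trans m2.
- exact: ltW.
- by rewrite divr_ge0 ?(ltW m0) // mulr_ge0 ?(ltW L0).
- rewrite BE lamn ler_wpM2r ?(ltW L0) //; move: m20; clear; lra.
- rewrite BE lamn /beta /lam.
  have -> : 10 * L / (m%:R * L) = 10 / m%:R :> R by field; rewrite !nz.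
  have Y0 : 0 <= L / m%:R by rewrite divr_ge0 ?(ltW L0) ?(ltW m0).
  have u1 : 10 / m%:R <= 10 * (L / m%:R).
    rewrite mulrA ler_wpM2r ?invr_ge0 ?(ltW m0) //; move: L40; clear; lra.
  have u2 : m%:R * L / n%:R <= L / m%:R.
    rewrite -subr_ge0 (_ : _ - _ = L * (n%:R - m%:R * m%:R) / (m%:R * n%:R)); last by field; rewrite !nz.
    by apply: divr_ge0; apply: mulr_ge0; rewrite ?subr_ge0 // ltW.
  by move: u1 u2; clear; lra.
- have : (Num.truncn x)%:R <= x by case/andP: (truncn_itv x0).
  move=> tx; apply: le_trans (_ : _ <= 2 * m%:R / L ^+ 2 * beta) _.
    by rewrite ler_wpM2r ?(le_trans tx) // divr_ge0 ?(ltW m0) // mulr_ge0 ?(ltW L0).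
  rewrite /beta (_ : _ * _ = 36 / L); last by field; rewrite !nz.
  rewrite ler_pdivrMr // mul1r; move: L40; clear; lra.
- by move=> c' i j be _; exact: single_var_le_maj3.
Qed.

Theorem choices2_consensus_slow : exists n0 : nat, forall n k : nat,
  (n0 <= n)%N -> (2 <= k)%N -> (k <= n)%N -> exists c : config n k,
  1 - n%:R^-1 <= prob_tau_ge R TwoChoices c (k%:R / ln n%:R ^+ 2).
Proof.
have [n1 H1] := ln_nat_ge (80 : R).
have a1 : 1 <= 10 ^+ 2 :> R by rewrite exprn_ege1 // ler1n.
have [n2 H2] := ln_sqr_le a1.
exists (n1 + n2).+1 => n k nn k2 kn.
have n_gt0 : (0 < n)%N by apply: leq_trans nn.
have L80 : 80 <= ln n%:R :> R.
  by apply: H1; apply: leq_trans nn; rewrite -addnS leq_addr.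
have [_ Lsq] : 1 <= ln n%:R :> R /\ 10 ^+ 2 * ln n%:R ^+ 2 <= n%:R :> R.
  by apply: H2; apply: leq_trans nn; rewrite -addSn leq_addl.
set L : R := ln n%:R in L80 Lsq *.
have n0 : 0 < n%:R :> R by rewrite ltr0n.
have L0 : 0 < L by move: L80; clear; lra.
set x := k%:R / L ^+ 2.
have [c cons cm] := balanced_config n_gt0 k2 (leqnn k) kn.
exists c; apply: le_trans (tau_ge_hit TwoChoices n_gt0 c x).
have k0R : 2 <= k%:R :> R by rewrite ler_nat.
have k0 : 0 < k%:R :> R by move: k0R; clear; lra.
have x0 : 0 <= x by rewrite divr_ge0 ?sqr_ge0 // ler0n.
have [k20|k20] := ltP (k%:R : R) 20.
  have -> : Num.truncn x = 0%N.
    apply/eqP; rewrite truncn_eq // x0 /= ltr_pdivrMr ?exprn_gt0 // mul1r.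
    have : 80 * 80 <= L * L by apply: ler_pM.
    by move: k20; rewrite expr2; clear; lra.
  by rewrite /= (negbTE cons) subr0 lerBlDr lerDl invr_ge0 ltW.
have nz : (n%:R != 0 :> R) * (k%:R != 0 :> R) * (L != 0) by rewrite !gt_eqF.
(* The variance of 2-Choices carries the frequency bound, so a constant exponent is affordable and
   no barrier at [sqrt n] arises; 1/24 makes [4 * lam] equal to 1/6. *)
pose lam : R := 1 / 24; pose beta := 80 * L / k%:R.
have L100 : 100 * L <= n%:R.
  apply: le_trans Lsq; have : 80 * L <= L * L by rewrite ler_wpM2r // ltW.
  by rewrite expr2; move: L80; clear; lra.
have knR : k%:R <= n%:R :> R by rewrite ler_nat.
pose B := 8 * lam * n%:R / k%:R + 2 * L.
have nk0 : 0 <= n%:R / k%:R :> R by rewrite divr_ge0 // ltW.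
have BE : B = 1 / 3 * (n%:R / k%:R) + 2 * L by rewrite /B /lam; field; rewrite !nz.
have nk20 : n%:R / k%:R <= n%:R / 20 :> R.
  by rewrite ler_wpM2l ?(ltW n0) // lef_pV2 ?posrE.
have Y0 : 0 <= L / k%:R by rewrite divr_ge0 ?(ltW L0) ?(ltW k0).
have FE : B / (lam * n%:R) = 8 / k%:R + 48 * (L / n%:R) by rewrite BE /lam; field; rewrite !nz.
have F0 : 0 <= B / (lam * n%:R).
  by rewrite FE addr_ge0 // ?mulr_ge0 ?invr_ge0 ?(ltW k0) ?(ltW L0) ?(ltW n0).
have Fle : B / (lam * n%:R) <= 50 * (L / k%:R).
  rewrite FE; have u1 : 80 * k%:R^-1 <= L * k%:R^-1 :> R by rewrite ler_wpM2r // invr_ge0 ltW.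
  have u2 : L / n%:R <= L / k%:R by rewrite ler_wpM2l ?(ltW L0) // lef_pV2 ?posrE.
  by move: u1 u2 Y0; clear; lra.
apply: (balanced_slow (m := k) (lam := lam) (beta := beta) (phi := B / (lam * n%:R)) (L := L)) => //.
- exact: ltnW.
- exact: ltW.
- by rewrite /lam; clear; lra.
- by rewrite /lam; clear; lra.
- by rewrite divr_ge0 ?(ltW k0) // mulr_ge0 ?(ltW L0).
- by rewrite -/B BE /lam; move: nk20 L100 n0; clear; lra.
- by rewrite -/B /beta; move: Fle F0; rewrite /lam; clear; lra.
- have : (Num.truncn x)%:R <= x by case/andP: (truncn_itv x0).
  move=> tx; apply: le_trans (_ : _ <= k%:R / L ^+ 2 * beta) _.
    by rewrite ler_wpM2r // divr_ge0 ?(ltW k0) // mulr_ge0 ?(ltW L0).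
  rewrite /beta (_ : _ * _ = 80 / L); last by field; rewrite !nz.
  by rewrite ler_pdivrMr // mul1r.
- by move=> c' i j be; exact: single_var_le_choices2.
Qed.

End BalancedStart.

(** * Plurality consensus *)

Section Plurality.
Context {R : realType}.

(** A consensus on another opinion needs [Phi] to reach 1, which for a process superharmonic below 1
    has probability at most the initial value. *)
Lemma consensus_on_transfer (p : protocol) (n k : nat) (n_gt0 : (0 < n)%N) (i : 'I_k)
    (Phi : config n k -> R) :
  (forall c, 0 <= Phi c) -> (forall c, Phi c < 1 -> expect p c Phi <= Phi c) ->
  (forall c, Phi c < 1 -> is_consensus c -> consensus_on c i) ->
  forall N c, hit p (@is_consensus n k) N c <= hit p (fun c' => consensus_on c' i) N c + Phi c.
Proof.
move=> Phi0 super on N; elim: N => [|N IH] c.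
  have [P1|P1] := ltP (Phi c) 1; last by rewrite ler_wpDl ?hit_ge0 // (le_trans (hit_le1 p n_gt0 _ _ _)).
  rewrite /=; case: ifP => [cc|_]; first by rewrite (on c P1 cc) lerDl.
  by rewrite addr_ge0 //; case: ifP.
have [P1|P1] := ltP (Phi c) 1; last by rewrite ler_wpDl ?hit_ge0 // (le_trans (hit_le1 p n_gt0 _ _ _)).
rewrite /=; case: ifP => [cc|cc]; first by rewrite (on c P1 cc) lerDl.
have -> : consensus_on c i = false.
  by apply: contraFF cc => ci; apply/existsP; exists i.
apply: le_trans (lerD (lexx _) (super c P1)); rewrite -expectD.
by apply: ler_expect => c'; exact: IH.
Qed.

Lemma reach_on_ge_hit (p : protocol) (n k : nat) (n_gt0 : (0 < n)%N) (c : config n k) (i : 'I_k) N :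
  hit p (fun c' => consensus_on c' i) N c <= prob_reach_on R p c i.
Proof.
have E M : prob_reach_within R p c i M = hit p (fun c' => consensus_on c' i) M c.
  exact: (probTraj_exists p (fun c' => consensus_on c' i) M c n_gt0).
have mono : {homo (prob_reach_within R p c i : nat -> R) : M M' / (M <= M')%N >-> M <= M'}.
  by move=> M M' MM; rewrite !E; apply: hit_nondecreasing.
rewrite -E /prob_reach_on; apply: nondecreasing_cvgn_le => //.
apply: nondecreasing_is_cvgn => //; exists 1 => _ [M _ <-].
by rewrite E hit_le1.
Qed.

Lemma reach_on_ge (p : protocol) (n k : nat) (n_gt0 : (0 < n)%N) (c : config n k) (i : 'I_k)
    (Phi : config n k -> R) (e1 e2 : R) N :
  (forall c, 0 <= Phi c) -> (forall c, Phi c < 1 -> expect p c Phi <= Phi c) ->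
  (forall c, Phi c < 1 -> is_consensus c -> consensus_on c i) ->
  1 - hit p (@is_consensus n k) N c <= e1 -> Phi c <= e2 ->
  1 - (e1 + e2) <= prob_reach_on R p c i.
Proof.
move=> Phi0 super on fast start.
apply: le_trans (reach_on_ge_hit p n_gt0 c i N).
have := consensus_on_transfer n_gt0 Phi0 super on N c; move: fast start; clear; lra.
Qed.

Lemma consensus_on_of_leader (n k : nat) (n_gt0 : (0 < n)%N) (c : config n k) (i : 'I_k) :
  (forall j, j != i -> cnt c j < cnt c i :> R) -> is_consensus c -> consensus_on c i.
Proof.
move=> lead /existsP[q /forallP cq]; have [<-|qi] := eqVneq q i; first by apply/forallP.
have := lead q qi; have -> : cnt c i = 0 :> R.
  rewrite /cnt /opinion_count; apply/eqP; rewrite pnatr_eq0; apply/eqP; apply: eq_card0 => v.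
  by rewrite !inE (eqP (cq v)); apply/negbTE.
by rewrite ltNge cnt_ge0.
Qed.

Lemma gam_le_second (n k : nat) (n_gt0 : (0 < n)%N) (c : config n k) (i : 'I_k) (e : R) :
  (forall j, j != i -> freq c j <= e) ->
  gam c <= freq c i ^+ 2 + (1 - freq c i) * e.
Proof.
move=> fe; rewrite /gam (bigD1 i) //= lerD2l.
have -> : 1 - freq c i = \sum_(j | j != i) freq c j :> R.
  by have := freq_sum1 (R := R) n_gt0 c; rewrite (bigD1 i) //= => <-; ring.
rewrite mulr_suml; apply: ler_sum => j ji; rewrite expr2 ler_wpM2l ?freq_ge0 //; exact: fe.
Qed.

Lemma leader_of_gap (n k : nat) (n_gt0 : (0 < n)%N) (c : config n k) (i : 'I_k) :
  (forall j, j != i -> cnt c j <= cnt c i :> R) -> forall o, freq c o <= freq c i :> R.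
Proof.
move=> lead o; rewrite /freq ler_wpM2r ?invr_ge0 ?ler0n //.
by have [->|oi] := eqVneq o i => //; exact: lead.
Qed.

(** With [e] a lower bound on all gaps of the leader, [a + b - g] is at least [b + (1 - a) * e]. For
    [a <= 2 * b] the part [b] suffices, otherwise the gap exceeds [a / 2] and the other part does.
    The factor [a * (1 - a)] matches the variance. *)
Lemma gap_drift (a b g e : R) : 0 <= b -> b <= a -> a <= 1 -> 0 <= e -> e <= a - b ->
  g <= a ^+ 2 + (1 - a) * (a - e) ->
  e * (a * (1 - a)) / 2 <= (a - b) * (a + b - g).
Proof.
move=> b0 ba a1 e0 eab gle; have a0 : 0 <= a by apply: le_trans ba.
have rle : b + (1 - a) * e <= a + b - g.
  by move: gle; clear; rewrite expr2; lra.
have ae0 : 0 <= (1 - a) * e by rewrite mulr_ge0 ?subr_ge0.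
have r0 : 0 <= a + b - g by apply: le_trans rle; rewrite addr_ge0.
have [ab|ab] := leP a (2 * b).
  apply: le_trans (_ : _ <= e * (a + b - g)) _; last by rewrite ler_wpM2r.
  have : e * (b + (1 - a) * e) <= e * (a + b - g) by rewrite ler_wpM2l.
  have : e * (a * (1 - a)) <= e * (2 * b).
    rewrite ler_wpM2l //; apply: le_trans ab; rewrite ler_piMr //; move: a0; clear; lra.
  have := mulr_ge0 e0 ae0; clear; lra.
apply: le_trans (_ : _ <= a / 2 * ((1 - a) * e)) _; first by clear; lra.
apply: ler_pM => //; first by rewrite divr_ge0.
  by move: ab; clear; lra.
by apply: le_trans rle; rewrite lerDr.
Qed.

Theorem maj3_plurality : exists (D : R) (n0 : nat), forall n k : nat,
  (n0 <= n)%N -> (2 <= k)%N -> (k <= n)%N -> forall (c : config n k) (i : 'I_k) (g : R),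
  (forall j, j != i -> cnt c j + g <= cnt c i) -> 0 < g -> 32 ^+ 2 * (n%:R * ln n%:R) <= g ^+ 2 ->
  1 - D / n%:R <= prob_reach_on R ThreeMajority c i.
Proof.
have [D [n0 fast]] := maj3_consensus_fast (R := R).
exists (D + 1), n0.+1 => n k nn k2 kn c i g gap g0 gbig.
have n_gt0 : (0 < n)%N by apply: leq_trans nn.
have nR : 0 < n%:R :> R by rewrite ltr0n.
have {}fast := fast n k (ltnW nn) (ltnW k2) kn c.
(* Half of the initial gap is defended, the other half makes [Phi] small at the start. The 128 keeps
   the noise, [51 / 100 * 14 / 128] times [d * (a * (1 - a))], below the drift, half of that
   quantity. *)
pose d := g / 2; pose lam := d / (128 * n%:R).
have d0 : 0 < d by rewrite divr_gt0.
have lam0 : 0 < lam by rewrite divr_gt0 // mulr_gt0.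
have gn : g <= n%:R.
  have [j ji] := exists_other i k2.
  have := gap j ji; have := cnt_ge0 c j (R := R).
  have : cnt c i <= n%:R :> R by rewrite (cnt_freq n_gt0) ler_piMr ?(ltW nR) // freq_le1.
  by clear; lra.
have lam_bd : 0 <= lam <= 1 / 100.
  rewrite ltW //= /lam ler_pdivrMr ?mulr_gt0 // /d; move: gn; have := ltW nR; clear; lra.
pose Phi (c' : config n k) := \sum_(j | j != i) expR (- (lam * (cnt c' i - cnt c' j)) + lam * d).
have gap_of (c' : config n k) : Phi c' < 1 -> forall j, j != i -> d <= cnt c' i - cnt c' j.
  move=> P1 j ji; have : expR (- (lam * (cnt c' i - cnt c' j)) + lam * d) <= Phi c'.
    by rewrite /Phi (bigD1 j) //= lerDl sumr_ge0 // => o _; exact: expR_ge0.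
  move/le_lt_trans => /(_ _ P1); rewrite -[ltRHS]expR0 ltr_expR addrC subr_lt0 ltr_pM2l //.
  exact: ltW.
rewrite mulrDl; apply: (reach_on_ge n_gt0 _ _ _ fast (Phi := Phi)).
- by move=> c'; apply: sumr_ge0 => j _; exact: expR_ge0.
- move=> c' P1; have gap' := gap_of c' P1.
  have lead : forall o, freq c' o <= freq c' i :> R.
    by apply: leader_of_gap => // j ji; have := gap' j ji; move: d0; clear; lra.
  rewrite /Phi expect_sum; apply: ler_sum => j ji.
  have ij : i != j by rewrite eq_sym.
  have -> : expect ThreeMajority c' (fun c'' => expR (- (lam * (cnt c'' i - cnt c'' j)) + lam * d)) =
      expR (lam * d) * expect ThreeMajority c' (fun c'' => expR (- (lam * (cnt c'' i - cnt c'' j)))).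
    by rewrite -expectZ; apply: eq_expect => c''; rewrite -expRD addrC.
  rewrite addrC expRD ler_wpM2l ?expR_ge0 //.
  have /andP[_ up] := bias_exp_bounds ThreeMajority n_gt0 c' ij lam_bd.
  apply: le_trans up _; rewrite -expRD ler_expR.
  have V := pair_var_maj3_le_compl n_gt0 ij lead.
  have [b0 ba ab1 ga gab] := leader_facts n_gt0 ij lead.
  have e0 : 0 <= d / n%:R by rewrite divr_ge0 // ltW.
  have eab o : o != i -> d / n%:R <= freq c' i - freq c' o.
    move=> oi; rewrite /freq -mulrBl ler_wpM2r ?invr_ge0 ?(ltW nR) //; exact: gap'.
  have second : gam c' <= freq c' i ^+ 2 + (1 - freq c' i) * (freq c' i - d / n%:R).
    by apply: gam_le_second => // o oi; have := eab o oi; clear; lra.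
  have := gap_drift b0 ba (freq_le1 n_gt0 c' i) e0 (eab j ji) second.
  set a := freq c' i in ba ab1 ga gab V second *; set b := freq c' j in b0 ba ab1 gab *.
  set r := a + b - gam c'.
  have dE : cnt c' i - cnt c' j = n%:R * (a - b) :> R by rewrite !(cnt_freq n_gt0) mulrBr.
  move=> /(ler_wpM2l (ltW nR)) drift.
  have {}drift : d * (a * (1 - a)) / 2 <= (cnt c' i - cnt c' j) * r.
    rewrite dE -[leRHS]mulrA; apply: le_trans drift.
    by rewrite le_eqVlt; apply/orP; left; apply/eqP; field; rewrite gt_eqF.
  have lV : lam * pair_var ThreeMajority c' i j 1 1 <= d * (a * (1 - a)) * (14 / 128).
    apply: le_trans (ler_wpM2l (ltW lam0) V) _; rewrite /lam le_eqVlt; apply/orP; left; apply/eqP.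
    by field; rewrite gt_eqF.
  have aa0 : 0 <= d * (a * (1 - a)).
    have a0 : 0 <= a by exact: freq_ge0.
    have a1 : 0 <= 1 - a by rewrite subr_ge0; exact: freq_le1.
    by apply: mulr_ge0; [exact: ltW|exact: mulr_ge0].
  have step : 51 / 100 * (lam * pair_var ThreeMajority c' i j 1 1) <= (cnt c' i - cnt c' j) * r.
    by move: lV drift aa0; clear; lra.
  have := ler_wpM2l (ltW lam0) step; clear; lra.
- move=> c' P1; apply: consensus_on_of_leader => // j ji.
  by have := gap_of c' P1 j ji; move: d0; clear; lra.
- have start j : j != i -> expR (- (lam * (cnt c i - cnt c j)) + lam * d) <= expR (- (2%:R * ln n%:R)).
    move=> ji; rewrite ler_expR.
    have : lam * g <= lam * (cnt c i - cnt c j).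
      by rewrite ler_wpM2l ?(ltW lam0) //; have := gap j ji; clear; lra.
    have : 2%:R * ln n%:R <= lam * (g - d).
      (* Source of the constant 32: twice 512 is its square. *)
      rewrite (_ : lam * (g - d) = g ^+ 2 / (32 * 16 * n%:R)); last by rewrite /lam /d; field; rewrite gt_eqF.
      rewrite ler_pdivlMr ?mulr_gt0 //; apply: le_trans gbig.
      by clear; lra.
    by clear; lra.
  by rewrite mul1r; apply: sum_le_invn.
Qed.

(** For 2-Choices a proportional margin [(1 - rho) * a - b] is defended, because the noise is
    proportional to [a ^+ 2 * (1 - a)] and only such a margin has a drift of the same form. For
    [a <= 4 * b] the second term suffices, otherwise the first. *)
Lemma relative_gap_drift (a b g rho : R) : 0 <= b -> b <= (1 - rho) * a -> a <= 1 -> 0 <= rho -> rho <= 1 / 2 ->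
  g <= a ^+ 2 + (1 - a) * ((1 - rho) * a) ->
  rho * (a ^+ 2 * (1 - a)) / 4 <= ((1 - rho) * a - b) * (a - g) + b * (a - b).
Proof.
move=> b0 ba a1 r0 r2 gle.
have a0 : 0 <= a.
  have : 0 <= (1 - rho) * a by apply: le_trans ba.
  by rewrite pmulr_rge0 //; move: r2; clear; lra.
have ra0 : 0 <= rho * a by rewrite mulr_ge0.
have a10 : 0 <= 1 - a by rewrite subr_ge0.
have ag : (1 - a) * (rho * a) <= a - g by move: gle; clear; rewrite expr2; lra.
have ag0 : 0 <= a - g by apply: le_trans ag; rewrite mulr_ge0.
have abr : rho * a <= a - b by move: ba; clear; lra.
have raa : 0 <= rho * a * a by rewrite mulr_ge0.
have main0 : 0 <= ((1 - rho) * a - b) * (a - g) by rewrite mulr_ge0 // subr_ge0.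
have bb0 : 0 <= b * (a - b) by rewrite mulr_ge0 //; apply: le_trans abr.
have raa1 : rho * a * a * (1 - a) <= rho * a * a by rewrite ler_piMr // lerBlDr lerDl.
have [ab|ab] := leP a (4 * b).
  have : a / 4 * (rho * a) <= b * (a - b).
    by apply: ler_pM; rewrite ?divr_ge0 //; move: ab; clear; lra.
  by move: main0 raa1; clear; rewrite expr2; lra.
have : a / 4 * ((1 - a) * (rho * a)) <= ((1 - rho) * a - b) * (a - g).
  apply: ler_pM; rewrite ?divr_ge0 ?mulr_ge0 //.
  have : rho * a <= 1 / 2 * a by rewrite ler_wpM2r.
  by move: ab; clear; lra.
by move: bb0; clear; rewrite expr2; lra.
Qed.

Theorem choices2_plurality : exists (D : R) (n0 : nat), forall n k : nat,
  (n0 <= n)%N -> (2 <= k)%N -> (k <= n)%N -> forall (c : config n k) (i : 'I_k) (g : R),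
  (forall j, j != i -> cnt c j + g <= cnt c i) -> 0 < g ->
  24 ^+ 2 * (cnt c i * ln n%:R) <= g ^+ 2 ->
  1 - D / n%:R <= prob_reach_on R TwoChoices c i.
Proof.
have [D [n0 fast]] := choices2_consensus_fast (R := R).
exists (D + 1), n0.+1 => n k nn k2 kn c i g gap g0 gbig.
have n_gt0 : (0 < n)%N by apply: leq_trans nn.
have nR : 0 < n%:R :> R by rewrite ltr0n.
have {}fast := fast n k (ltnW nn) (ltnW k2) kn c.
set X := cnt c i in gbig gap.
have gX : g <= X.
  have [j ji] := exists_other i k2.
  by have := gap j ji; have := cnt_ge0 c j (R := R); clear; lra.
have X0 : 0 < X by apply: lt_le_trans gX.
(* Half of the initial relative gap [g / X] is defended. With 36 the noise is about [11 / 72] of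
   [lam * T], against a drift of a quarter. *)
pose rho := g / (2 * X); pose lam := rho / 36.
have rho0 : 0 < rho by rewrite divr_gt0 // mulr_gt0.
have rho2 : rho <= 1 / 2 by rewrite /rho ler_pdivrMr ?mulr_gt0 //; move: gX; clear; lra.
have lam0 : 0 < lam by rewrite divr_gt0.
pose gapf (c' : config n k) j : R := (1 - rho) * cnt c' i - cnt c' j.
pose Phi (c' : config n k) := \sum_(j | j != i) expR (- (lam * gapf c' j)).
have gap_of (c' : config n k) : Phi c' < 1 -> forall j, j != i -> 0 < gapf c' j.
  move=> P1 j ji; have : expR (- (lam * gapf c' j)) <= Phi c'.
    by rewrite /Phi (bigD1 j) //= lerDl sumr_ge0 // => o _; exact: expR_ge0.
  by move/le_lt_trans => /(_ _ P1); rewrite -[ltRHS]expR0 ltr_expR oppr_lt0 pmulr_rgt0.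
have lead_of (c' : config n k) : Phi c' < 1 -> forall j, j != i -> cnt c' j < cnt c' i :> R.
  move=> P1 j ji; have := gap_of c' P1 j ji; rewrite /gapf.
  have : 0 <= rho * cnt c' i by rewrite mulr_ge0 ?cnt_ge0 // ltW.
  by clear; lra.
rewrite mulrDl; apply: (reach_on_ge n_gt0 _ _ _ fast (Phi := Phi)).
- by move=> c'; apply: sumr_ge0 => j _; exact: expR_ge0.
- move=> c' P1; have gap' := gap_of c' P1.
  have lead : forall o, freq c' o <= freq c' i :> R.
    by apply: leader_of_gap => // j ji; exact: (ltW (lead_of c' P1 j ji)).
  rewrite /Phi expect_sum; apply: ler_sum => j ji.
  have ij : i != j by rewrite eq_sym.
  pose al := lam * (1 - rho).
  have r10 : 0 <= 1 - rho by move: rho2; clear; lra.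
  have al_bd : 0 <= al <= lam.
    by rewrite mulr_ge0 ?(ltW lam0) //= ler_piMr ?(ltW lam0) // lerBlDr lerDl ltW.
  have be_bd : 0 <= lam <= lam by rewrite ltW /=.
  have lam72 : lam <= 1 / 72 by rewrite /lam; move: rho2; clear; lra.
  have lam6 : lam <= 1 / 6 by move: lam72; clear; lra.
  have /andP[_ up] := laplace_bounds TwoChoices n_gt0 c' ij al_bd be_bd lam6.
  have -> : expect TwoChoices c' (fun c'' => expR (- (lam * gapf c'' j))) =
      expect TwoChoices c' (fun c'' => expR (lam * cnt c'' j - al * cnt c'' i)).
    by apply: eq_expect => c''; congr expR; rewrite /gapf /al; ring.
  apply: le_trans up _; rewrite ler_expR.
  have W0 := pair_var_ge0 TwoChoices n_gt0 c' al lam ij.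
  have W1 := pair_var_le n_gt0 TwoChoices c' ij al_bd be_bd.
  set W := pair_var _ _ _ _ al lam in W0 W1 *.
  have V := pair_var_choices2_le_compl n_gt0 ij lead.
  have [b0 ba ab1 ga gab] := leader_facts n_gt0 ij lead.
  have fgap o : o != i -> freq c' o <= (1 - rho) * freq c' i.
    move=> oi; rewrite /freq mulrA ler_wpM2r ?invr_ge0 ?(ltW nR) //.
    by have := gap' o oi; rewrite /gapf subr_gt0 => /ltW.
  have second := gam_le_second n_gt0 fgap.
  have a1 : freq c' i <= 1 :> R := freq_le1 n_gt0 c' i.
  have := relative_gap_drift b0 (fgap j ji) a1 (ltW rho0) rho2 second.
  have XE : cnt c' i = n%:R * freq c' i :> R := cnt_freq n_gt0 c' i.
  have YE : cnt c' j = n%:R * freq c' j :> R := cnt_freq n_gt0 c' j.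
  rewrite /mean_cnt /gapf XE YE.
  have a0 : 0 <= freq c' i :> R by exact: freq_ge0.
  set a := freq c' i in a0 a1 V *; set b := freq c' j; set gm := gam c'.
  move=> /(ler_wpM2l (ltW nR)) drift.
  set T := n%:R * (rho * (a ^+ 2 * (1 - a))).
  have T0 : 0 <= T.
    have a10 : 0 <= 1 - a by rewrite subr_ge0.
    by do 2?[apply: mulr_ge0; first exact: ltW]; apply: mulr_ge0; rewrite ?sqr_ge0.
  have lW : W <= lam * (T * (11 / 36)).
    apply: le_trans W1 _; rewrite expr2 -mulrA ler_wpM2l ?(ltW lam0) //.
    apply: le_trans (ler_wpM2l (ltW lam0) V) _; rewrite /lam /T le_eqVlt; apply/orP; left; apply/eqP.
    by field.
  have Wh : W / 2 * (1 + 2 * lam) <= lam * (T / 4).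
    have : W * lam <= W * (1 / 72) by rewrite ler_wpM2l.
    have := mulr_ge0 (ltW lam0) T0.
    by move: lW W0; clear; lra.
  have TE : T / 4 <= n%:R * (rho * (a ^+ 2 * (1 - a)) / 4) by rewrite /T; clear; lra.
  have := ler_wpM2l (ltW lam0) (le_trans TE drift); rewrite /al => H.
  by move: H Wh; clear; lra.
- by move=> c' P1; apply: (consensus_on_of_leader n_gt0); exact: (lead_of c' P1).
- have start j : j != i -> expR (- (lam * gapf c j)) <= expR (- (2%:R * ln n%:R)).
    move=> ji; rewrite ler_expR lerN2.
    have rX : rho * X = g / 2 by rewrite /rho; field; rewrite gt_eqF.
    apply: le_trans (_ : _ <= lam * (g / 2)) _; last first.
      rewrite ler_wpM2l ?(ltW lam0) // /gapf -/X; have := gap j ji; move: rX; clear; lra.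
    rewrite (_ : lam * (g / 2) = g ^+ 2 / (12 * 12 * X)); last by rewrite /lam /rho; field; rewrite gt_eqF.
    rewrite ler_pdivlMr ?mulr_gt0 //; apply: le_trans gbig.
    have L0 : 0 <= ln n%:R :> R by rewrite ln_ge0 // ler1n.
    by have := mulr_ge0 (ltW X0) L0; clear; lra.
  by rewrite mul1r; apply: sum_le_invn.
Qed.

End Plurality.

(** * Asymptotic form of the bounds *)

Section Assembly.
Context {R : realType}.

Lemma sqr_ge_of_ratio (g s a : R) : 0 < a -> 0 <= s -> a <= g / Num.sqrt s ->
  0 < g /\ a ^+ 2 * s <= g ^+ 2.
Proof.
move=> a0 s0 ag; have q0 : 0 <= Num.sqrt s by exact: sqrtr_ge0.
have {}q0 : 0 < Num.sqrt s.
  (* Division by zero yields 0, so a vanishing root contradicts [0 < a]. *)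
  rewrite lt_neqAle q0 andbT eq_sym; apply/eqP => q0'.
  by move: ag; rewrite q0' invr0 mulr0 leNgt a0.
move: ag; rewrite ler_pdivlMr // => ag.
have g0 : 0 < g by apply: lt_le_trans ag; rewrite mulr_gt0.
split=> //; rewrite -[s in leLHS](sqr_sqrtr s0) -exprMn lerXn2r ?nnegrE ?(ltW g0) //.
by rewrite mulr_ge0 // ltW.
Qed.

End Assembly.

Local Open Scope classical_set_scope.

Theorem mainTheorem1 (R : realType) :
  (* (1) 3-Majority: upper bound for every initial configuration *)
  (exists (C c D : R) (n0 : nat), 0 < c /\
     forall (n k : nat), (n0 <= n)%N -> (2 <= k)%N -> (k <= n)%N ->
     forall c0 : config n k,
       prob_tau_le R ThreeMajority c0
         (Num.min (Num.sqrt (n%:R)) (k%:R) * (ln (n%:R : R)) `^ C)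
       >= 1 - D * (n%:R `^ (- c)))
  /\
  (* (1) 3-Majority: matching lower bound for some initial configuration *)
  (exists (C c D : R) (n0 : nat), 0 < c /\
     forall (n k : nat), (n0 <= n)%N -> (2 <= k)%N -> (k <= n)%N ->
     exists c0 : config n k,
       prob_tau_ge R ThreeMajority c0
         (Num.min (Num.sqrt (n%:R)) (k%:R) / (ln (n%:R : R)) `^ C)
       >= 1 - D * (n%:R `^ (- c)))
  /\
  (* (2) 3-Majority: plurality consensus *)
  (forall (kseq : nat -> nat) (c0 : forall n, config n (kseq n))
          (i : forall n, 'I_(kseq n)) (g : nat -> R),
     (\forall n \near \oo, (2 <= kseq n)%N && (kseq n <= n)%N) ->
     ((fun n => (kseq n)%:R / (Num.sqrt (n%:R) / ln (n%:R : R)) : R)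
        @ \oo --> (0 : R)) ->
     (\forall n \near \oo, forall j : 'I_(kseq n), j != i n ->
        (opinion_count (c0 n) j)%:R + g n <= (opinion_count (c0 n) (i n))%:R) ->
     ((fun n => g n / Num.sqrt (n%:R * ln (n%:R : R))) @ \oo --> +oo) ->
     exists (c D : R), 0 < c /\
       \forall n \near \oo,
         prob_reach_on R ThreeMajority (c0 n) (i n) >= 1 - D * (n%:R `^ (- c)))
  /\
  (* (3) 2-Choices: upper bound for every initial configuration *)
  (exists (C c D : R) (n0 : nat), 0 < c /\
     forall (n k : nat), (n0 <= n)%N -> (2 <= k)%N -> (k <= n)%N ->
     forall c0 : config n k,
       prob_tau_le R TwoChoices c0 (k%:R * (ln (n%:R : R)) `^ C)
       >= 1 - D * (n%:R `^ (- c)))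
  /\
  (* (3) 2-Choices: matching lower bound for some initial configuration *)
  (exists (C c D : R) (n0 : nat), 0 < c /\
     forall (n k : nat), (n0 <= n)%N -> (2 <= k)%N -> (k <= n)%N ->
     exists c0 : config n k,
       prob_tau_ge R TwoChoices c0 (k%:R / (ln (n%:R : R)) `^ C)
       >= 1 - D * (n%:R `^ (- c)))
  /\
  (* (4) 2-Choices: plurality consensus *)
  (forall (kseq : nat -> nat) (c0 : forall n, config n (kseq n))
          (i : forall n, 'I_(kseq n)) (g : nat -> R),
     (\forall n \near \oo, (2 <= kseq n)%N && (kseq n <= n)%N) ->
     ((fun n => (kseq n)%:R / (n%:R / (ln (n%:R : R)) ^+ 2) : R)
        @ \oo --> (0 : R)) ->
     (\forall n \near \oo, forall j : 'I_(kseq n), j != i n ->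
        (opinion_count (c0 n) j)%:R + g n <= (opinion_count (c0 n) (i n))%:R) ->
     ((fun n => g n /
         Num.sqrt ((opinion_count (c0 n) (i n))%:R / n%:R * n%:R * ln (n%:R : R)))
        @ \oo --> +oo) ->
     exists (c D : R), 0 < c /\
       \forall n \near \oo,
         prob_reach_on R TwoChoices (c0 n) (i n) >= 1 - D * (n%:R `^ (- c))).
Proof.
have ln0 (n k : nat) : (2 <= k)%N -> (k <= n)%N -> 0 <= ln (n%:R : R).
  by move=> k2 kn; rewrite ln_ge0 // ler1n; apply: leq_trans kn; apply: ltnW.
have pos (n k : nat) : (2 <= k)%N -> (k <= n)%N -> (0 < n)%N.
  by move=> k2 kn; apply: leq_trans kn; apply: ltnW.
split; [|split; [|split; [|split; [|split]]]].
- have [D [n0 fast]] := maj3_consensus_fast (R := R).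
  exists 3%:R, 1, D, n0; split=> // n k nn k2 kn c0.
  rewrite powR_mulrn ?(ln0 n k) // powR_inv1 // /prob_tau_le.
  rewrite (probTraj_exists ThreeMajority (@is_consensus n k) _ c0 (pos n k k2 kn)).
  by have := fast n k nn (ltnW k2) kn c0; rewrite lerBlDr addrC -lerBlDr.
- have [n0 slow] := maj3_consensus_slow (R := R).
  exists 2%:R, 1, 1, n0; split=> // n k nn k2 kn.
  have [c0 Hc] := slow n k nn k2 kn; exists c0.
  by rewrite powR_mulrn ?(ln0 n k) // powR_inv1 // mul1r.
- move=> kseq c0 i g hk _ gap gbig.
  have [D [n0 plur]] := maj3_plurality (R := R).
  exists 1, D; split=> //.
  have {}gbig := (cvgryPge _).1 gbig 32.
  near=> n.
  have /andP[k2 kn] : (2 <= kseq n)%N && (kseq n <= n)%N by near: n.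
  have [g0 g2] : 0 < g n /\ 32 ^+ 2 * (n%:R * ln n%:R) <= g n ^+ 2.
    apply: sqr_ge_of_ratio => //; first by rewrite mulr_ge0 // (ln0 _ _ k2 kn).
    by near: n; exact: gbig.
  rewrite powR_inv1 //; apply: (plur n (kseq n) _ k2 kn (c0 n) (i n) (g n) _ g0 g2).
    by near: n; exists n0.
  by near: n; exact: gap.
- have [D [n0 fast]] := choices2_consensus_fast (R := R).
  exists 3%:R, 1, D, n0; split=> // n k nn k2 kn c0.
  rewrite powR_mulrn ?(ln0 n k) // powR_inv1 // /prob_tau_le.
  rewrite (probTraj_exists TwoChoices (@is_consensus n k) _ c0 (pos n k k2 kn)).
  by have := fast n k nn (ltnW k2) kn c0; rewrite lerBlDr addrC -lerBlDr.
- have [n0 slow] := choices2_consensus_slow (R := R).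
  exists 2%:R, 1, 1, n0; split=> // n k nn k2 kn.
  have [c0 Hc] := slow n k nn k2 kn; exists c0.
  by rewrite powR_mulrn ?(ln0 n k) // powR_inv1 // mul1r.
- move=> kseq c0 i g hk _ gap gbig.
  have [D [n0 plur]] := choices2_plurality (R := R).
  exists 1, D; split=> //.
  have {}gbig := (cvgryPge _).1 gbig 24.
  near=> n.
  have /andP[k2 kn] : (2 <= kseq n)%N && (kseq n <= n)%N by near: n.
  have nz : n%:R != 0 :> R by rewrite pnatr_eq0 -lt0n (pos _ _ k2 kn).
  have [g0 g2] : 0 < g n /\ 24 ^+ 2 * (cnt (c0 n) (i n) * ln n%:R) <= g n ^+ 2.
    apply: sqr_ge_of_ratio => //; first by rewrite mulr_ge0 ?cnt_ge0 // (ln0 _ _ k2 kn).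
    rewrite -[cnt _ _](divfK nz); near: n; exact: gbig.
  rewrite powR_inv1 //; apply: (plur n (kseq n) _ k2 kn (c0 n) (i n) (g n) _ g0 g2).
    by near: n; exists n0.
  by near: n; exact: gap.
Unshelve. all: by end_near.
Qed.
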